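(* Let $d\ge1$, $s\in[0,1]$, and let $\Omega,\gamma,\mathbb{T}$ and, for $\mathcal{T}\in\mathbb{T}$, the integer $L=L(\mathcal{T})$, the hierarchy $\mathcal{T}_0\prec\cdots\prec\mathcal{T}_L=\mathcal{T}$ and the matrices $\boldsymbol{E}_{\mathcal{T}},\boldsymbol{H}_j,\boldsymbol{R}_j,\boldsymbol{P}_j$ be as defined in the context. Let $$\boldsymbol{B}_{\mathcal{T}}^{\mathscr{S}}:=\boldsymbol{E}_{\mathcal{T}}^\top\Big(\sum_{j=0}^{L}(\boldsymbol{H}_j\boldsymbol{R}_j-\boldsymbol{P}_j\boldsymbol{H}_{j-1}\boldsymbol{R}_{j-1})^\top\,2^{j(\frac{2s}{d}-1)}\,(\boldsymbol{H}_j\boldsymbol{R}_j-\boldsymbol{P}_j\boldsymbol{H}_{j-1}\boldsymbol{R}_{j-1})\Big)\boldsymbol{E}_{\mathcal{T}} .$$ Then the application of $\boldsymbol{B}_{\mathcal{T}}^{\mathscr{S}}$ can be computed in $\mathcal{O}(\#\mathcal{T})$ operations; that is, there is a constant $C$, independent of $\mathcal{T}\in\mathbb{T}$, such that for every $\mathcal{T}\in\mathbb{T}$ and every vector $\vec{x}\in\mathbb{R}^{\dim\mathscr{S}_{\mathcal{T},0}^{0,1}}$ the vector $\boldsymbol{B}_{\mathcal{T}}^{\mathscr{S}}\vec{x}$ can be computed in at most $C\,\#\mathcal{T}$ arithmetic operations.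
   Context: **Spaces and partitions.** $\Omega\subset\mathbb{R}^d$ is a domain that admits the partitions below; $\gamma\subset\partial\Omega$ is closed, possibly empty; $H^1_{0,\gamma}(\Omega)$ is the closure in $H^1(\Omega)$ of the smooth functions on $\Omega$ that vanish at $\gamma$. Partitions are conforming partitions of $\Omega$ into open $d$-simplices, and $\gamma$ is a (possibly empty) union of $(d-1)$-faces of simplices of each partition. For $d\ge2$, $\mathbb{T}$ is the family of all conforming partitions of $\Omega$ that can be created by Newest Vertex Bisection from a given fixed conforming initial partition $\mathcal{T}_\bot$ satisfying the matching condition. For $d=1$, $\mathbb{T}$ is the family of partitions of the interval $\Omega$ that can be constructed by bisections from $\mathcal{T}_\bot=\{\Omega\}$ such that the generations of any two neighbouring subintervals differ by at most one. *Newest Vertex Bisection ($d\ge 2$).* Simplices are tagged: $T=(z_0,\dots,z_d)_g$ with an ordering of the vertices and a type $g\in\{0,\dots,d-1\}$. $T$ is bisected at the midpoint $m=\frac{z_0+z_d}{2}$ of $z_0z_d$ into $(z_0,m,z_1,\dots,z_g,z_{g+1},\dots,z_{d-1})_{g+1 \bmod d}$ and $(z_d,m,z_1,\dots,z_g,z_{d-1},\dots,z_{g+1})_{g+1\bmod d}$. With $T_R:=(z_d,z_1,\dots,z_g,z_{d-1},\dots,z_{g+1},z_0)_g$ (which has the same children), two simplices sharing a $(d-1)$-face are reflected neighbours if they have the same type and the vertex ordering of $T$ or $T_R$ coincides with that of $T'$ in all but one position. Matching condition: all $T\in\mathcal{T}_\bot$ have the same type, and for any two $T,T'\in\mathcal{T}_\bot$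 sharing a $(d-1)$-face: if the refinement edge $z_0z_d$ of $T$ or that of $T'$ lies in $\overline T\cap\overline{T'}$ then $T,T'$ are reflected neighbours; otherwise the two neighbouring children of $T$ and $T'$ are reflected neighbours. **Generations and hierarchy.** $N_T$ is the set of vertices of a simplex $T$; $N_{\mathcal{T}}$ the set of vertices of $\mathcal{T}$, $N_{\mathcal{T}}^0$ those not on $\gamma$. Let $\mathfrak{T}:=\bigcup_{\mathcal{T}\in\mathbb{T}}\{T:T\in\mathcal{T}\}$ and $\mathfrak{N}:=\bigcup_{\mathcal{T}\in\mathbb{T}}N_{\mathcal{T}}$. For $T\in\mathfrak{T}$, $\mathrm{gen}(T)$ is the number of bisections needed to create $T$ from its ancestor in $\mathcal{T}_\bot$; for $\nu\in\mathfrak{N}$, $\mathrm{gen}(\nu):=\min\{\mathrm{gen}(T):T\in\mathfrak{T},\nu\in N_T\}$. For $\mathcal{T}\in\mathbb{T}$ put $L=L(\mathcal{T}):=\max_{T\in\mathcal{T}}\mathrm{gen}(T)$ and define $\mathcal{T}_\bot=\mathcal{T}_0\prec\mathcal{T}_1\prec\cdots\prec\mathcal{T}_L=\mathcal{T}$ in $\mathbb{T}$ by constructing $\mathcal{T}_{j-1}$ from $\mathcal{T}_j$ by removing all vertices $\nu\in N_{\mathcal{T}_j}$ with $\mathrm{gen}(\nu)=j$ (i.e. replacing each pair of sibling simplices of generation $j$ by their parent). Write $N_j^0:=N^0_{\mathcal{T}_j}$. The partition $\mathcal{T}$ is represented as the set of leaves of a binary forest whose roots are the simplices of $\mathcal{T}_\bot$,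 each non-leaf having as children the two simplices created by its bisection. **Finite element spaces.** $\mathscr{S}_{\mathcal{T},0}^{0,1}:=\{u\in H^1_{0,\gamma}(\Omega):u|_T\in\mathcal{P}_1\ (T\in\mathcal{T})\}$, with nodal basis $\Phi_{\mathcal{T}}$ associated to $N_{\mathcal{T}}^0$; $\mathscr{S}_{\mathcal{T}}^{-1,1}$ is the space of discontinuous piecewise linears w.r.t. $\mathcal{T}$, with element-wise nodal basis. ($\mathcal{P}_1$: polynomials of degree at most 1.) All matrices below are representations w.r.t. these bases. **Matrices.** - $\boldsymbol{E}_{\mathcal{T}}$ represents the embedding $\mathscr{S}_{\mathcal{T},0}^{0,1}\to\mathscr{S}_{\mathcal{T}}^{-1,1}$. - For $0\le j\le L$, $\boldsymbol{R}_j$ represents the $L_2(\Omega)$-orthogonal projector of $\mathscr{S}_{\mathcal{T}}^{-1,1}$ onto $\mathscr{S}_{\mathcal{T}_j}^{-1,1}$; $\boldsymbol{R}_{-1}:=0$. - For $0\le j\le L$, $\boldsymbol{H}_j$ represents $H_j\colon\mathscr{S}_{\mathcal{T}_j}^{-1,1}\to\mathscr{S}_{\mathcal{T}_j,0}^{0,1}$ given by $(H_ju)(\nu)=\frac{\sum_{\{T\in\mathcal{T}_j:\nu\in N_T\}}|T|\,u|_T(\nu)}{\sum_{\{T\in\mathcal{T}_j:\nu\in N_T\}}|T|}$ for $\nu\in N_j^0$; $\boldsymbol{H}_{-1}:=0$. - For $1\le j\le L$, $\boldsymbol{P}_j$ represents the embedding $\mathscr{S}_{\mathcal{T}_{j-1},0}^{0,1}\to\mathscr{S}_{\mathcal{T}_j,0}^{0,1}$;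 $\boldsymbol{P}_0:=0$. *)

(* Defs.v *)
Set Warnings "-all".
From HB Require Import structures.
From mathcomp Require Import all_boot all_order all_algebra finmap.
From mathcomp Require Import all_classical all_reals all_analysis.

Set Implicit Arguments.
Unset Strict Implicit.
Unset Printing Implicit Defensive.

Import Order.TTheory GRing.Theory Num.Theory.
Import numFieldNormedType.Exports.

Local Open Scope classical_set_scope.
Local Open Scope ring_scope.

Definition rV_display : measure_display -> measure_display.
Proof. exact. Qed.

(* The product sigma-algebra on row vectors. *)
Section measurable_rV.
Context {d : measure_display} {T : sigmaRingType d}.
Variable n : nat.

Let coords : 'I_n -> 'rV[T]_n -> T := fun i x => x ord0 i.

Let rV_set0 : g_sigma_preimage coords set0.
Proof. exact: sigma_algebra0. Qed.

Let rV_setC A : g_sigma_preimage coords A -> g_sigma_preimage coords (~` A).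
Proof. exact: sigma_algebraC. Qed.

Let rV_bigcup (F : _^nat) : (forall i, g_sigma_preimage coords (F i)) ->
  g_sigma_preimage coords (\bigcup_i (F i)).
Proof. exact: sigma_algebra_bigcup. Qed.

HB.instance Definition _ := @isMeasurable.Build (rV_display d)
  'rV[T]_n (g_sigma_preimage coords) rV_set0 rV_setC rV_bigcup.
End measurable_rV.


Section lebesgue_rV.
Context {R : realType}.
Let R1 : measurableType _ := measurableTypeR R.

Lemma measurable_coord n (i : 'I_n) :
  measurable_fun [set: 'rV[R1]_n] (fun x : 'rV[R1]_n => x ord0 i : R1).
Proof.
move=> _ Y mY; rewrite setTI; apply: sub_sigma_algebra => /=.
rewrite -bigcup_seq/=; exists i => /=; first by rewrite mem_index_enum.
by exists Y => //; rewrite setTI.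
Qed.

Lemma measurable_to_rV d (T : measurableType d) n (f : T -> 'rV[R1]_n) :
  (forall i, measurable_fun [set: T] (fun x => f x ord0 i : R1)) ->
  measurable_fun [set: T] f.
Proof.
move=> mf _ A mA; rewrite setTI.
have {}mA : <<s \big[setU/set0]_(i < n) preimage_set_system setT
   (fun x : 'rV[R1]_n => x ord0 i : R1) measurable >> A := mA.
move: A mA; apply: smallest_sub.
  split=> /=.
  - by rewrite preimage_set0.
  - move=> A mA; rewrite setTD preimage_setC; exact: measurableC.
  - move=> F mF; rewrite preimage_bigcup; exact: bigcupT_measurable.
rewrite -bigcup_seq => B [i _ [C mC <-]] /=.
by rewrite setTI -comp_preimage -[X in measurable X]setTI; exact: mf.
Qed.

Definition rV_cons n (p : R1 * 'rV[R1]_n) : 'rV[R1]_n.+1 :=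
  \row_i (if unlift ord0 i is Some j then p.2 ord0 j else p.1).

Lemma measurable_rV_cons n : measurable_fun [set: R1 * 'rV[R1]_n] (@rV_cons n).
Proof.
apply: measurable_to_rV => i; under eq_fun do rewrite mxE.
case: unliftP => [j _|_]; last exact: measurable_fst.
exact: (measurableT_comp (measurable_coord j) measurable_snd).
Qed.

Let rV_uncons n (x : 'rV[R1]_n.+1) : R1 * 'rV[R1]_n :=
  (x ord0 ord0, \row_j x ord0 (lift ord0 j)).

Let rV_consK n : cancel (@rV_cons n) (@rV_uncons n).
Proof.
case=> a v; rewrite /rV_cons /rV_uncons/=; congr pair.
  by rewrite mxE unlift_none.
by apply/rowP => j; rewrite !mxE liftK.
Qed.

Let measurable_rV_uncons n : measurable_fun setT (@rV_uncons n).
Proof.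
apply/measurable_fun_pairP; split; first exact: measurable_coord.
apply: measurable_to_rV => i.
by under eq_fun do rewrite mxE; exact: measurable_coord.
Qed.

Section step.
Variables (n : nat) (mu : {sigma_finite_measure set 'rV[R1]_n -> \bar R}).

Definition lebesgue_rVS : set 'rV[R1]_n.+1 -> \bar R :=
  pushforward (@lebesgue_measure R \x mu)%E (@rV_cons n).

Let lebesgue_rVS0 : lebesgue_rVS set0 = 0%E.
Proof. by rewrite /lebesgue_rVS /pushforward preimage_set0 measure0. Qed.

Let lebesgue_rVS_ge0 A : (0 <= lebesgue_rVS A)%E.
Proof. by rewrite /lebesgue_rVS /pushforward; exact: measure_ge0. Qed.

Let measurable_rV_consI A : measurable A -> measurable (@rV_cons n @^-1` A).
Proof.
by move=> mA; rewrite -[X in measurable X]setTI; exact: measurable_rV_cons.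
Qed.

Let lebesgue_rVS_sigma_additive : semi_sigma_additive lebesgue_rVS.
Proof.
move=> F mF tF mUF; rewrite /lebesgue_rVS /pushforward preimage_bigcup.
apply: measure_semi_sigma_additive.
- by move=> k; exact: measurable_rV_consI.
- apply/trivIsetP => /= i j _ _ ij; rewrite -preimage_setI.
  by move/trivIsetP : tF => /(_ _ _ _ _ ij) ->//; rewrite preimage_set0.
- by rewrite -preimage_bigcup; exact: measurable_rV_consI.
Qed.

HB.instance Definition _ := isMeasure.Build _ _ _ lebesgue_rVS
  lebesgue_rVS0 lebesgue_rVS_ge0 lebesgue_rVS_sigma_additive.

Let lebesgue_rVS_sigma_finite : sigma_finite setT lebesgue_rVS.
Proof.
have /sigma_finiteP[F [TF ndF Foo]] := sigma_finiteT (@lebesgue_measure R).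
have /sigma_finiteP[G [TG ndG Goo]] := sigma_finiteT mu.
exists (fun k => @rV_uncons n @^-1` (F k `*` G k)).
  rewrite -preimage_bigcup (_ : \bigcup_k _ = setT) ?preimage_setT//.
  rewrite -setXTT TF TG predeqE => -[x y]; split.
    by move=> [k _ []/= ? ?]; split; exists k.
  move=> [/= [k _ Fkx] [l _ Gly]]; exists (maxn k l) => //; split.
  - by move: x Fkx; exact/subsetPset/ndF/leq_maxl.
  - by move: y Gly; exact/subsetPset/ndG/leq_maxr.
move=> k; have [? ?] := Foo k; have [? ?] := Goo k; split.
  rewrite -[X in measurable X]setTI; apply: measurable_rV_uncons => //.
  exact: measurableX.
rewrite /lebesgue_rVS /pushforward -comp_preimage.
rewrite (_ : _ \o _ = id); last by apply/funext => p; exact: rV_consK.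
by rewrite product_measure1E// lte_mul_pinfty// ge0_fin_numE.
Qed.

HB.instance Definition _ := Measure_isSigmaFinite.Build _ _ _ lebesgue_rVS
  lebesgue_rVS_sigma_finite.

End step.

(* Lebesgue measure on R^n, as the n-fold product of the one on R. *)
Fixpoint lebesgue_rV n : {sigma_finite_measure set 'rV[R1]_n -> \bar R} :=
  if n is n'.+1 then lebesgue_rVS (lebesgue_rV n')
  else \d_(0 : 'rV[R1]_0).

End lebesgue_rV.

Section simplices.
Context {R : realType} {d : nat}.
Local Notation point := 'rV[R]_d.

(* A tagged simplex: the ordered vertices (z_0, ..., z_d) and the type g. *)
Definition tsimplex : Type := (seq point * nat)%type.

Definition open_simplex (z : seq point) : set point :=
  [set x | exists l : 'I_(size z) -> R,
    [/\ forall i, 0 < l i, \sum_i l i = 1 & x = \sum_i l i *: z`_i]].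

Definition hull (z : seq point) : set point :=
  [set x | exists l : 'I_(size z) -> R,
    [/\ forall i, 0 <= l i, \sum_i l i = 1 & x = \sum_i l i *: z`_i]].

Definition nondegenerate (z : seq point) :=
  size z = d.+1 /\ row_free (\matrix_(i < d) (z`_i.+1 - z`_0)).

Definition facet (z : seq point) (i : 'I_d.+1) : set point :=
  hull [seq z`_j | j <- iota 0 d.+1 & j != val i].

Definition bisect (T : tsimplex) (b : bool) : tsimplex :=
  let: (z, g) := T in
  let m := 2^-1 *: (z`_0 + z`_d) in
  (if b then [:: z`_d; m] ++ [seq z`_i | i <- index_iota 1 g.+1]
                          ++ rev [seq z`_i | i <- index_iota g.+1 d]
   else [:: z`_0; m] ++ [seq z`_i | i <- index_iota 1 d],
   (g.+1 %% d)%N).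

Definition reflection (T : tsimplex) : tsimplex :=
  let: (z, g) := T in
  ([:: z`_d] ++ [seq z`_i | i <- index_iota 1 g.+1]
             ++ rev [seq z`_i | i <- index_iota g.+1 d] ++ [:: z`_0], g).

Definition share_facet (T T' : tsimplex) :=
  T <> T' /\ exists i j, facet T.1 i = facet T'.1 j.

Definition one_position_apart (z z' : seq point) :=
  count (fun i => z`_i != z'`_i) (iota 0 d.+1) = 1%N.

Definition reflected_neighbours (T T' : tsimplex) :=
  [/\ share_facet T T', T.2 = T'.2 &
      one_position_apart T.1 T'.1 \/ one_position_apart (reflection T).1 T'.1].

Definition matching_condition (T0 : {fset tsimplex}) :=
  {in T0 &, forall T T', T.2 = T'.2} /\
  {in T0 &, forall T T', share_facet T T' ->
    let refinement_edge_shared :=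
      hull [:: T.1`_0; T.1`_d] `<=` hull T.1 `&` hull T'.1 \/
      hull [:: T'.1`_0; T'.1`_d] `<=` hull T.1 `&` hull T'.1 in
    (refinement_edge_shared -> reflected_neighbours T T') /\
    (~ refinement_edge_shared ->
      exists b b', reflected_neighbours (bisect T b) (bisect T' b'))}.

(* A node of the binary forest: a root and the path from the root to the node,
   whose head is the last bisection. *)
Definition cell : Type := (tsimplex * seq bool)%type.

Definition cell_simplex (c : cell) : tsimplex :=
  foldr (fun b T => bisect T b) c.1 c.2.

Definition vertices (c : cell) : seq point := (cell_simplex c).1.
Definition cell_set (c : cell) : set point := open_simplex (vertices c).
Definition gen (c : cell) : nat := size c.2.
Definition child (c : cell) (b : bool) : cell := (c.1, b :: c.2).
Definition parent (c : cell) : cell := (c.1, behead c.2).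

Definition roots (T0 : {fset tsimplex}) : {fset cell} :=
  [fset (T, [::]) | T in T0]%fset.

Definition conforming_partition (Omega : set point) (P : {fset cell}) :=
  [/\ {in P, forall c, nondegenerate (vertices c) /\ cell_set c `<=` Omega},
      closure Omega = \bigcup_(c in [set` P]) closure (cell_set c),
      {in P &, forall c c', c <> c' -> cell_set c `&` cell_set c' = set0} &
      {in P &, forall c c', exists f : seq point,
        [/\ {subset f <= vertices c}, {subset f <= vertices c'} &
            closure (cell_set c) `&` closure (cell_set c') = hull f]}].

Definition initial_partition (Omega : set point) (T0 : {fset tsimplex}) :=
  [/\ conforming_partition Omega (roots T0),
      {in T0, forall T, (T.2 < d)%N} &
      if d == 1%N then #|` T0|%fset = 1%N else matching_condition T0].

Inductive bisections (T0 : {fset tsimplex}) : {fset cell} -> Prop :=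
| bisections_roots : bisections T0 (roots T0)
| bisections_step P c : bisections T0 P -> c \in P ->
    bisections T0 (child c false |` (child c true |` (P `\ c)))%fset.

(* Only the final partition has to be conforming, not those met on the way. *)
Definition admissible (Omega : set point) (T0 : {fset tsimplex})
    (P : {fset cell}) :=
  bisections T0 P /\
  if d == 1%N then
    {in P &, forall c c', share_facet (cell_simplex c) (cell_simplex c') ->
      (gen c <= (gen c').+1)%N}
  else conforming_partition Omega P.

Definition domain (Omega : set point) :=
  [/\ open Omega, connected Omega & Omega !=set0].

Definition dirichlet_boundary (Omega gamma : set point)
    (T0 : {fset tsimplex}) :=
  [/\ closed gamma, gamma `<=` closure Omega `\` Omega° &
      forall P, admissible Omega T0 P ->
        exists2 F : set (cell * 'I_d.+1), (forall p, F p -> p.1 \in P) &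
          gamma = \bigcup_(p in F) facet (vertices p.1) p.2].

Definition max_gen (P : {fset cell}) : nat := \max_(c <- P) gen c.

(* When j is the largest generation in P, the cells of generation j come in
   pairs of siblings, and each pair is replaced by its parent. *)
Definition coarsen (j : nat) (P : {fset cell}) : {fset cell} :=
  [fset (if gen c == j then parent c else c) | c in P]%fset.

Fixpoint coarsen_down (P : {fset cell}) (n : nat) : {fset cell} :=
  if n is n'.+1 then coarsen (max_gen P - n') (coarsen_down P n') else P.

(* [level P j] is T_j of the hierarchy T_0 < ... < T_L = P. *)
Definition level (P : {fset cell}) (j : nat) : {fset cell} :=
  coarsen_down P (max_gen P - j).

Definition nodes (P : {fset cell}) : {fset point} :=
  [fset z | c in P, z in vertices c]%fset.

Definition free_nodes (gamma : set point) (P : {fset cell}) : {fset point} :=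
  [fset z in nodes P | z \notin gamma]%fset.

End simplices.
Arguments tsimplex R d : clear implicits.
Arguments cell R d : clear implicits.

Section function_spaces.
Context {R : realType} {d : nat}.
Local Notation point := 'rV[R]_d.
Local Notation mu := (@lebesgue_rV R d).
Implicit Types (Omega gamma : set point) (u v : point -> R).
Implicit Types (P : {fset cell R d}).

Definition eq_ae Omega u v := {ae mu, forall x, Omega x -> u x = v x}.

Definition L2 Omega u :=
  measurable_fun Omega u /\ mu.-integrable Omega (fun x => (u x ^+ 2)%:E).

Fixpoint partials (l : seq 'I_d) u : point -> R :=
  if l is i :: l' then fun x => 'D_('e_i) (partials l' u) x else u.

Definition smooth_on Omega u :=
  forall l x, Omega x -> {for x, continuous (partials l u)} /\
    forall i, derivable (partials l u) x 'e_i.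

Definition test_function Omega u :=
  smooth_on setT u /\
  exists K : set point,
    [/\ compact K, K `<=` Omega & forall x, ~ K x -> u x = 0].

Definition weak_gradient Omega u (g : 'I_d -> point -> R) :=
  forall (w : point -> R) (i : 'I_d), test_function Omega w ->
    \int[mu]_(x in Omega) (u x * 'D_('e_i) w x) =
    - \int[mu]_(x in Omega) (g i x * w x).

Definition H1 Omega u (g : 'I_d -> point -> R) :=
  [/\ L2 Omega u, forall i, L2 Omega (g i) & weak_gradient Omega u g].

Definition H1_dist2 Omega u v (g h : 'I_d -> point -> R) : R :=
  \int[mu]_(x in Omega) ((u x - v x) ^+ 2) +
  \sum_i \int[mu]_(x in Omega) ((g i x - h i x) ^+ 2).

(* A function on Omega vanishes at gamma, which lies on the boundary, when it
   tends to 0 at each point of gamma. *)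
Definition vanishes_at Omega gamma u :=
  forall y, gamma y -> u x @[x --> within Omega (nbhs y)] --> (0 : R).

Definition H1_0 Omega gamma u :=
  exists2 g, H1 Omega u g &
    forall e : R, 0 < e -> exists v h,
      [/\ H1 Omega v h, smooth_on Omega v, vanishes_at Omega gamma v &
          H1_dist2 Omega u v g h < e].

Definition affine_on (A : set point) u :=
  exists (a : point) (b : R), forall x, A x -> u x = \sum_i a 0 i * x 0 i + b.

Definition S_cont Omega gamma P : set (point -> R) :=
  [set u | H1_0 Omega gamma u /\ {in P, forall c, affine_on (cell_set c) u}].

Definition S_disc Omega P : set (point -> R) :=
  [set u | L2 Omega u /\ {in P, forall c, affine_on (cell_set c) u}].

(* u|_T (y) for a vertex y of T. *)
Definition value_at (c : cell R d) u (y : point) : R :=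
  lim (u x @[x --> within (cell_set c) (nbhs y)]).

Definition volume (c : cell R d) : R := fine (mu (cell_set c)).

Definition lincomb n (b : 'I_n -> point -> R) (a : 'cV[R]_n) : point -> R :=
  fun x => \sum_i a i 0 * b i x.

Definition is_basis Omega (V : set (point -> R)) n (b : 'I_n -> point -> R) :=
  (forall i, V (b i)) /\
  forall u, V u -> exists! a : 'cV[R]_n, eq_ae Omega u (lincomb b a).

Definition free_node gamma P (k : 'I_#|` free_nodes gamma P|%fset) : point :=
  (enum_fset (free_nodes gamma P))`_k.

(* The nodal basis of [S_cont Omega gamma P], each function being given by its
   representative that is continuous on the closure of Omega. *)
Definition nodal_basis Omega gamma P
    (phi : 'I_#|` free_nodes gamma P|%fset -> point -> R) :=
  is_basis Omega (S_cont Omega gamma P) phi /\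
  forall k, {within closure Omega, continuous (phi k)} /\
    {in nodes P, forall z, phi k z = (z == free_node k)%:R}.

(* Barycentric coordinates: the solution l of
   sum_i l_i = 1 and sum_i l_i *: z_i = x. *)
Definition barycentric (z : seq point) (x : point) : 'rV[R]_(1 + d) :=
  row_mx (const_mx 1) x *m
  invmx (\matrix_(i < 1 + d) (row_mx (const_mx 1) z`_i : 'rV[R]_(1 + d))).

Definition dofs P : seq (cell R d * 'I_d.+1) :=
  [seq (c, i) | c <- enum_fset P, i <- enum 'I_d.+1].

(* The element-wise nodal basis of [S_disc Omega P]. *)
Definition disc_basis P (k : 'I_(size (dofs P))) : point -> R :=
  let: (c, i) := tnth (in_tuple (dofs P)) k in
  fun x => if x \in cell_set c then barycentric (vertices c) x 0 i else 0.

(* M represents, w.r.t. the bases b and b', the linear map with graph F. *)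
Definition represents n n' (b : 'I_n -> point -> R) (b' : 'I_n' -> point -> R)
    (F : (point -> R) -> (point -> R) -> Prop) (M : 'M[R]_(n', n)) :=
  forall a : 'cV[R]_n, F (lincomb b a) (lincomb b' (M *m a)).

Definition embedding Omega u v := eq_ae Omega u v.

Definition L2_projection Omega P u v :=
  S_disc Omega P v /\
  forall w, S_disc Omega P w ->
    \int[mu]_(x in Omega) (u x * w x) = \int[mu]_(x in Omega) (v x * w x).

Definition averaging Omega gamma P u v :=
  [/\ S_cont Omega gamma P v, {within closure Omega, continuous v} &
      {in free_nodes gamma P, forall z, v z =
        (\sum_(c <- P | z \in vertices c) volume c * value_at c u z) /
        (\sum_(c <- P | z \in vertices c) volume c)}].

End function_spaces.

Section preconditioner.
Context {R : realType} {d : nat} (gamma : set 'rV[R]_d) (s : R).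
Variable P : {fset cell R d}.

Local Notation n_ j := #|` free_nodes gamma (level P j)|%fset.
Local Notation m_ j := (size (dofs (level P j))).
Local Notation N := (size (dofs P)).

Variables (E : 'M[R]_(N, #|` free_nodes gamma P|%fset))
  (H : forall j, 'M[R]_(n_ j, m_ j)) (Q : forall j, 'M[R]_(m_ j, N))
  (I : forall j, 'M[R]_(n_ j, n_ j.-1)).

(* The j-th level difference; the conventions for the index -1 amount to
   I 0%N = 0. *)
Definition level_diff j : 'M[R]_(n_ j, N) :=
  H j *m Q j - I j *m H j.-1 *m Q j.-1.

Definition preconditioner : 'M[R]_#|` free_nodes gamma P|%fset :=
  E^T *m
  (\sum_(j < (max_gen P).+1)
     (level_diff j)^T *m
     ((2 `^ (j%:R * (2 * s / d%:R - 1))) *: level_diff j)) *m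
  E.

End preconditioner.

(* Straight-line programs over a list of registers: an instruction appends the
   result of one arithmetic operation on two registers, and fails upon a
   division by zero or an access to a missing register. *)
Section programs.
Context {R : realType}.

Inductive operation := Add | Sub | Mul | Div.

Definition instruction : Type := (operation * nat * nat)%type.

Definition execute (o : operation) (x y : R) : option R :=
  match o with
  | Add => Some (x + y)
  | Sub => Some (x - y)
  | Mul => Some (x * y)
  | Div => if y == 0 then None else Some (x / y)
  end.

Fixpoint run (regs : seq R) (prog : seq instruction) : option (seq R) :=
  if prog is (o, i, j) :: prog' then
    if onth regs i is Some x then
      if onth regs j is Some y then
        if execute o x y is Some r then run (rcons regs r) prog' else None
      else None
    else None
  else Some regs.

(* Started on the constants K and the entries of x, [prog] ends with the entries
   of M *m x in the registers [out], whatever x is. *)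
Definition computes (K : seq R) (prog : seq instruction) n m
    (out : 'I_m -> nat) (M : 'M[R]_(m, n)) :=
  forall x : 'cV[R]_n, exists2 regs,
    run (K ++ [seq x i 0 | i <- enum 'I_n]) prog = Some regs &
    forall i, onth regs (out i) = Some ((M *m x) i 0).

End programs.

(* Main.v *)
(* The orthogonal projection onto the discontinuous piecewise affine functions
   is local, and the one on a cell is obtained from those on its two children by
   a matrix which, by affine invariance of the Lebesgue measure up to a factor,
   depends on the type of the cell only.  One traversal of the binary forest,
   which has at most 2 #P nodes, thus gives all the projections.  The weighted
   sums that define H_j at a node z change from level j-1 to level j only if z
   is a vertex of a cell of generation j, and are then updated from the cells
   that were added or removed.  At all the other nodes the level difference
   vanishes, so that all the level differences are computed in O(#P) linear
   operations.  If D_j is the j-th level difference, the preconditioner is a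
   weighted sum of the Gram matrices of the D_j E, and reverse accumulation
   applies the transposes at the same cost. *)
Require Import Defs.
From HB Require Import structures.
From mathcomp Require Import all_boot all_order all_algebra finmap.
From mathcomp Require Import all_classical all_reals all_analysis.
From mathcomp Require Import measurable_realfun.
From mathcomp Require Import zify ring lra.

Set Implicit Arguments.
Unset Strict Implicit.
Unset Printing Implicit Defensive.

Import Order.TTheory GRing.Theory Num.Theory.
Import numFieldNormedType.Exports.

Local Open Scope classical_set_scope.
Local Open Scope ring_scope.

Local Notation nondegenerate := Defs.nondegenerate.
Local Notation roots := Defs.roots.

(** * Lebesgue measure on row vectors *)

(** A program has to serve every input [x], so intermediate results are treated as linear forms:
    matrix rows applied to [x]. Each row arises from earlier ones by a step [a *: u + b *: w] whose
    scalars do not depend on [x]; a chain of such steps can be run forwards (evaluation) and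
    backwards (transposition) at a fixed cost per step. The scalars (volumes, weights and their
    inverses, level weights) must themselves be computed from constants that do not depend on the
    partition. This is why local quantities are pulled back to one reference simplex: finitely many
    types leave finitely many constants. The pull-back uses only that an affine bijection scales
    volume by some positive factor. That factor comes from the uniqueness of translation-invariant
    measures and cancels in quotients of volumes. The obstacle to linear cost is that the levels
    together may have far more nodes than there are cells; work is therefore charged to pairs of a
    node and the generation of a cell at that node. Projections are kept multiplied by the volume of
    their cell, which removes volumes from the passage from children to parent and makes the
    numerators of the averages plain sums. *)

(** The existential hides the measure structure built from [mf]; what is used afterwards is only the
    values of the image measure. *)
Lemma ex_pushforward d1 d2 (T1 : measurableType d1) (T2 : measurableType d2)
    (R : realType) (m : {measure set T1 -> \bar R}) (f : T1 -> T2) :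
  measurable_fun setT f ->
  exists nu : {measure set T2 -> \bar R}, forall A, nu A = m (f @^-1` A).
Proof.
move=> mf.
by exists (measure_function_pushforward__canonical__measure_function_Measure m mf).
Qed.

Section Translation.
Context {R : realType}.
Local Notation mu n := (@lebesgue_rV R n).

Lemma lebesgue_measure_shift (a : R) (A : set R) : measurable A ->
  lebesgue_measure ((fun x => x + a) @^-1` A) = lebesgue_measure A.
Proof.
move=> mA.
have mf : measurable_fun [set: measurableTypeR R]
    (fun x => x + a : measurableTypeR R) by exact: measurable_funD.
have [nu nuE] := ex_pushforward (@lebesgue_measure R) mf.
rewrite [RHS](@lebesgue_measure_unique R nu) ?nuE//.
move=> _ [[b c] _ <-]; rewrite nuE /=.
rewrite (_ : _ @^-1` _ = `](b - a), (c - a)]%classic).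
  rewrite !lebesgue_measure_itv/= !lte_fin ltrD2r; case: ifP => // _.
  by rewrite -!EFinB; congr EFin; rewrite opprB addrA subrK.
by apply/seteqP; split => x /=; rewrite !in_itv/= ltrBlDr lerBrDr.
Qed.

Lemma measurable_rV_affine n p (M : 'M[R]_(n, p)) (b : 'rV[R]_p) :
  measurable_fun [set: 'rV[measurableTypeR R]_n]
    (fun x => (x : 'rV[R]_n) *m M + b : 'rV[measurableTypeR R]_p).
Proof.
apply: measurable_to_rV => i.
rewrite (_ : (fun _ => _) = (fun x : 'rV[R]_n => \sum_j x 0 j * M j i + b 0 i)); last first.
  by apply/funext => x; rewrite !mxE.
apply: measurable_funD; last exact: measurable_cst.
apply: measurable_sum => j; apply: measurable_funM; last exact: measurable_cst.
exact: measurable_coord.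
Qed.

Lemma measurable_rV_shift n (b : 'rV[R]_n) :
  measurable_fun [set: 'rV[measurableTypeR R]_n]
    (fun x => (x : 'rV[R]_n) + b : 'rV[measurableTypeR R]_n).
Proof.
have := @measurable_rV_affine n n 1%:M b.
by under eq_fun do rewrite mulmx1.
Qed.

Local Open Scope ereal_scope.

(** By induction on the dimension: the translated product measure agrees with the original one on
    rectangles, and these determine a product measure. *)
Lemma lebesgue_rV_shift n (a : 'rV[R]_n) (A : set 'rV[R]_n) : measurable A ->
  mu n ((fun x => x + a)%R @^-1` A) = mu n A.
Proof.
elim: n a A => [|n IH] a A mA.
  congr (\d_ _ _).
  by apply/seteqP; split => x /=; rewrite [(x + a)%R](_ : _ = x)//; apply/rowP; case.
pose a0 := a ord0 ord0; pose a' : 'rV[R]_n := \row_j a ord0 (lift ord0 j).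
pose T := (measurableTypeR R * 'rV[measurableTypeR R]_n)%type.
pose f (p : T) : T := (p.1 + a0, (p.2 : 'rV[R]_n) + a')%R.
have mf : measurable_fun setT f.
  apply/measurable_fun_pairP; split => /=.
    by apply: measurable_funD => //; exact: measurable_fst.
  exact: measurableT_comp (measurable_rV_shift a') measurable_snd.
have [nu nuE] := ex_pushforward (@lebesgue_measure R \x mu n) mf.
rewrite /= /lebesgue_rVS /pushforward.
have mB : measurable (@rV_cons R n @^-1` A).
  by rewrite -[X in measurable X]setTI; exact: measurable_rV_cons.
rewrite [RHS](@product_measure_unique _ _ _ _ _ _ _ nu)//.
  rewrite nuE; congr (_ _).
  apply/seteqP; split => -[x y]/=; congr (A _).
  - apply/rowP => i; rewrite !mxE; case: unliftP => [j ->|->] //=.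
    by rewrite !mxE.
  - apply/rowP => i; rewrite !mxE; case: unliftP => [j ->|->] //=.
    by rewrite !mxE.
move=> B C mB' mC; rewrite nuE.
rewrite (_ : _ @^-1` _ =
  ((fun x => x + a0)%R @^-1` B) `*` ((fun x => x + a')%R @^-1` C))//.
have mB1 : measurable ((fun x => x + a0)%R @^-1` B).
  have := @measurable_funD _ _ R setT id (cst a0) (@measurable_id _ _ _)
    (@measurable_cst _ _ _ _ _ _).
  by move=> /(_ measurableT _ mB'); rewrite setTI.
have mC1 : measurable ((fun x => x + a')%R @^-1` C).
  by rewrite -[X in measurable X]setTI; exact: measurable_rV_shift.
apply: (eq_trans (@product_measure1E _ _ _ _ R (@lebesgue_measure R) (mu n) _ _ mB1 mC1)).
rewrite IH//; congr (_ * _); exact: lebesgue_measure_shift.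
Qed.
End Translation.

Section Uniqueness.
Context {R : realType} {n : nat}.
Local Notation T := 'rV[measurableTypeR R]_n.
Local Open Scope ereal_scope.

Lemma product_measure12 d1 d2 (T1 : measurableType d1) (T2 : measurableType d2)
  (m1 : {sigma_finite_measure set T1 -> \bar R})
  (m2 : {sigma_finite_measure set T2 -> \bar R}) A :
  measurable A -> (m1 \x m2) A = (m1 \x^ m2) A.
Proof.
by move=> mA; apply: product_measure_unique => // B C mB mC; exact: product_measure2E.
Qed.

Lemma measurable_rV_add : measurable_fun [set: T * T]
  (fun p : T * T => (p.1 : 'rV[R]_n) + (p.2 : 'rV[R]_n) : T)%R.
Proof.
apply: measurable_to_rV => i; under eq_fun do rewrite mxE.
apply: measurable_funD.
  exact: (measurableT_comp (measurable_coord i) measurable_fst).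
exact: (measurableT_comp (measurable_coord i) measurable_snd).
Qed.

Lemma measurable_rV_opp : measurable_fun [set: T]
  (fun p : T => - (p : 'rV[R]_n) : T)%R.
Proof.
have := @measurable_rV_affine R n n (- 1%:M) 0.
by under eq_fun do rewrite mulmxN mulmx1 addr0.
Qed.

(* Computing by Tonelli, in two orders, the measure of the set of the pairs
   [(x, y)] with [y] in [B] and [x + y] in [A]. *)
Lemma shift_invariant_measure_unique
    (nu mu : {sigma_finite_measure set T -> \bar R}) (A B : set 'rV[R]_n) :
  (forall a C, measurable C -> nu ((fun x : 'rV[R]_n => x + a)%R @^-1` C) = nu C) ->
  (forall a C, measurable C -> mu ((fun x : 'rV[R]_n => x + a)%R @^-1` C) = mu C) ->
  measurable A -> measurable B ->
  nu A * mu B = nu (-%R @^-1` B) * mu A.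
Proof.
move=> nuT muT mA mB.
have mpre (f : T * T -> T) C : measurable_fun setT f -> measurable C ->
    measurable (f @^-1` C).
  by move=> mf mC; rewrite -[X in measurable X]setTI; exact: mf.
pose sub (p : T * T) : T := ((p.2 : 'rV[R]_n) + - (p.1 : 'rV[R]_n))%R.
have msub : measurable_fun setT sub.
  rewrite (_ : sub = (fun p : T * T => (p.1 : 'rV[R]_n) + (p.2 : 'rV[R]_n) : T)%R \o
     (fun p : T * T => (p.2, - (p.1 : 'rV[R]_n) : T)%R))//.
  apply: measurableT_comp; first exact: measurable_rV_add.
  apply/measurable_fun_pairP; split; first exact: measurable_snd.
  exact: measurableT_comp measurable_rV_opp measurable_fst.
pose Z := snd @^-1` B `&` (fun p : T * T => (p.1 : 'rV[R]_n) + (p.2 : 'rV[R]_n) : T)%R @^-1` A.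
pose W := snd @^-1` A `&` sub @^-1` B.
have mZ : measurable Z.
  by apply: measurableI; apply: mpre => //; exact: measurable_rV_add.
have mW : measurable W.
  by apply: measurableI; exact: mpre.
have integral_on C c : measurable C -> 0 <= c ->
    \int[mu]_y (c * (\1_C y)%:E) = c * mu C.
  move=> mC c0; rewrite ge0_integralZl//; last exact: measurableT_comp.
  by rewrite integral_indic// setIT.
transitivity ((nu \x mu) Z).
  rewrite product_measure12// /product_measure2 -integral_on//.
  apply: eq_integral => y _ /=; rewrite indicE.
  have [yB|yB] := boolP (y \in B).
    rewrite mule1 -(nuT y)//; congr (nu _); apply/seteqP; split => x/=.
      by move=> ?; rewrite /ysection/= inE; split => //; exact: set_mem.
    by rewrite /ysection/= inE => -[].
  rewrite mule0 (_ : ysection _ _ = set0) ?measure0// -subset0 => x.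
  by rewrite /ysection/= inE => -[/= /mem_set]; rewrite (negbTE yB).
(* For fixed [x], the section of [W] is the section of [Z] translated by [x], so the invariance of
   [mu] applies fibrewise. *)
transitivity ((nu \x mu) W).
  apply: eq_integral => x _ /=.
  rewrite -[LHS](muT (- x)%R); last exact: measurable_xsection.
  congr (mu _); apply/seteqP; split => y; rewrite /xsection/= !inE /Z /W /sub/=.
    by move=> [/= ? +]; rewrite addrC subrK.
  by move=> [/= ? ?]; split => //=; rewrite addrC subrK.
rewrite product_measure12// /product_measure2 -integral_on//.
apply: eq_integral => y _ /=; rewrite indicE.
have [yA|yA] := boolP (y \in A).
  rewrite mule1 -[RHS](nuT (- y)%R); last first.
    by rewrite -[X in measurable X]setTI; exact: measurable_rV_opp.
  congr (nu _); apply/seteqP; split => x; rewrite /ysection/= inE /W /sub/= opprB.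
    by move=> [].
  by move=> ?; split => //=; exact: set_mem.
rewrite mule0 (_ : ysection _ _ = set0) ?measure0// -subset0 => x.
by rewrite /ysection/= inE => -[/= /mem_set]; rewrite (negbTE yA).
Qed.
End Uniqueness.

(** * Boxes, and continuous functions that vanish almost everywhere *)

Section Boxes.
Context {R : realType}.
Local Notation mu n := (@lebesgue_rV R n).
Local Open Scope ereal_scope.

Definition box n (a : 'rV[R]_n) (e : R) : set 'rV[R]_n :=
  [set x | forall i, ball (a 0%R i) e (x 0%R i)].

Lemma measurable_box n (a : 'rV[R]_n) e : measurable (box a e).
Proof.
rewrite (_ : box a e =
    \bigcap_(i in [set: 'I_n]) (fun x : 'rV[R]_n => x ord0 i) @^-1` ball (a 0%R i) e).
  apply: fin_bigcap_measurable; first exact: finite_finset.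
  move=> i _; rewrite -[X in measurable X]setTI.
  by apply: measurable_coord => //; exact: measurable_ball.
by apply/seteqP; split => x xb i; [move=> _|]; exact: xb.
Qed.

Lemma lebesgue_rV_box n (a : 'rV[R]_n) e : (0 < e)%R ->
  mu n (box a e) = ((e *+ 2) ^+ n)%:E.
Proof.
move=> e0; elim: n a => [|n IH] a.
  by rewrite /= diracE expr0 (_ : _ \in _)// inE => -[].
rewrite /= /lebesgue_rVS /pushforward.
pose a' : 'rV[R]_n := (\row_j a ord0 (lift ord0 j))%R.
rewrite (_ : _ @^-1` _ = ball (a ord0 ord0) e `*` box a' e).
  apply: (eq_trans (@product_measure1E _ _ _ _ R (@lebesgue_measure R) (mu n) _ _ _ _)).
  - exact: measurable_ball.
  - exact: measurable_box.
  rewrite IH exprS EFinM; congr (_ * _).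
  exact: lebesgue_measure_ball (ltW e0).
apply/seteqP; split => -[x y] /=.
  move=> xb; split => /=.
    by have := xb ord0; rewrite mxE unlift_none.
  by move=> i; have := xb (lift ord0 i); rewrite !mxE liftK.
move=> [/= xa yb] i; rewrite mxE; case: unliftP => [j ->|-> //].
by have := yb j; rewrite mxE.
Qed.

Lemma not_negligible_box n (a : 'rV[R]_n) e (A : set 'rV[R]_n) : (0 < e)%R ->
  box a e `<=` A -> ~ (mu n).-negligible A.
Proof.
move=> e0 bA [N [mN N0 AN]].
have : mu n (box a e) <= mu n N.
  by apply: le_measure; rewrite ?inE//; [exact: measurable_box|exact: subset_trans AN].
rewrite N0 lebesgue_rV_box// lee_fin leNgt exprn_gt0//.
by rewrite mulrn_wgt0.
Qed.

Lemma nbhs_box n (a : 'rV[R]_n) (A : set 'rV[R]_n) :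
  nbhs a A -> exists2 e : R, (0 < e)%R & box a e `<=` A.
Proof.
move=> /nbhs_ballP[e /= e0 eA]; exists e => // x xb; apply: eA.
by split => // i j; rewrite ord1; exact: xb.
Qed.

(** A nonzero value persists near the point, and that neighbourhood meets [U] in a nonempty open
    set, which contains a box of positive measure. This turns the almost-everywhere identities of
    the function spaces into identities at nodes. *)
Lemma ae_eq0_closure n (U : set 'rV[R]_n) (f : 'rV[R]_n -> R) : open U ->
  {within closure U, continuous f} ->
  {ae mu n, forall x, U x -> f x = 0%R} -> forall x, closure U x -> f x = 0%R.
Proof.
move=> oU /subspace_continuousP fc f0 x Ux; apply: contrapT => /eqP fx0.
have /(fc x Ux) V : nbhs (f x) [set y | y != 0%R].
  by apply: open_nbhs_nbhs; split => //; exact: open_neq.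
have {}V : \forall y \near x, closure U y -> f y != 0%R := V.
have [y [Uy Vy]] := Ux _ (nbhs_interior V).
have : nbhs y (U `&` [set y | closure U y -> f y != 0%R]).
  by apply: filterI; [exact: open_nbhs_nbhs|exact: Vy].
move=> /nbhs_box[e e0 eA].
apply: (not_negligible_box e0 _ f0) => z /eA[Uz fz] /(_ Uz) fz0.
by have := fz (subset_closure Uz); rewrite fz0 eqxx.
Qed.
End Boxes.

Section SigmaFiniteAlias.
Context d (T : measurableType d) (R : realType) (nu : {measure set T -> \bar R}).
Hypothesis sfnu : sigma_finite setT nu.

(** The [let] ties the name to the proof [sfnu], from which the instance below obtains
    sigma-finiteness for a measure known only through an existential. *)
Definition sigma_finite_alias : set T -> \bar R := let _ := sfnu in nu.

HB.instance Definition _ := Measure.on sigma_finite_alias.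
HB.instance Definition _ :=
  Measure_isSigmaFinite.Build _ _ _ sigma_finite_alias sfnu.

End SigmaFiniteAlias.

(** * Affine maps scale Lebesgue measure by a constant *)

Section Scaling.
Context {R : realType} {n : nat}.
Local Notation T := 'rV[measurableTypeR R]_n.
Local Notation mu := (@lebesgue_rV R n).
Local Open Scope ereal_scope.

Lemma lebesgue_rV_affine (M : 'M[R]_n) (b : 'rV[R]_n) : M \in unitmx ->
  exists2 C : R, (0 < C)%R &
  forall A, measurable A -> mu ((fun x => x *m M + b)%R @^-1` A) = C%:E * mu A.
Proof.
move=> uM; pose f (x : T) : T := ((x : 'rV[R]_n) *m M + b)%R.
pose g (x : T) : T := ((x : 'rV[R]_n) *m invmx M + - (b *m invmx M))%R.
have fK : cancel f g by move=> x; rewrite /f /g mulmxDl mulmxK// addrK.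
have mf : measurable_fun setT f by exact: measurable_rV_affine.
have mg : measurable_fun setT g by exact: measurable_rV_affine.
have mpre (h : T -> T) C : measurable_fun setT h -> measurable C ->
    measurable (h @^-1` C).
  by move=> mh mC; rewrite -[X in measurable X]setTI; exact: mh.
have fgE C : f @^-1` (g @^-1` C) = C.
  by apply/seteqP; split => x; rewrite /= fK.
have [nu nuE'] := ex_pushforward mu mf.
have nuE (A : set 'rV[R]_n) : nu A = mu (f @^-1` A) := nuE' A.
have sfnu : sigma_finite setT nu.
  have /sigma_finiteP[F [TF ndF Foo]] := sigma_finiteT mu.
  exists (fun k => g @^-1` F k); first by rewrite -preimage_bigcup -TF preimage_setT.
  move=> k; have [mF Fk] := Foo k; split; first exact: mpre.
  by rewrite nuE fgE.
pose nu' : {sigma_finite_measure set T -> \bar R} := sigma_finite_alias sfnu.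
have nuT a C : measurable C -> nu ((fun x : 'rV[R]_n => x + a)%R @^-1` C) = nu C.
  move=> mC; rewrite !nuE.
  apply: eq_trans (lebesgue_rV_shift (a *m invmx M) (mpre _ _ mf mC)).
  congr (mu _); apply/seteqP; split => x; rewrite /f/= mulmxDl -mulmxA mulVmx// mulmx1;
    by rewrite addrAC.
(* The side length is 1, so that [B] has measure 1 and normalizes the comparison of [nu] with
   [mu]. *)
pose B := box (0 : 'rV[R]_n) (2^-1).
have mB : measurable B by exact: measurable_box.
have muB : mu B = 1.
  have half2 : (2^-1 *+ 2 = 1 :> R)%R by rewrite mulr2n -[2^-1%R]mul1r -splitr.
  by rewrite lebesgue_rV_box ?invr_gt0// half2 expr1n.
have nuC A : measurable A -> nu A = nu (-%R @^-1` B) * mu A.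
  move=> mA; have muT (a : 'rV[R]_n) (C : set 'rV[R]_n) :
      measurable C -> mu ((fun x => x + a)%R @^-1` C) = mu C.
    exact: lebesgue_rV_shift.
  have e : nu A * mu B = nu (-%R @^-1` B) * mu A :=
    shift_invariant_measure_unique (nu := nu') nuT muT mA mB.
  by rewrite -e; apply/esym/(eq_trans (congr1 (mule (nu A)) muB)); rewrite mule1.
(* Applied to the preimage of [B] under [g], whose [nu]-measure is 1, the proportionality excludes
   the factors 0 and infinity. *)
have := nuC _ (mpre _ _ mg mB); rewrite {1}nuE fgE [X in X = _]muB.
have : 0 <= nu (-%R @^-1` B) by exact: measure_ge0.
move: nuC; case: (nu (-%R @^-1` B)) => [c| |] nuC c0 // cE.
- exists c => //; last by move=> A mA; rewrite -nuE nuC.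
  rewrite lt_neqAle -lee_fin c0 andbT; apply/eqP => c0'; move: cE.
  by rewrite -c0' mul0e => -[] /eqP; rewrite oner_eq0.
- move: cE; have : 0 <= mu (g @^-1` B) by exact: measure_ge0.
  rewrite le_eqVlt => /orP[/eqP <-|m0]; last by rewrite gt0_mulye.
  by rewrite mule0 => -[] /eqP; rewrite oner_eq0.
Qed.

End Scaling.

(** * Straight-line computations *)

Section Chains.
Variables (V : eqType) (step : seq V -> V -> Prop).
Hypothesis step_sub : forall S S' v, {subset S <= S'} -> step S v -> step S' v.
Implicit Types (S T U : seq V) (N M : nat).

(** An execution trace without addresses: a step may use any value present, and the newest value is
    the head. The same notion serves real numbers, functions of the input and matrix rows; addresses
    return only in [chain_run]. *)
Inductive chain S0 : nat -> seq V -> Prop :=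
| chain0 : chain S0 0 S0
| chainS N S v : chain S0 N S -> step S v -> chain S0 N.+1 (v :: S).

Definition reach S0 N T :=
  exists N' S, [/\ (N' <= N)%N, chain S0 N' S & {subset T <= S}].

Lemma chain_sub S0 N S : chain S0 N S -> {subset S0 <= S}.
Proof. by elim=> [|{}N {}S v _ IH _] x // /IH xS; rewrite inE xS orbT. Qed.

(** Steps are monotone in the available values, so a chain can be replayed on top of a larger stock;
    this is what makes computations composable. *)
Lemma chain_extend S0 S1 N S : chain S0 N S -> {subset S0 <= S1} ->
  exists S', [/\ chain S1 N S', {subset S <= S'} & {subset S1 <= S'}].
Proof.
move=> cS S01; elim: cS => [|{}N {}S v cS [S' [cS' SS' S1S']] sv].
  by exists S1; split => //; exact: chain0.
exists (v :: S'); split.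
- by apply: chainS => //; exact: step_sub sv.
- by move=> x; rewrite !inE => /orP[->//|/SS' ->]; rewrite orbT.
- by move=> x /S1S'; rewrite inE => ->; rewrite orbT.
Qed.

Lemma chain_trans S0 N S M S' : chain S0 N S -> chain S M S' -> chain S0 (N + M) S'.
Proof.
by move=> cS; elim=> [|{}M {}S' v _ IH sv]; rewrite ?addn0// addnS; exact: chainS.
Qed.

Lemma reach_refl S0 N T : {subset T <= S0} -> reach S0 N T.
Proof. by move=> TS; exists 0%N, S0; split => //; exact: chain0. Qed.

Lemma reach_step S0 v : step S0 v -> reach S0 1 [:: v].
Proof.
move=> sv; exists 1%N, (v :: S0); split => //.
  by apply: chainS sv; exact: chain0.
by move=> x; rewrite !inE => ->.
Qed.

Lemma reach_weak S0 S1 N N1 T T1 : reach S0 N T -> {subset S0 <= S1} ->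
  (N <= N1)%N -> {subset T1 <= T} -> reach S1 N1 T1.
Proof.
move=> [N' [S [N'N cS TS]]] S01 NN1 T1T.
have [S' [cS' SS' _]] := chain_extend cS S01.
exists N', S'; split => //; first exact: leq_trans N'N NN1.
by move=> x /T1T/TS/SS'.
Qed.

Lemma reach_leq S0 N N1 T : reach S0 N T -> (N <= N1)%N -> reach S0 N1 T.
Proof. by move=> rT NN1; exact: reach_weak rT _ NN1 _. Qed.

Lemma reach_sub S0 S1 N T : reach S0 N T -> {subset S0 <= S1} -> reach S1 N T.
Proof. by move=> rT S01; exact: reach_weak rT S01 _ _. Qed.

Lemma reach_cut S0 N M T U :
  reach S0 N T -> reach (T ++ S0) M U -> reach S0 (N + M) (T ++ U).
Proof.
move=> [N' [S [N'N cS TS]]] [M' [S1 [M'M cS1 US1]]].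
have TSS : {subset T ++ S0 <= S}.
  by move=> x; rewrite mem_cat => /orP[/TS //|]; exact: (chain_sub cS).
have [S' [cS' S1S' SS']] := chain_extend cS1 TSS.
exists (N' + M')%N, S'; split; [exact: leq_add|exact: chain_trans cS'|].
by move=> x; rewrite mem_cat => /orP[/TS/SS' //|/US1/S1S'].
Qed.

Lemma reach_cutr S0 N M T U :
  reach S0 N T -> reach (T ++ S0) M U -> reach S0 (N + M) U.
Proof.
move=> rT rU; apply: reach_weak (reach_cut rT rU) _ _ _ => //.
by move=> x xU; rewrite mem_cat xU orbT.
Qed.

Lemma reach_then_step S0 N T v : reach S0 N T -> step (T ++ S0) v ->
  reach S0 N.+1 [:: v].
Proof. by move=> rT /reach_step rv; rewrite -addn1; exact: reach_cutr rv. Qed.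

Section Tasks.
Variables (I : eqType) (f : I -> V) (cost : I -> nat).

Lemma reach_tasks S0 (s : seq I) :
  (forall s1 t s2, s = s1 ++ t :: s2 ->
     reach ([seq f i | i <- s1] ++ S0) (cost t) [:: f t]) ->
  reach S0 (\sum_(t <- s) cost t) [seq f i | i <- s].
Proof.
elim/last_ind: s => [|s t IH] H; first exact: reach_refl.
rewrite -cats1 big_cat big_seq1 map_cat; apply: reach_cut.
  by apply: IH => s1 u s2 sE; apply: (H _ _ (rcons s2 t)); rewrite sE rcons_cat.
by apply: (H _ _ [::]); rewrite cats1.
Qed.

(** Sorting the tasks by rank yields an order in which everything a task needs has been computed
    before it. *)
Lemma reach_ranked S0 (s : seq I) (r : I -> nat) :
  (forall t, t \in s ->
     reach ([seq f i | i <- s & (r i < r t)%N] ++ S0) (cost t) [:: f t]) ->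
  reach S0 (\sum_(t <- s) cost t) [seq f i | i <- s].
Proof.
move=> H; pose s' := sort (relpre r leq) s.
have ss' : perm_eq s s' by rewrite perm_sym perm_sort.
apply: (@reach_weak S0 S0 (\sum_(t <- s') cost t) _ [seq f i | i <- s']) => //.
- apply: reach_tasks => s1 t s2 s'E.
  have ts : t \in s by rewrite (perm_mem ss') s'E mem_cat inE eqxx orbT.
  apply: reach_weak (H t ts) _ _ _ => // v.
  rewrite !mem_cat => /orP[/mapP[i]|->]; last by rewrite orbT.
  rewrite mem_filter => /andP[rit is_] ->; apply/orP; left; apply: map_f.
  move: is_; rewrite (perm_mem ss') s'E mem_cat => /orP[//|its2].
  have : sorted (relpre r leq) (t :: s2).
    have : sorted (relpre r leq) s' by apply: sort_sorted => ? ?; exact: leq_total.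
    by rewrite s'E sorted_cat_cons => /andP[].
  move=> /(order_path_min (fun _ _ _ => @leq_trans _ _ _))/allP ts2.
  move: its2; rewrite inE => /orP[/eqP itE|/ts2 /=].
    by move: rit; rewrite itE ltnn.
  by rewrite leqNgt rit.
- by rewrite (perm_big _ ss').
- by move=> v; rewrite (perm_mem (perm_map f ss')).
Qed.
End Tasks.
End Chains.

Lemma reach_sum (V : nmodType) (step : seq V -> V -> Prop)
    (step_sub : forall S S' v, {subset S <= S'} -> step S v -> step S' v)
    (stepD : forall S u v, u \in S -> v \in S -> step S (u + v))
    (I : eqType) (s : seq I) (f : I -> V) S0 u :
  u \in S0 -> (forall i, i \in s -> f i \in S0) ->
  reach step S0 (size s) [:: u + \sum_(i <- s) f i].
Proof.
elim/last_ind: s => [|s i IH] u0 fs.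
  by rewrite big_nil addr0; apply: reach_refl => v; rewrite inE => /eqP ->.
rewrite size_rcons -cats1 big_cat big_seq1 addrA.
have /IH {}IH : u \in S0 by [].
apply: reach_then_step => //.
  by apply: IH => j js; apply: fs; rewrite mem_rcons inE js orbT.
apply: stepD; first by rewrite inE eqxx.
by rewrite inE fs ?orbT// mem_rcons inE eqxx.
Qed.

(** * From chains of values to straight-line programs *)

Section Programs.
Context {R : realType}.

Definition arith_step (S : seq R) (v : R) :=
  exists o x y, [/\ x \in S, y \in S & execute o x y = Some v].

(** The operation must succeed for every input, divisions included, so that a single program serves
    all vectors. *)
Definition fun_step (X : Type) (S : seq (X -> R)) (v : X -> R) :=
  exists o f g, [/\ f \in S, g \in S &
    forall x, execute o (f x) (g x) = Some (v x)].

(** The coefficients come from a fixed stock of scalars. A step is linear in the rows, hence can be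
    transposed, and costs two products and one sum when evaluated. *)
Definition lin_step n (A : seq R) (S : seq 'rV[R]_n) (v : 'rV[R]_n) :=
  exists a b u w, [/\ a \in A, b \in A, u \in S, w \in S & v = a *: u + b *: w].

Lemma arith_step_sub S S' v : {subset S <= S'} -> arith_step S v -> arith_step S' v.
Proof. by move=> SS' [k [x [y [/SS' xS /SS' yS e]]]]; exists k, x, y. Qed.

Lemma fun_step_sub X S S' v : {subset S <= S'} -> @fun_step X S v -> fun_step S' v.
Proof. by move=> SS' [k [x [y [/SS' xS /SS' yS e]]]]; exists k, x, y. Qed.

Lemma lin_step_sub n A S S' v : {subset S <= S'} -> @lin_step n A S v -> lin_step A S' v.
Proof.
by move=> SS' [a [b [u [w [aA bA /SS' uS /SS' wS e]]]]]; exists a, b, u, w.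
Qed.

Lemma run_cat (regs : seq R) p q :
  run regs (p ++ q) = obind (run^~ q) (run regs p).
Proof.
elim: p regs => [//|[[k i] j] p IH] regs /=.
by case: onth => // x; case: onth => // y; case: execute.
Qed.

Lemma onth_index (T : eqType) (B : Type) (g : T -> B) (s : seq T) x : x \in s ->
  onth [seq g y | y <- s] (index x s) = Some (g x).
Proof.
by elim: s => [//|y s IH]; rewrite inE eq_sym /=; case: eqP => [->//|_ /= /IH].
Qed.

(** Registers grow at the tail and chains at the head, hence the reversals; the address of an
    operand is its first index among the computed functions. *)
Lemma chain_run X (S0 S : seq (X -> R)) N : chain (@fun_step X) S0 N S ->
  exists2 prog, size prog = N &
  forall x, run [seq f x | f <- rev S0] prog = Some [seq f x | f <- rev S].
Proof.
elim=> [|{}N {}S v _ [p <- pE] [k [f [g [fS gS e]]]]]; first by exists [::].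
exists (p ++ [:: (k, index f (rev S), index g (rev S))]).
  by rewrite size_cat addn1.
move=> x; rewrite run_cat pE /=.
by rewrite !(onth_index (fun f => f x)) ?mem_rev// e rev_cons map_rcons.
Qed.

Definition proj n (i : 'I_n) (x : 'cV[R]_n) : R := x i 0.

Lemma computes_reach (K : seq R) n m (M : 'M[R]_(m, n)) N :
  reach (@fun_step 'cV[R]_n) ([seq cst a | a <- K] ++ [seq proj i | i <- enum 'I_n])
    N [seq (fun x => (M *m x) i 0) | i <- enum 'I_m] ->
  exists prog out, (size prog <= N)%N /\ computes K prog out M.
Proof.
move=> rM.
(* The start list is reversed beforehand, so that [rev] in [chain_run] restores the register order
   required by [computes]. *)
have [|N' [S [N'N cS MS]]] := reach_weak (@fun_step_sub _) rM
  (S1 := rev ([seq cst a | a <- K] ++ [seq proj i | i <- enum 'I_n])) _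
  (leqnn _) (fun _ => id).
  by move=> f; rewrite mem_rev.
have [p pN pE] := chain_run cS.
exists p, (fun i => index (fun x => (M *m x) i 0) (rev S)).
split; first by rewrite pN.
move=> x; exists [seq f x | f <- rev S].
  by rewrite -pE revK map_cat -!map_comp /comp /= map_id.
move=> i; rewrite (onth_index (fun f => f x))// mem_rev; apply: MS.
by apply/mapP; exists i => //; rewrite mem_enum.
Qed.


Lemma reach_cst X (K A : seq R) N (B : seq (X -> R)) : reach arith_step K N A ->
  {subset [seq cst a | a <- K] <= B} -> reach (@fun_step X) B N [seq cst a | a <- A].
Proof.
move=> [N' [S [N'N cS AS]]] KB.
suff [S' [cS' SS' _]] : exists S', [/\ chain (@fun_step X) B N' S',
    {subset [seq cst a | a <- S] <= S'} & {subset B <= S'}].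
  by exists N', S'; split => // _ /mapP[a /AS aS ->]; apply/SS'/map_f.
clear N'N AS; elim: cS => [|{}N' {}S v _ [S' [cS' SS' BS']] [k [x [y [xS yS e]]]]].
  by exists B; split => //; exact: chain0.
exists (cst v :: S'); split.
- apply: chainS cS' _; exists k, (cst x), (cst y); split => //.
  + exact/SS'/map_f.
  + exact/SS'/map_f.
- by move=> g /=; rewrite !inE => /orP[->//|/SS' ->]; rewrite orbT.
- by move=> g /BS' gS'; rewrite inE gS' orbT.
Qed.

Definition row_fun n (u : 'rV[R]_n) (x : 'cV[R]_n) : R := (u *m x) 0 0.

Lemma reach_row n (A : seq R) (S0 T : seq 'rV[R]_n) N (B : seq ('cV[R]_n -> R)) :
  reach (lin_step A) S0 N T -> {subset [seq cst a | a <- A] <= B} ->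
  {subset [seq row_fun u | u <- S0] <= B} ->
  reach (@fun_step _) B (3 * N) [seq row_fun u | u <- T].
Proof.
move=> [N' [S [N'N cS TS]]] AB SB.
suff : reach (@fun_step _) B (3 * N') [seq row_fun u | u <- S].
  move=> /(reach_weak (@fun_step_sub _)); apply => //; first by rewrite leq_mul2l.
  by move=> _ /mapP[u /TS uS ->]; exact: map_f.
clear N'N TS; elim: cS => [|{}N' {}S v _ IH [a [b [u [w [aA bA uS wS ->]]]]]].
  by apply: reach_refl => f; exact: SB.
have aB S' : cst a \in S' ++ B by rewrite mem_cat AB ?orbT// map_f.
have bB S' : cst b \in S' ++ B by rewrite mem_cat AB ?orbT// map_f.
have uE : row_fun u \in [seq row_fun u | u <- S] ++ B by rewrite mem_cat map_f.
have wE : row_fun w \in [seq row_fun u | u <- S] ++ B by rewrite mem_cat map_f.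
apply: (@reach_weak _ _ (@fun_step_sub _) B B (3 * N' + 3)
  _ ([seq row_fun u | u <- S] ++ [:: row_fun (a *: u + b *: w)])) => //; first last.
- by move=> f; rewrite /= mem_cat mem_seq1 inE orbC.
- by rewrite mulnS addnC.
apply: reach_cut => //; first exact: fun_step_sub.
pose f x := a * row_fun u x; pose g x := b * row_fun w x.
apply: (@reach_cutr _ _ (@fun_step_sub _) _ 2 1 [:: f; g]).
  apply: (@reach_cut _ _ (@fun_step_sub _) _ 1 1 [:: f] [:: g]).
    by apply: reach_step; exists Mul, (cst a), (row_fun u); split.
  apply: reach_step; exists Mul, (cst b), (row_fun w); split => //.
  - by rewrite in_cons bB orbT.
  - by rewrite in_cons wE orbT.
apply: reach_step; exists Add, f, g; split => //.
- by rewrite inE eqxx.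
- by rewrite !inE eqxx orbT.
- by move=> x; rewrite /= /f /g /row_fun mulmxDl -!scalemxAl !mxE.
Qed.

(* Reverse accumulation: the weight carried by a row [a *: u + b *: w] is moved,
   multiplied by [a] and by [b], to the earlier rows [u] and [w]. *)
Lemma reach_adjoint n (A : seq R) (S0 S : seq 'rV[R]_n) N
    (B : seq ('cV[R]_n -> R)) (Y : seq (('cV[R]_n -> R) * 'rV[R]_n)) :
  chain (lin_step A) S0 N S -> {subset [seq cst a | a <- A] <= B} ->
  cst 0 \in B -> {subset [seq y.1 | y <- Y] <= B} -> {subset [seq y.2 | y <- Y] <= S} ->
  exists Y' : seq (('cV[R]_n -> R) * 'rV[R]_n), exists c : nat,
  [/\ reach (@fun_step _) B c [seq y.1 | y <- Y'],
     {subset [seq y.2 | y <- Y'] <= S0},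
     (c + size Y' <= 4 * N + size Y)%N &
     forall x, \sum_(y <- Y') y.1 x *: y.2 = \sum_(y <- Y) y.1 x *: y.2].
Proof.
move=> cS; elim: cS B Y => [|{}N {}S v _ IH sv] B Y AB B0 Y1 Y2.
  by exists Y, 0%N; split => //; exact: reach_refl.
have [a [b [u [w [aA bA uS wS vE]]]]] := sv.
(* The newest row [v] is eliminated: the weights it carries are summed into [h], which is then
   passed on to [u] and [w]. *)
pose Yv := [seq y <- Y | y.2 == v]; pose Yn := [seq y <- Y | y.2 != v].
pose h x := \sum_(y <- Yv) y.1 x.
pose f x := a * h x; pose g x := b * h x.
have rh : reach (@fun_step _) B (size Yv) [:: h].
  have -> : h = cst 0 + \sum_(y <- Yv) y.1.
    by apply/funext => x; rewrite /h add0r fct_sumE.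
  apply: reach_sum => //; first exact: fun_step_sub.
    by move=> S1 f1 f2 ? ?; exists Add, f1, f2; split.
  by move=> y; rewrite mem_filter => /andP[_ yY]; apply/Y1/map_f.
have rfg : reach (@fun_step _) B (size Yv + 2) [:: f; g].
  apply: reach_cutr rh _; first exact: fun_step_sub.
  apply: (@reach_cut _ _ (@fun_step_sub _) _ 1 1 [:: f] [:: g]).
    apply: reach_step; exists Mul, (cst a), h; split => //; last by rewrite inE eqxx.
    by rewrite inE AB ?orbT// map_f.
  apply: reach_step; exists Mul, (cst b), h; split => //; last by rewrite !inE eqxx orbT.
  by rewrite !inE AB ?orbT// map_f.
pose Y1' := (f, u) :: (g, w) :: Yn.
have Bsub : {subset B <= [:: f; g] ++ B} by move=> k kB; rewrite mem_cat kB orbT.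
have [||||Y' [c [rY' Y'S cE YE]]] := IH ([:: f; g] ++ B) Y1'.
- by move=> k /AB; exact: Bsub.
- exact: Bsub.
- move=> k /=; rewrite !inE => /or3P[->//|->|]; first by rewrite orbT.
  by move=> /mapP[y]; rewrite mem_filter => /andP[_ yY] ->; rewrite Y1 ?orbT// map_f.
- move=> k /=; rewrite !inE => /or3P[/eqP->//|/eqP->//|].
  move=> /mapP[y]; rewrite mem_filter => /andP[yv yY] ->.
  by have := Y2 _ (map_f snd yY); rewrite inE (negbTE yv).
(* Operations plus pairs form a potential. Summing the weights of [v] costs [size Yv] and removes as
   many pairs; two products and two new pairs give the 4 per step. *)
exists Y', (size Yv + 2 + c)%N; split => //.
- by apply: reach_cutr rfg rY'; exact: fun_step_sub.
- have -> : size Y = (size Yv + size Yn)%N.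
    by rewrite !size_filter -[LHS](count_predC (fun y : _ * _ => y.2 == v)).
  move: cE; rewrite /Y1' /=; lia.
- move=> x; rewrite YE /Y1' !big_cons /= addrA.
  have -> : f x *: u + g x *: w = h x *: v.
    by rewrite vE scalerDr !scalerA ![h x * _]mulrC.
  rewrite [RHS](bigID (fun y => y.2 == v))/=.
  rewrite -[X in _ = X + _]big_filter -[X in _ = _ + X]big_filter.
  congr (_ + _).
  rewrite scaler_suml; apply: eq_big_seq => y; rewrite mem_filter => /andP[/eqP -> _] //.
Qed.

(** [M *m x] is the sum of the transposed rows [y.2] weighted by [y.1 * (y.2 *m x)]. Evaluation
    costs [3 * Nl], the weights [size Y], and transposition with the final sums
    [4 * Nl + size Y]. *)
Lemma computes_gram (K A : seq R) n (M : 'M[R]_n) (Y : seq (R * 'rV[R]_n)) Ns Nl :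
  0 \in K -> reach arith_step K Ns A ->
  reach (lin_step A) (0 :: [seq delta_mx 0 i | i <- enum 'I_n]) Nl [seq y.2 | y <- Y] ->
  {subset [seq y.1 | y <- Y] <= A} ->
  M = \sum_(y <- Y) y.1 *: (y.2^T *m y.2) ->
  exists prog out, (size prog <= Ns + 7 * Nl + 2 * size Y)%N /\ computes K prog out M.
Proof.
move=> K0 rA rY YA ME.
pose B0 := [seq cst a | a <- K] ++ [seq @proj n i | i <- enum 'I_n].
pose cA : seq ('cV[R]_n -> R) := [seq cst a | a <- A].
have rcA : reach (@fun_step _) B0 Ns cA.
  by apply: reach_cst rA _ => f fK; rewrite mem_cat fK.
have z0 : cst 0 \in B0 by rewrite mem_cat map_f.
(* One chain is fixed, to be run forwards for the values of the rows and backwards for the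
   transposition. *)
have [N' [S [N'N cS YS]]] := rY.
have rYS : reach (lin_step A) (0 :: [seq delta_mx 0 i | i <- enum 'I_n]) N' [seq y.2 | y <- Y].
  by exists N', S.
pose B1 := cA ++ B0.
have B01 : {subset B0 <= B1} by move=> f fB; rewrite mem_cat fB orbT.
have rR : reach (@fun_step _) B1 (3 * N') [seq row_fun u | u <- [seq y.2 | y <- Y]].
  apply: reach_row rYS _ _ => f.
    by rewrite mem_cat => ->.
  move=> /mapP[u]; rewrite inE => /orP[/eqP -> ->|/mapP[i _ ->] ->]; apply: B01.
    have -> : row_fun (0 : 'rV[R]_n) = cst 0; last exact: z0.
    by apply/funext => x; rewrite /row_fun mul0mx mxE.
  have -> : row_fun (delta_mx 0 i : 'rV[R]_n) = proj i.
    by apply/funext => x; rewrite /row_fun /proj -rowE mxE.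
  by rewrite mem_cat map_f ?orbT// mem_enum.
pose Y' := [seq ((fun x => y.1 * row_fun y.2 x), y.2) | y <- Y].
pose B2 := [seq row_fun u | u <- [seq y.2 | y <- Y]] ++ B1.
have B12 : {subset B1 <= B2} by move=> f fB; rewrite mem_cat fB orbT.
have cAB1 : {subset cA <= B1} by move=> f fB; rewrite mem_cat fB.
have rF : reach (@fun_step _) B2 (size Y) [seq y.1 | y <- Y'].
  rewrite -map_comp -sum1_size; apply: reach_tasks; first exact: fun_step_sub.
  move=> s1 y s2 YE; have yY : y \in Y by rewrite YE mem_cat inE eqxx orbT.
  apply: reach_step; exists Mul, (cst y.1), (row_fun y.2); split => //.
    rewrite mem_cat (_ : cst y.1 \in B2) ?orbT//; apply/B12/cAB1/map_f/YA/map_f.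
    exact: yY.
  by rewrite mem_cat (_ : row_fun y.2 \in B2) ?orbT// mem_cat map_f// map_f.
pose B3 := [seq y.1 | y <- Y'] ++ B2.
have B23 : {subset B2 <= B3} by move=> f fB; rewrite mem_cat fB orbT.
have [||||Z [c [rZ ZS cE ZE]]] := @reach_adjoint _ A _ S N' B3 Y' cS.
- by move=> f /cAB1/B12/B23.
- exact/B23/B12/B01.
- by move=> f fY; rewrite mem_cat fY.
- by rewrite -map_comp.
have sY' : size Y' = size Y by rewrite size_map.
(* Every remaining row is 0 or a unit row, so a pair contributes to at most one entry of the result,
   and all entries together cost at most [size Z] sums. *)
have rO : reach (@fun_step _) ([seq y.1 | y <- Z] ++ B3) (size Z)
    [seq (fun x => (M *m x) i 0) | i <- enum 'I_n].
  apply: (@reach_weak _ _ (@fun_step_sub _) ([seq y.1 | y <- Z] ++ B3) _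
    (\sum_(i <- enum (ordinal n))
      count (fun y : _ * _ => y.2 == delta_mx (0 : ordinal 1)%R i) Z)%N
      _ [seq (fun x => (M *m x) i 0) | i <- enum 'I_n]) => //; last first.
    rewrite (eq_bigr (fun i : 'I_n =>
      \sum_(y <- Z) (y.2 == delta_mx (0 : ordinal 1)%R i : nat))%N); last first.
      by move=> u _; rewrite -sum1_count big_mkcond; apply: eq_bigr => y _; case: eqP.
    rewrite exchange_big /= -[size Z]sum1_size leq_sum// => y _.
    rewrite (eq_bigr (fun i =>
      if y.2 == delta_mx (0 : ordinal 1)%R i then 1%N else 0%N)); last first.
      by move=> i _; case: eqP.
    rewrite -big_mkcond sum1_count.
    have [/hasP[i _ /eqP yi]|/hasPn yN] :=
      boolP (has (fun i => y.2 == delta_mx 0 i) (enum 'I_n)).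
      rewrite (@eq_count _ _ (pred1 i)); last first.
        move=> j; rewrite yi /=; apply/eqP/eqP => [|-> //].
        move=> /rowP/(_ j); rewrite !mxE !eqxx /=; case: eqP => // _ /eqP.
        by rewrite eq_sym oner_eq0.
      by rewrite count_uniq_mem ?enum_uniq// mem_enum.
    by rewrite (@eq_in_count _ _ pred0) ?count_pred0// => j /yN/negbTE.
  apply: (@reach_tasks _ _ (@fun_step_sub _) _ (fun i x => (M *m x) i 0)
    (fun i => count (fun y : _ * _ => y.2 == delta_mx 0 i) Z)).
  move=> s1 i s2 _; rewrite -size_filter.
  apply: (@reach_sub _ _ (@fun_step_sub _) ([seq y.1 | y <- Z] ++ B3)); last first.
    by move=> v vZ; rewrite mem_cat vZ orbT.
  have -> : (fun x => (M *m x) i 0) =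
      cst 0 + \sum_(y <- [seq y <- Z | y.2 == delta_mx 0 i]) y.1.
    apply/funext => x; rewrite add0r fct_sumE big_filter.
    have -> : M *m x = (\sum_(y <- Z) y.1 x *: y.2)^T.
      rewrite ZE big_map /= ME mulmx_suml linear_sum /=.
      apply: eq_bigr => y _; rewrite -scalemxAl -mulmxA linearZ/= -scalerA; congr (_ *: _).
      rewrite [y.2 *m x]mx11_scalar -[(y.2 *m x) 0 0]/(row_fun y.2 x).
      by rewrite mul_mx_scalar.
    rewrite mxE summxE [RHS]big_mkcond; apply: eq_big_seq => y yZ.
    have := ZS _ (map_f snd yZ); rewrite inE => /orP[/eqP y0|/mapP[j _ yj]].
      rewrite y0 !mxE mulr0; case: eqP => // /rowP/(_ i); rewrite !mxE !eqxx /= => /eqP.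
      by rewrite eq_sym oner_eq0.
    rewrite yj !mxE eqxx /=; case: (i =P j) => [->|/eqP ij]; first by rewrite !eqxx mulr1.
    rewrite mulr0; case: eqP => // /rowP/(_ i); rewrite !mxE !eqxx /= (negbTE ij) => /eqP.
    by rewrite eq_sym oner_eq0.
  apply: reach_sum; first exact: fun_step_sub.
  - by move=> S1 f1 f2 ? ?; exists Add, f1, f2; split.
  - by rewrite mem_cat (B23 _ (B12 _ (B01 _ z0))) orbT.
  - by move=> y; rewrite mem_filter => /andP[_ yZ]; rewrite mem_cat map_f.
have := reach_cutr (@fun_step_sub _) rcA (reach_cutr (@fun_step_sub _) rR
   (reach_cutr (@fun_step_sub _) rF (reach_cutr (@fun_step_sub _) rZ rO))).
move=> /computes_reach[prog [out [szp cp]]]; exists prog, out; split => //.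
apply: leq_trans szp _; move: cE; rewrite sY'; lia.
Qed.
End Programs.

(** * The binary forest *)

Section Forest.
Context {R : realType} {d : nat}.
Implicit Types (P F : {fset cell R d}) (c : cell R d).

(** [F] stands for all the nodes, interior ones and leaves, of the binary forest with leaves [P]:
    interior nodes have both children and leaves have none. *)
Definition forest (T0 : {fset tsimplex R d}) P F :=
  [/\ {subset P <= F}, {in F, forall c, c.1 \in T0},
      forall c b, (child c b \in F) = (c \in F) && (c \notin P) &
      (#|` F|%fset <= 2 * #|` P|%fset)%N].

Lemma mem_roots (T0 : {fset tsimplex R d}) c :
  (c \in roots T0) = (c.1 \in T0) && (c.2 == [::]).
Proof.
apply/imfsetP/andP => /= [[T TinT ->]//|[cT0 /eqP c2]].
by exists c.1 => //; case: c c2 {cT0} => ? ? /= ->.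
Qed.

Lemma child_inj c c' b b' : child c b = child c' b' -> c = c' /\ b = b'.
Proof. by case: c => T s; case: c' => T' s' [-> -> ->]. Qed.

Lemma child_neq c b : (c == child c b) = false.
Proof.
apply/negbTE/eqP => /(congr1 (fun c : cell R d => size c.2)) /= /eqP.
by rewrite -addn1 -{1}[size _]addn0 eqn_add2l.
Qed.

(** A bisection adds two nodes and increases the number of leaves by one, which preserves the bound
    on the size. *)
Lemma ex_forest (T0 : {fset tsimplex R d}) P : bisections T0 P -> exists F, forest T0 P F.
Proof.
elim=> [|{}P c _ [F [PF FT0 Fc F2]] cP].
  exists (roots T0); split => //.
  - by move=> c; rewrite mem_roots => /andP[].
  - by move=> c b; rewrite andbN mem_roots andbF.
  - by rewrite leq_pmull.
have cF := PF _ cP; have chF b : child c b \notin F by rewrite Fc cP andbF.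
have chP b : child c b \notin P by apply: contra (chF b) => /PF.
exists (child c false |` (child c true |` F))%fset; split.
- by move=> x; rewrite !inE => /or3P[->//|->|/andP[_ /PF ->]]; rewrite !orbT.
- by move=> x; rewrite !inE => /or3P[/eqP->|/eqP->|/FT0 //]; exact: (FT0 _ cF).
- move=> x b; rewrite !inE.
  have [->|xc] := eqVneq x c.
    by rewrite !child_neq cF; case: b; rewrite eqxx ?orbT.
  have -> : (child x b == child c false) = false.
    by apply/negbTE; apply: contra xc => /eqP/child_inj[-> _].
  have -> : (child x b == child c true) = false.
    by apply/negbTE; apply: contra xc => /eqP/child_inj[-> _].
  rewrite /= Fc.
  have [->|x1] := eqVneq x (child c false); first by rewrite (negbTE (chF _)).
  have [->|x2] := eqVneq x (child c true); first by rewrite (negbTE (chF _)).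
  by [].
- rewrite !cardfsU1 !inE.
  have -> : (child c false == child c true) = false.
    by apply/negbTE/eqP => /child_inj[].
  rewrite !(negbTE (chF _)) !(negbTE (chP _)) !andbF /=.
  by have := cardfsD1 c P; rewrite cP; move: F2 => /=; lia.
Qed.

Section Levels.
Variables (T0 : {fset tsimplex R d}) (P F : {fset cell R d}).
Hypothesis PF : forest T0 P F.

(** Descending from an interior node increases the generation, which is bounded on the finite set
    [F]; so a leaf of at least the same generation is reached. *)
Lemma forest_gen c : c \in F -> (gen c <= max_gen P)%N.
Proof.
have [subP _ Fc _] := PF; pose N := (\max_(c <- F) gen c)%N.
have FN x : x \in F -> (gen x <= N)%N by move=> xF; exact: leq_bigmax_seq.
have: (N <= gen c + N)%N by rewrite leq_addl.
move: {2}N => k; elim: k c => [|k IH] c Nc cF.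
  have [cP|cP] := boolP (c \in P); first exact: leq_bigmax_seq.
  have := FN (child c false); rewrite Fc cF cP => /(_ isT).
  by move: Nc; rewrite /gen /=; lia.
have [cP|cP] := boolP (c \in P); first exact: leq_bigmax_seq.
have := IH (child c false); rewrite Fc cF cP /gen /=; move: Nc; rewrite /gen.
by move=> ? /(_ _ isT) H; apply: ltnW; apply: H; lia.
Qed.

Lemma forest_parent c : c \in F -> (0 < gen c)%N ->
  exists b, [/\ c = child (parent c) b, parent c \in F & parent c \notin P].
Proof.
have [_ _ Fc _] := PF; case: c => T [//|b s] cF _; exists b.
by have := Fc (T, s) b; rewrite /child /= cF => /esym/andP[].
Qed.

(** Replaces the recursive coarsening by a test on a single cell, which makes sums over consecutive
    levels comparable. The induction runs over the number of coarsenings, downwards from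
    [max_gen P]. *)
Lemma mem_level j c : (j <= max_gen P)%N ->
  (c \in level P j) = (c \in F) && ((gen c == j) || (c \in P) && (gen c < j)%N).
Proof.
have [subP _ Fc _] := PF.
move=> jL; rewrite /level -{2 3}(subKn jL).
have := leq_subr j (max_gen P); move: (max_gen P - j)%N => {jL} n.
elim: n c => [|n IH] c nL /=.
  rewrite subn0; apply/idP/idP => [cP|/andP[cF]].
    by rewrite subP// cP /= -leq_eqVlt; exact/forest_gen/subP.
  case/predU1P => [gc|/andP[] //]; apply: contraT => cP.
  by have := @forest_gen (child c false); rewrite Fc cF cP /gen /= -gc ltnn => /(_ isT).
have {}IH c0 := IH c0 (ltnW nL).
have LnE : (max_gen P - n = (max_gen P - n.+1).+1)%N by rewrite subnSK.
apply/imfsetP/andP => /= [[c0 + ->]|[cF cj]].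
  rewrite IH => /andP[c0F]; case: eqP => [gc _|gc /= /andP[c0P c0j]].
    have [|b [_ pF _]] := forest_parent c0F; first by rewrite gc LnE.
    split=> //; apply/orP; left; move: gc; rewrite LnE /gen /=.
    by rewrite size_behead => ->.
  split => //; rewrite c0P /= -leq_eqVlt -ltnS -LnE; move: c0j.
  by rewrite leq_eqVlt.
have [cP|cP] := boolP (c \in P).
  have gcn : (gen c < max_gen P - n)%N.
    by move: cj; rewrite cP /= -leq_eqVlt LnE ltnS.
  by exists c; rewrite ?IH ?cF ?cP ?gcn ?orbT// (ltn_eqF gcn).
move: cj; rewrite (negbTE cP) orbF => /eqP gc.
(* An interior node enters the coarser level as the parent of its children, which belong to the
   finer one. *)
have gch : gen (child c false) = (max_gen P - n)%N by rewrite /gen /= -/(gen c) gc -LnE.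
by exists (child c false); rewrite ?IH ?Fc ?cF ?cP ?gch ?eqxx//; case: (c).
Qed.

Lemma level_max : level P (max_gen P) = P.
Proof. by rewrite /level subnn. Qed.

Lemma level_sub j : (j <= max_gen P)%N -> {subset level P j <= F}.
Proof. by move=> jL c; rewrite mem_level// => /andP[]. Qed.

Lemma big_level (V : nmodType) j (p : pred (cell R d)) (f : cell R d -> V) :
  (j <= max_gen P)%N ->
  \sum_(c <- level P j | p c) f c =
  \sum_(c <- F | ((gen c == j) || (c \in P) && (gen c < j)%N) && p c) f c.
Proof.
move=> jL; rewrite -[RHS]big_filter_cond; apply: perm_big.
apply: uniq_perm; rewrite ?filter_uniq ?fset_uniq// => c.
by rewrite mem_filter mem_level// andbC.
Qed.

Lemma big_levelS (V : zmodType) j (p : pred (cell R d)) (f : cell R d -> V) :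
  (j < max_gen P)%N ->
  \sum_(c <- level P j.+1 | p c) f c =
  \sum_(c <- level P j | p c) f c + \sum_(c <- F | (gen c == j.+1) && p c) f c
  - \sum_(c <- F | [&& gen c == j, c \notin P & p c]) f c.
Proof.
move=> jL; rewrite !big_level ?(ltnW jL)//.
rewrite !(big_mkcond _ f) -big_split -sumrB /=; apply: eq_bigr => c _.
case: (p c); rewrite ?andbF ?andbT ?addr0 ?subr0//.
have [->|/eqP gcj] := gen c =P j.
  by rewrite ltnn ltnSn andbT ltn_eqF//=; case: (c \in P); rewrite /= ?addr0 ?subr0// subrr.
rewrite /= subr0 ltnS leq_eqVlt (negbTE gcj) /=.
have [->|/eqP gcj1] := gen c =P j.+1; last by rewrite addr0.
by rewrite (ltnNge _ j) leqnSn andbF add0r.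
Qed.
End Levels.

Lemma mem_nodes P (z : 'rV[R]_d) :
  reflect (exists2 c, c \in P & z \in vertices c) (z \in nodes P).
Proof.
apply: (iffP idP) => [/imfset2P/=[c cP [z' z'c ->]]|[c cP zc]]; first by exists c.
by apply/imfset2P; exists c => //=; exists z.
Qed.
End Forest.

Lemma sum_nat_const_seq (I : Type) (s : seq I) n : (\sum_(i <- s) n = size s * n)%N.
Proof. by rewrite big_const_seq count_predT iter_addn_0 mulnC. Qed.

Lemma leq_sum_seq (I : eqType) (s : seq I) (f g : I -> nat) :
  {in s, forall i, (f i <= g i)%N} -> (\sum_(i <- s) f i <= \sum_(i <- s) g i)%N.
Proof. by move=> fg; rewrite big_seq [X in (_ <= X)%N]big_seq leq_sum. Qed.

(** * Sums over the cells around a node, updated from level to level *)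

Section VertexSums.
Context {R : realType} {d : nat}.
Local Notation point := 'rV[R]_d.
Variables (T0 : {fset tsimplex R d}) (P F : {fset cell R d}).
Hypothesis PF : forest T0 P F.
Hypothesis size_vertices : {in F, forall c, size (vertices c) = d.+1}.
Hypothesis vertices_child : forall c z, c \in F -> z \in vertices c ->
  exists b, z \in vertices (child c b).

(** The pairs of a node and a level at which work is done. They are bounded by the vertices of all
    cells of the forest, counted with multiplicity. *)
Definition active : seq (point * nat) :=
  undup [seq (z, gen c) | c <- F, z <- vertices c].

Lemma activeP z j :
  reflect (exists c, [/\ c \in F, gen c = j & z \in vertices c]) ((z, j) \in active).
Proof.
rewrite mem_undup; apply: (iffP idP).
  by move=> /allpairsPdep[c [z' [cF zc [-> ->]]]]; exists c.
by move=> [c [cF <- zc]]; apply/allpairsPdep; exists c, z.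
Qed.

Lemma active_le a : a \in active -> (a.2 <= max_gen P)%N.
Proof. by case: a => z j /activeP[c [cF <- _]]; exact: (forest_gen PF). Qed.

Lemma size_active : (size active <= #|` F|%fset * d.+1)%N.
Proof.
apply: leq_trans (size_undup _) _.
rewrite size_allpairs_dep sumnE big_map -sum_nat_const_seq leq_sum_seq// => c cF.
by rewrite size_vertices.
Qed.

(** For [e = 0] these are the cells that enter the sum at [a]; for [e = 1] they include those that
    leave it. Adding [e] to the generation avoids a truncated subtraction at level 0. *)
Definition incidences e (a : point * nat) :=
  count (fun c => ((gen c + e)%N == a.2) && (a.1 \in vertices c)) (enum_fset F).

(** Double counting: a cell has one relevant level and [d.+1] vertices. *)
Lemma sum_incidences e : (\sum_(a <- active) incidences e a <= #|` F|%fset * d.+1)%N.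
Proof.
rewrite (eq_bigr (fun a => \sum_(c <- F)
    (((gen c + e)%N == a.2) && (a.1 \in vertices c) : nat))%N); last first.
  by move=> a _; rewrite /incidences -sum1_count big_mkcond; apply: eq_bigr => c _; case: ifP.
rewrite exchange_big /= -sum_nat_const_seq leq_sum_seq// => c cF.
rewrite (eq_bigr (fun a : point * nat =>
    if ((gen c + e)%N == a.2) && (a.1 \in vertices c) then 1%N else 0%N)); last first.
  by move=> a _; case: ifP.
rewrite -big_mkcond sum1_count -size_filter.
have -> : d.+1 = size [seq (z, (gen c + e)%N) | z <- vertices c].
  by rewrite size_map size_vertices.
apply: uniq_leq_size; first by rewrite filter_uniq ?undup_uniq.
move=> [z j]; rewrite mem_filter /= => /andP[/andP[/eqP <- zc] _].
exact: (map_f (fun z => (z, (gen c + e)%N))).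
Qed.

Lemma nodes_level_active j z : (j < max_gen P)%N -> z \in nodes (level P j.+1) ->
  (z, j.+1) \in active \/ z \in nodes (level P j).
Proof.
move=> jL /mem_nodes[c]; rewrite (mem_level PF)// => /andP[cF] /orP[/eqP gc|].
  by left; apply/activeP; exists c.
move=> /andP[cP cj] zc; right; apply/mem_nodes; exists c => //.
by rewrite (mem_level PF) ?(ltnW jL)// cF cP /= -leq_eqVlt.
Qed.

Lemma active0 z : z \in nodes (level P 0) -> (z, 0%N) \in active.
Proof.
move=> /mem_nodes[c]; rewrite (mem_level PF)// ltn0 andbF orbF => /andP[cF /eqP gc] zc.
by apply/activeP; exists c.
Qed.

Section Values.
Variables (V : zmodType) (q : cell R d -> point -> V).

(** Both the denominator (volumes) and the numerator (rows) of the averages defining [H_j] have this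
    form, hence the general [V]. *)
Definition vertex_sum j z : V := \sum_(c <- level P j | z \in vertices c) q c z.

Lemma vertex_sum_notin j z : z \notin nodes (level P j) -> vertex_sum j z = 0.
Proof.
move=> zj; rewrite /vertex_sum big_seq_cond big_pred0// => c.
apply/negP => /andP[cj zc]; move/negP: zj; apply; apply/mem_nodes.
by exists c.
Qed.

Lemma vertex_sumS j z : (j < max_gen P)%N ->
  vertex_sum j.+1 z = vertex_sum j z
    + \sum_(c <- F | (gen c == j.+1) && (z \in vertices c)) q c z
    - \sum_(c <- F | [&& gen c == j, c \notin P & z \in vertices c]) q c z.
Proof. exact: (big_levelS PF). Qed.

(** Nothing leaves the sum either: an interior cell of generation [j] at [z] has a child with vertex
    [z], which would make [(z, j.+1)] active. *)
Lemma vertex_sum_inactive j z : (j < max_gen P)%N -> (z, j.+1) \notin active ->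
  vertex_sum j.+1 z = vertex_sum j z.
Proof.
move=> jL zj; rewrite vertex_sumS//.
rewrite big_seq_cond big_pred0 ?addr0; last first.
  move=> c; apply/negP => /and3P[cF /eqP gc zc]; move/negP: zj; apply.
  by apply/activeP; exists c.
rewrite big_seq_cond big_pred0 ?subr0// => c.
apply/negP => /and4P[cF /eqP gc cP zc]; move/negP: zj; apply.
have [b zb] := vertices_child cF zc; have [_ _ Fc _] := PF.
by apply/activeP; exists (child c b); rewrite Fc cF cP /gen /= -/(gen c) gc.
Qed.

End Values.

(** Values at inactive levels are looked up instead of recomputed. The level [i] is chosen before
    [V] and [q], so that numerator and denominator are read at the same level. *)
Lemma last_active j z : (j <= max_gen P)%N -> z \in nodes (level P j) ->
  exists i, [/\ (i <= j)%N, (z, i) \in active &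
    forall (V : zmodType) (q : cell R d -> point -> V), vertex_sum q i z = vertex_sum q j z].
Proof.
elim: j => [|j IH] jL zj; first by exists 0%N; split => //; exact: active0.
have [zj1|zj1] := boolP ((z, j.+1) \in active); first by exists j.+1.
have [zA|/(IH (ltnW jL))[i [ij zi iE]]] := nodes_level_active jL zj.
  by rewrite zA in zj1.
exists i; split => //; first exact: leqW.
by move=> V q; rewrite iE vertex_sum_inactive.
Qed.

Lemma reach_vertex_sum (V : zmodType) (q : cell R d -> point -> V) (step : seq V -> V -> Prop)
    (step_sub : forall S S' v, {subset S <= S'} -> step S v -> step S' v)
    (stepD : forall S u v, u \in S -> v \in S -> step S (u + v))
    (stepB : forall S u v, u \in S -> v \in S -> step S (u - v)) S0 :
  0 \in S0 -> {in F, forall c z, z \in vertices c -> q c z \in S0} ->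
  reach step S0 (3 * (#|` F|%fset * d.+1)) [seq vertex_sum q a.2 a.1 | a <- active].
Proof.
move=> S00 qS0.
(* Per active pair: one sum per entering cell, one sum per leaving cell, and one subtraction. *)
apply: (@reach_leq _ _ step_sub S0
  (\sum_(a <- active) (incidences 0 a + (incidences 1 a + 1)))); last first.
  have := sum_incidences 0; have := sum_incidences 1; have := size_active.
  rewrite !big_split /= sum_nat_const_seq muln1; lia.
apply: (@reach_ranked _ _ step_sub _ _ _ _ _ snd) => -[z j] zj /=.
have qS (p : pred (cell R d)) S c :
    c \in [seq c <- enum_fset F | p c && (z \in vertices c)] -> q c z \in S ++ S0.
  by rewrite mem_filter mem_cat => /andP[/andP[_ zc] cF]; rewrite qS0 ?orbT.
pose S1 := [seq vertex_sum q a.2 a.1 | a <- active & (a.2 < j)%N] ++ S0.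
have S10 : 0 \in S1 by rewrite mem_cat S00 orbT.
have jL := active_le zj.
case: j zj @S1 S10 jL => [|j] zj S1 S10 jL.
  apply: (@reach_leq _ _ step_sub S1 (incidences 0 (z, 0%N))); last by rewrite leq_addr.
  rewrite /vertex_sum (big_level PF)//.
  rewrite (eq_bigl (fun c => ((gen c + 0)%N == 0%N) && (z \in vertices c))); last first.
    by move=> c; rewrite ltn0 andbF orbF addn0.
  rewrite -big_filter -[\sum_(c <- _) _]add0r /incidences -size_filter.
  by apply: reach_sum => // c cF; apply: (qS (fun c => (gen c + 0)%N == 0%N)).
(* The previous sum is available: it equals the one at the last active level, or is 0 if [z] is not
   yet a node. *)
have uS : vertex_sum q j z \in S1.
  have [/(last_active (ltnW jL))[i [ij zi <-]]|] :=
      boolP (z \in nodes (level P j)); last first.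
    by move=> /vertex_sum_notin ->.
  rewrite mem_cat; apply/orP; left.
  by apply/mapP; exists (z, i) => //; rewrite mem_filter zi /= ltnS ij.
set u := vertex_sum q j z in uS.
pose F1 := [seq c <- enum_fset F | (gen c + 0 == j.+1)%N && (z \in vertices c)].
pose F2 := [seq c <- enum_fset F | ((gen c == j) && (c \notin P)) && (z \in vertices c)].
pose w := u + \sum_(c <- F1) q c z; pose t := 0 + \sum_(c <- F2) q c z.
have -> : vertex_sum q j.+1 z = w - t.
  rewrite vertex_sumS// /w /t add0r !big_filter; congr (_ + _ - _).
    by apply: eq_bigl => c; rewrite addn0.
  by apply: eq_bigl => c; rewrite andbA.
apply: (@reach_cutr _ _ step_sub S1 (incidences 0 (z, j.+1)) _ [:: w]).
  rewrite /incidences -size_filter; apply: reach_sum => // c.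
  exact: (qS (fun c => gen c + 0 == j.+1)%N).
apply: (@reach_cutr _ _ step_sub _ (incidences 1 (z, j.+1)) 1 [:: t]).
  apply: (@reach_weak _ _ step_sub S1 _ (size F2) _ [:: t]); last by [].
  - apply: reach_sum => // c; exact: (qS (fun c => (gen c == j) && (c \notin P))).
  - by move=> x xS; rewrite mem_cat xS orbT.
  - rewrite /F2 /incidences size_filter; apply: sub_count => c /andP[/andP[/eqP -> _] /=].
    by rewrite addn1 eqxx.
apply: reach_step; apply: stepB; last by rewrite inE eqxx.
by rewrite !inE eqxx orbT.
Qed.
End VertexSums.

(** * Simplices and bisection *)

Section Simplices.
Context {R : realType} {d : nat}.
Local Notation point := 'rV[R]_d.
Implicit Types (z : seq point) (x y : point) (g : nat) (b : bool).

(** Homogeneous coordinates: affine combinations of points become linear combinations of rows, and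
    barycentric coordinates the solution of a linear system. *)
Definition homog x : 'rV[R]_(1 + d) := row_mx (const_mx 1) x.

Definition vertex_mx z : 'M[R]_(1 + d) := \matrix_(i < 1 + d) homog z`_i.

Definition edge_mx z : 'M[R]_d := \matrix_(i < d) (z`_i.+1 - z`_0).

Lemma barycentricE z x : barycentric z x = homog x *m invmx (vertex_mx z).
Proof. by []. Qed.

(** Subtracting the first row from the others gives [vertex_mx] and [edge_mx] the same determinant,
    so nondegeneracy is invertibility of [vertex_mx]. *)
Lemma vertex_mxE z : vertex_mx z =
  block_mx 1%:M 0 (const_mx 1) 1%:M *m block_mx 1%:M z`_0 0 (edge_mx z).
Proof.
rewrite mulmx_block !mul1mx !mul0mx !mulmx1 !addr0.
apply/row_matrixP => i; rewrite rowK; case: (split_ordP i) => j ->.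
  rewrite /block_mx rowKu !row_row_mx [j]ord1; congr row_mx.
    by apply/rowP => k; rewrite !mxE !ord1 eqxx.
  by apply/rowP => k; rewrite !mxE.
rewrite /block_mx rowKd !row_row_mx; congr row_mx.
  by apply/rowP => k; rewrite !mxE.
apply/rowP => k; rewrite mxE 2!mxE big_ord1 !mxE mul1r.
by rewrite addrC subrK.
Qed.

Lemma nondegenerateE z : nondegenerate z <-> size z = d.+1 /\ vertex_mx z \in unitmx.
Proof.
rewrite /nondegenerate -/(edge_mx z) row_free_unit !unitmxE vertex_mxE det_mulmx.
by rewrite det_lblock det_ublock !det1 !mul1r.
Qed.

Lemma homog_comb (I : Type) (s : seq I) (w : I -> R) (y : I -> point) :
  \sum_(i <- s) w i = 1 ->
  \sum_(i <- s) w i *: homog (y i) = homog (\sum_(i <- s) w i *: y i).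
Proof.
move=> w1; rewrite /homog; under eq_bigr do rewrite scale_row_mx.
have -> (u v : I -> _) : \sum_(i <- s) row_mx (u i) (v i) =
    row_mx (\sum_(i <- s) u i) (\sum_(i <- s) v i) :> 'rV[R]_(1 + d).
  elim/big_rec3: _ => [|i A B C _ ->]; first by rewrite row_mx0.
  by rewrite add_row_mx.
congr row_mx; apply/rowP => k; rewrite summxE mxE -[RHS]w1.
by apply: eq_bigr => i _; rewrite !mxE mulr1.
Qed.

Lemma barycentric_comb z (I : Type) (s : seq I) (w : I -> R) (y : I -> point) :
  \sum_(i <- s) w i = 1 ->
  barycentric z (\sum_(i <- s) w i *: y i) = \sum_(i <- s) w i *: barycentric z (y i).
Proof.
move=> w1; rewrite barycentricE -homog_comb// mulmx_suml.
by apply: eq_bigr => i _; rewrite -scalemxAl.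
Qed.

Section Nondegenerate.
Variable z : seq point.
Hypothesis nz : nondegenerate z.

Lemma size_nondegenerate : size z = d.+1. Proof. by case: nz. Qed.

Lemma vertex_mx_unit : vertex_mx z \in unitmx.
Proof. by have /nondegenerateE[] := nz. Qed.

Lemma barycentric_vertex (i : 'I_(1 + d)) : barycentric z z`_i = delta_mx 0 i.
Proof.
rewrite barycentricE (_ : homog _ = row i (vertex_mx z)); last by rewrite rowK.
by rewrite -row_mul mulmxV ?vertex_mx_unit// row1.
Qed.

Lemma homog_barycentric x : barycentric z x *m vertex_mx z = homog x.
Proof. by rewrite barycentricE mulmxKV// vertex_mx_unit. Qed.

Lemma sum_barycentric x : \sum_i barycentric z x 0 i = 1.
Proof.
have /rowP/(_ (lshift d ord0)) := homog_barycentric x.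
rewrite /homog row_mxEl !mxE => <-; apply: eq_bigr => i _.
by rewrite [vertex_mx z _ _]mxE /homog row_mxEl [const_mx _ _ _]mxE mulr1.
Qed.

Lemma barycentricK x : \sum_(i < 1 + d) barycentric z x 0 i *: z`_i = x.
Proof.
apply/rowP => k; rewrite summxE.
have /rowP/(_ (rshift 1 k)) := homog_barycentric x.
rewrite /homog row_mxEr !mxE => <-; apply: eq_bigr => i _.
by rewrite mxE [vertex_mx z _ _]mxE /homog row_mxEr.
Qed.

Lemma barycentric_uniq (l : 'I_(1 + d) -> R) : \sum_i l i = 1 ->
  barycentric z (\sum_(i < 1 + d) l i *: z`_i) = \row_i l i.
Proof.
move=> l1; rewrite barycentric_comb//.
under eq_bigr do rewrite barycentric_vertex.
by apply/rowP => k; rewrite summxE (bigD1 k)//= !mxE !eqxx mulr1 big1 ?addr0// => i ik;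
   rewrite !mxE eqxx eq_sym (negbTE ik) mulr0.
Qed.

Lemma open_simplexE : open_simplex z = [set x | forall i, 0 < barycentric z x 0 i].
Proof.
have sz := size_nondegenerate.
have big_cast (W : nmodType) (F : 'I_(size z) -> W) :
    \sum_i F i = \sum_(i < 1 + d) F (cast_ord (esym sz) i).
  by rewrite (reindex (cast_ord (esym sz)))//; exists (cast_ord sz) => i _;
     rewrite ?cast_ordK ?cast_ordKV.
apply/seteqP; split => x.
  move=> [l [l0 l1 ->]] i; rewrite big_cast.
  rewrite (barycentric_uniq (l := fun i => l (cast_ord (esym sz) i))) ?mxE//.
  by rewrite -big_cast.
move=> x0; exists (fun i => barycentric z x 0 (cast_ord sz i)).
split; first by move=> i; exact: x0.
- by rewrite big_cast -[RHS](sum_barycentric x); apply: eq_bigr => i _; rewrite cast_ordKV.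
- rewrite big_cast -[LHS]barycentricK; apply: eq_bigr => i _ /=.
  by rewrite cast_ordKV.
Qed.

Lemma barycentric_lt1 x : open_simplex z x -> forall i, 0 < barycentric z x 0 i <= 1.
Proof.
rewrite open_simplexE => x0 i; rewrite x0 -(sum_barycentric x) (bigD1 i)//= lerDl.
by rewrite sumr_ge0// => k _; exact: ltW.
Qed.
End Nondegenerate.

Section Bisection.
Variables (z : seq point) (g : nat).
Hypothesis (d0 : (0 < d)%N) (sz : size z = d.+1) (gd : (g < d)%N).

Definition midpoint : point := 2^-1 *: (z`_0 + z`_d).

(** The type affects only the order of the vertices, not the vertex set of a child. *)
Lemma mem_bisect b x : (x \in (bisect (z, g) b).1) =
  [|| x == (if b then z`_d else z`_0), x == midpoint |
      x \in [seq z`_i | i <- index_iota 1 d]].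
Proof.
case: b; rewrite /= !inE ?mem_cat ?mem_rev// -mem_cat -map_cat.
congr [|| _, _ | x \in map _ _]; rewrite /index_iota !subn1 /= -iotaD.
by congr iota; lia.
Qed.

Lemma size_bisect b : size (bisect (z, g) b).1 = d.+1.
Proof. by case: b; rewrite /= ?size_cat ?size_rev !size_map !size_iota; lia. Qed.

Lemma mem_middle k : (0 < k < d)%N -> z`_k \in [seq z`_i | i <- index_iota 1 d].
Proof. by move=> kd; apply: map_f; rewrite mem_index_iota. Qed.

Lemma midpoint_bisect b : midpoint \in (bisect (z, g) b).1.
Proof. by rewrite mem_bisect eqxx orbT. Qed.

Lemma bisect_child x b : x \in (bisect (z, g) b).1 -> x \in z \/ x = midpoint.
Proof.
rewrite mem_bisect => /or3P[/eqP ->|/eqP ->|/mapP[i]]; [left|by right|].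
  by case: b; rewrite mem_nth ?sz.
by rewrite mem_index_iota => /andP[_ id_] ->; left; rewrite mem_nth// sz ltnW// ltnS.
Qed.

Lemma bisect_parent x : x \in z -> exists b, x \in (bisect (z, g) b).1.
Proof.
move=> /(nthP 0)[i]; rewrite sz ltnS => id_ <-.
have [->|i0] := posnP i; first by exists false; rewrite mem_bisect eqxx.
move: id_; rewrite leq_eqVlt => /predU1P[->|id_].
  by exists true; rewrite mem_bisect eqxx.
by exists true; rewrite mem_bisect mem_middle ?i0 ?orbT.
Qed.

Hypothesis uz : vertex_mx z \in unitmx.

Lemma homog_sub (z' : seq point) x : size z' = d.+1 -> x \in z' ->
  (homog x <= vertex_mx z')%MS.
Proof.
move=> sz' /(nthP 0)[i]; rewrite sz' => id_ <-.
by rewrite -[homog _](rowK (fun i : 'I_(1 + d) => homog z'`_i) (Ordinal id_)) row_sub.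
Qed.

(** The vertex lost in a child is twice the midpoint minus the other end of the edge, so the rows of
    the child span those of the parent. *)
Lemma bisect_unit b : vertex_mx (bisect (z, g) b).1 \in unitmx.
Proof.
rewrite -row_full_unit -sub1mx; set z' := (bisect _ _).1.
have fz : (1%:M <= vertex_mx z)%MS by rewrite sub1mx row_full_unit.
apply: (submx_trans fz).
have zs x : x \in z' -> (homog x <= vertex_mx z')%MS.
  by apply: homog_sub; exact: size_bisect.
have hm : homog midpoint *+ 2 = homog z`_0 + homog z`_d.
  rewrite /homog add_row_mx mulr2n add_row_mx; congr row_mx.
  by rewrite -mulr2n /midpoint -scaler_nat scalerA mulfV// scale1r.
have ms := zs _ (midpoint_bisect b).
apply/row_subP => i; rewrite rowK.
have [i0|i0] := posnP i.
  rewrite i0; case: b @z' zs hm ms => z' zs hm ms; last first.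
    by apply: zs; rewrite mem_bisect eqxx.
  rewrite -[homog _](addrK (homog z`_d)) -hm addmx_sub//; first by rewrite mulr2n addmx_sub.
  by rewrite eqmx_opp zs// mem_bisect eqxx.
have : (i <= d)%N by exact: ltn_ord i.
rewrite leq_eqVlt => /predU1P[iE|id_]; last first.
  by apply: zs; rewrite mem_bisect mem_middle ?i0 ?id_ ?orbT.
rewrite iE; case: b @z' zs hm ms => z' zs hm ms.
  by apply: zs; rewrite mem_bisect eqxx.
rewrite -[homog _](addKr (homog z`_0)) -hm addmx_sub//; last by rewrite mulr2n addmx_sub.
by rewrite eqmx_opp zs// mem_bisect eqxx.
Qed.
End Bisection.

Lemma bisect_nondegenerate z g b : (0 < d)%N -> (g < d)%N ->
  nondegenerate z -> nondegenerate (bisect (z, g) b).1.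
Proof.
move=> d0 gd /nondegenerateE[sz uz]; apply/nondegenerateE.
by split; [exact: size_bisect|exact: bisect_unit].
Qed.
End Simplices.

Section BisectedSimplex.
Context {R : realType} {d : nat}.
Local Notation point := 'rV[R]_d.
Variables (z : seq point) (g : nat).
Hypotheses (d0 : (0 < d)%N) (gd : (g < d)%N) (nz : nondegenerate z).

Let first : 'I_(1 + d) := ord0.
Let last : 'I_(1 + d) := ord_max.

Let sz : size z = d.+1. Proof. exact: size_nondegenerate. Qed.

Let first_last : (first == last) = false.
Proof. by apply/negbTE; rewrite -val_eqE /= eq_sym -lt0n. Qed.

Lemma barycentric_midpoint :
  barycentric z (midpoint z) = 2^-1 *: (delta_mx 0 first + delta_mx 0 last).
Proof.
have -> : midpoint z = \sum_(i <- [:: first; last]) 2^-1 *: z`_i.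
  by rewrite big_cons big_seq1 -scalerDr.
rewrite barycentric_comb; last by rewrite big_cons big_seq1; lra.
by rewrite big_cons big_seq1 !barycentric_vertex// -scalerDr.
Qed.

Lemma barycentric_bisect_ge0 b y k : y \in (bisect (z, g) b).1 ->
  0 <= barycentric z y 0 k.
Proof.
rewrite mem_bisect// => /or3P[/eqP ->|/eqP ->|/mapP[i]].
- case: b; first by rewrite (barycentric_vertex nz last) mxE ler0n.
  by rewrite (barycentric_vertex nz first) mxE ler0n.
- by rewrite barycentric_midpoint !mxE mulr_ge0 ?invr_ge0// addr_ge0.
- rewrite mem_index_iota => /andP[_ id_] ->.
  by rewrite (barycentric_vertex nz (Ordinal (leqW id_))) mxE ler0n.
Qed.

Lemma barycentric_bisect_gt0 b k :
  exists2 y, y \in (bisect (z, g) b).1 & 0 < barycentric z y 0 k.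
Proof.
have m0 : k = first \/ k = last -> 0 < barycentric z (midpoint z) 0 k.
  move=> kfl; rewrite barycentric_midpoint !mxE mulr_gt0 ?invr_gt0//.
  case: kfl => ->; rewrite !eqxx ?first_last ?[last == _]eq_sym ?first_last /=;
    by rewrite ?addr0 ?add0r.
have [kf|/eqP kf] := k =P first.
  by exists (midpoint z); [exact: midpoint_bisect|apply: m0; left].
have [kl|/eqP kl] := k =P last.
  by exists (midpoint z); [exact: midpoint_bisect|apply: m0; right].
have kd : (0 < k < d)%N.
  have : (k <= d)%N by exact: ltn_ord k.
  rewrite leq_eqVlt lt0n; move: kf kl; rewrite -!val_eqE /= => -> /negbTE ->.
  by [].
exists z`_k; first by rewrite mem_bisect// mem_middle// !orbT.
by rewrite barycentric_vertex// mxE !eqxx.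
Qed.

Lemma barycentric_child b x k :
  barycentric z x 0 k = \sum_(i < 1 + d)
    barycentric (bisect (z, g) b).1 x 0 i * barycentric z (bisect (z, g) b).1`_i 0 k.
Proof.
have nz' := bisect_nondegenerate b d0 gd nz.
rewrite -{1}(barycentricK nz' x) barycentric_comb ?sum_barycentric// summxE.
by apply: eq_bigr => i _; rewrite mxE.
Qed.

(** Parent coordinates of a point are its child coordinates averaged over the child's vertices,
    where every parent coordinate is nonnegative and somewhere positive. *)
Lemma bisect_sub b : open_simplex (bisect (z, g) b).1 `<=` open_simplex z.
Proof.
have nz' := bisect_nondegenerate b d0 gd nz.
rewrite !open_simplexE// => x x0 k; rewrite (barycentric_child b).
have [y /(nthP 0)[i]] := barycentric_bisect_gt0 b k.
rewrite size_nondegenerate// => id_ <- yk.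
rewrite (bigD1 (Ordinal id_))//= ltr_pwDl// ?mulr_gt0//.
apply: sumr_ge0 => j _; rewrite mulr_ge0 ?(ltW (x0 _))//.
by apply: (@barycentric_bisect_ge0 b); rewrite mem_nth// size_nondegenerate//; exact: ltn_ord.
Qed.

(** The children lie on the two sides of the hyperplane where the first and last barycentric
    coordinates agree. *)
Lemma bisect_order b x : open_simplex (bisect (z, g) b).1 x ->
  if b then barycentric z x 0 first < barycentric z x 0 last
  else barycentric z x 0 last < barycentric z x 0 first.
Proof.
have nz' := bisect_nondegenerate b d0 gd nz.
rewrite open_simplexE// => x0.
(* A linear form in the barycentric coordinates that is nonnegative at the vertices of the child and
   positive at one of them is positive inside it. *)
have ge0 (v : 'cV[R]_(1 + d)) :
    (forall y, y \in (bisect (z, g) b).1 -> 0 <= (barycentric z y *m v) 0 0) ->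
    (exists2 y, y \in (bisect (z, g) b).1 & 0 < (barycentric z y *m v) 0 0) ->
    0 < (barycentric z x *m v) 0 0.
  move=> v0 [y /(nthP 0)[i]]; rewrite size_nondegenerate// => id_ <- yv.
  have -> : barycentric z x *m v = \sum_(i < 1 + d)
      barycentric (bisect (z, g) b).1 x 0 i *: (barycentric z (bisect (z, g) b).1`_i *m v).
    rewrite -{1}(barycentricK nz' x) barycentric_comb ?sum_barycentric// mulmx_suml.
    by apply: eq_bigr => j _; rewrite scalemxAl.
  rewrite summxE (bigD1 (Ordinal id_))//= mxE ltr_pwDl// ?mulr_gt0//.
  apply: sumr_ge0 => j _; rewrite mxE mulr_ge0 ?(ltW (x0 _))// v0//.
  by rewrite mem_nth// size_nondegenerate//; exact: ltn_ord.
pose v : 'cV[R]_(1 + d) := (-1) ^+ b *: (delta_mx first 0 - delta_mx last 0).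
have vE y : (barycentric z y *m v) 0 0 =
    (-1) ^+ b * (barycentric z y 0 first - barycentric z y 0 last).
  rewrite -scalemxAr mxE mulmxBr; congr (_ * _).
  by rewrite -!colE !mxE.
have : 0 < (barycentric z x *m v) 0 0.
  apply: ge0.
    move=> y; rewrite vE mem_bisect// => /or3P[/eqP ->|/eqP ->|/mapP[i]].
    - case: b {x0 v vE nz'} => /=.
        by rewrite (barycentric_vertex nz last) !mxE !eqxx first_last /= expr1; lra.
      rewrite (barycentric_vertex nz first) !mxE !eqxx [last == _]eq_sym first_last /=.
      by rewrite expr0; lra.
    - rewrite barycentric_midpoint !mxE !eqxx first_last [last == _]eq_sym first_last /=.
      by rewrite [X in _ * X](_ : _ = 0) ?mulr0//; lra.
    - rewrite mem_index_iota => /andP[i0 id_] ->.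
      rewrite (barycentric_vertex nz (Ordinal (leqW id_))) !mxE -!val_eqE /=.
      by rewrite [_ == i]eq_sym (gtn_eqF i0) (gtn_eqF id_) subrr mulr0.
  exists (if b then z`_d else z`_0); first by rewrite mem_bisect// eqxx.
  rewrite vE; case: b {x0 v vE nz'} => /=.
    by rewrite (barycentric_vertex nz last) !mxE !eqxx first_last /= expr1; lra.
  rewrite (barycentric_vertex nz first) !mxE !eqxx [last == _]eq_sym first_last /=.
  by rewrite expr0; lra.
by rewrite vE; case: b {x0 v vE nz' ge0} => /=; rewrite ?expr1 ?expr0; lra.
Qed.

Lemma bisect_disjoint x :
  open_simplex (bisect (z, g) false).1 x -> ~ open_simplex (bisect (z, g) true).1 x.
Proof.
move=> /(@bisect_order false)/= xf /(@bisect_order true)/= xt.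
by have := lt_trans xf xt; rewrite ltxx.
Qed.
End BisectedSimplex.

(** * Affine maps and the reference simplex *)

Section AffineMaps.
Context {R : realType} {d : nat}.
Local Notation point := 'rV[R]_d.
Implicit Types (z : seq point) (x y : point).

Definition affine_map (A : 'M[R]_d) (c : point) x : point := x *m A + c.

Lemma homog_affine A c x :
  homog (affine_map A c x) = homog x *m block_mx 1%:M c 0 A.
Proof.
rewrite /homog mul_row_block mulmx1 mulmx0 addr0; congr row_mx.
rewrite /affine_map [RHS]addrC; congr (_ + _).
by apply/rowP => k; rewrite !mxE big_ord1 mxE mul1r.
Qed.

Lemma vertex_mx_affine A c z : size z = d.+1 ->
  vertex_mx [seq affine_map A c x | x <- z] = vertex_mx z *m block_mx 1%:M c 0 A.
Proof.
move=> sz; apply/row_matrixP => i; rewrite row_mul !rowK -homog_affine.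
by rewrite (nth_map 0) ?sz//; exact: ltn_ord.
Qed.

Lemma block_affine_unit (A : 'M[R]_d) (c : point) : A \in unitmx ->
  (block_mx 1%:M c 0 A : 'M[R]_(1 + d)) \in unitmx.
Proof. by rewrite !unitmxE det_ublock det1 mul1r. Qed.

Lemma nondegenerate_affine A c z : A \in unitmx -> nondegenerate z ->
  nondegenerate [seq affine_map A c x | x <- z].
Proof.
move=> uA nz; have [sz uz] := (nondegenerateE z).1 nz.
apply/nondegenerateE; rewrite size_map vertex_mx_affine// unitmx_mul uz.
by rewrite block_affine_unit.
Qed.

Lemma barycentric_affine A c z x : A \in unitmx -> nondegenerate z ->
  barycentric [seq affine_map A c x | x <- z] (affine_map A c x) = barycentric z x.
Proof.
move=> uA nz; have [sz uz] := (nondegenerateE z).1 nz.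
rewrite !barycentricE homog_affine vertex_mx_affine//.
have uVN : vertex_mx z *m block_mx 1%:M c 0 A \in unitmx.
  by rewrite unitmx_mul uz block_affine_unit.
by apply: (canLR (mulmxK uVN)); rewrite mulmxA mulmxKV.
Qed.

Lemma open_simplex_affine A c z : A \in unitmx -> nondegenerate z ->
  affine_map A c @^-1` open_simplex [seq affine_map A c x | x <- z] = open_simplex z.
Proof.
move=> uA nz; rewrite !open_simplexE//; last exact: nondegenerate_affine.
by apply/seteqP; split => x /= x0 i; have := x0 i; rewrite barycentric_affine.
Qed.

Lemma bisect_affine A c z g b : (0 < d)%N -> (g < d)%N -> size z = d.+1 ->
  (bisect ([seq affine_map A c x | x <- z], g) b).1 =
  [seq affine_map A c x | x <- (bisect (z, g) b).1].
Proof.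
move=> d0 gd sz.
have nthE i : (i <= d)%N -> [seq affine_map A c x | x <- z]`_i = affine_map A c z`_i.
  by move=> id_; rewrite (nth_map 0) ?sz.
have mapE s : (forall i, i \in s -> (i <= d)%N) ->
    [seq [seq affine_map A c x | x <- z]`_i | i <- s] = [seq affine_map A c z`_i | i <- s].
  by move=> sd; apply/eq_in_map => i /sd/nthE.
have midE : 2^-1 *: ([seq affine_map A c x | x <- z]`_0 + [seq affine_map A c x | x <- z]`_d) =
    affine_map A c (2^-1 *: (z`_0 + z`_d)).
  rewrite !nthE// /affine_map -scalemxAl mulmxDl addrACA scalerDr; congr (_ + _).
  by rewrite -mulr2n -[c *+ 2]scaler_nat scalerA mulVf ?scale1r.
case: b; rewrite /= ?map_cat ?map_rev midE nthE// -?map_comp.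
  by rewrite !mapE// => i; rewrite mem_index_iota; lia.
by rewrite mapE// => i; rewrite mem_index_iota; lia.
Qed.

Definition ref_simplex : seq point := 0 :: [seq delta_mx 0 i | i <- enum 'I_d].

Lemma size_ref : size ref_simplex = d.+1.
Proof. by rewrite /= size_map size_enum_ord. Qed.

Lemma nth_ref (i : 'I_d) : ref_simplex`_i.+1 = delta_mx 0 i.
Proof. by rewrite /= (nth_map i) ?size_enum_ord// nth_ord_enum. Qed.

Lemma nondegenerate_ref : nondegenerate ref_simplex.
Proof.
split; first exact: size_ref.
rewrite (_ : \matrix_(_ < _) _ = 1%:M) ?row_free_unit ?unitmx1//.
by apply/row_matrixP => i; rewrite rowK nth_ref subr0 row1.
Qed.

Lemma affine_ref z : nondegenerate z ->
  exists2 A : 'M[R]_d, A \in unitmx & z = [seq affine_map A z`_0 x | x <- ref_simplex].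
Proof.
move=> [sz]; rewrite row_free_unit => uA; exists (edge_mx z) => //.
apply: (@eq_from_nth _ 0); first by rewrite size_map size_ref.
move=> i; rewrite sz => id_; rewrite (nth_map 0) ?size_ref//.
case: i id_ => [_|i id_]; first by rewrite /affine_map mul0mx add0r.
rewrite ltnS in id_; rewrite (nth_ref (Ordinal id_)) /affine_map.
by rewrite -rowE rowK subrK.
Qed.

(* The entries of the transition matrix from the barycentric coordinates in a
   child to those in its parent, which only depend on the type of the parent. *)
Definition transition g b (i k : 'I_(1 + d)) : R :=
  barycentric ref_simplex (bisect (ref_simplex, g) b).1`_i 0 k.

(** Bisection commutes with affine maps and barycentric coordinates are invariant under them, so [z]
    may be replaced by the reference simplex. *)
Lemma transitionE z g b (i k : 'I_(1 + d)) : (0 < d)%N -> (g < d)%N -> nondegenerate z ->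
  barycentric z (bisect (z, g) b).1`_i 0 k = transition g b i k.
Proof.
move=> d0 gd nz; have [A uA zE] := affine_ref nz.
rewrite {1 2}zE bisect_affine ?size_ref// (nth_map 0); last first.
  by rewrite size_bisect ?size_ref//; exact: ltn_ord.
by rewrite barycentric_affine//; exact: nondegenerate_ref.
Qed.
End AffineMaps.

Lemma continuous_sumr (R : realType) (T : topologicalType) (I : Type) (s : seq I)
    (f : I -> T -> R) : (forall i, continuous (f i)) ->
  continuous (fun x => \sum_(i <- s) f i x).
Proof.
move=> fc; elim: s => [|i s IH] x.
  by under eq_fun do rewrite big_nil; exact: cst_continuous.
under eq_fun do rewrite big_cons.
by apply: cvgD; [exact: fc|exact: IH].
Qed.

(** * Topology and measure of open simplices *)

Section SimplexTopology.
Context {R : realType} {d : nat}.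
Local Notation point := 'rV[R]_d.
Local Notation mu := (@lebesgue_rV R d).
Implicit Types (z : seq point) (x y : point).

Lemma barycentric_coordE z x i : barycentric z x 0 i =
  \sum_j x 0 j * invmx (vertex_mx z) (rshift 1 j) i + invmx (vertex_mx z) (lshift d 0) i.
Proof.
rewrite barycentricE mxE big_split_ord big_ord1 /= addrC; congr (_ + _).
  by apply: eq_bigr => j _; rewrite /homog row_mxEr.
by rewrite /homog row_mxEl mxE mul1r.
Qed.

Lemma barycentric_continuous z i : continuous (fun x => barycentric z x 0 i).
Proof.
have fc : continuous (fun x : point =>
    \sum_j x 0 j * invmx (vertex_mx z) (rshift 1 j) i).
  apply: continuous_sumr => j y.
  apply: (@continuousM _ _ (fun x : point => x 0 j) (cst _)); last exact: cst_continuous.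
  exact: (@coord_continuous R 1 d 0 j y).
rewrite (_ : (fun x => _) = (fun x : point =>
    \sum_j x 0 j * invmx (vertex_mx z) (rshift 1 j) i) \+
    cst (invmx (vertex_mx z) (lshift d 0) i)).
  by move=> x; apply: continuousD; [exact: fc|exact: cst_continuous].
by apply/funext => x; exact: barycentric_coordE.
Qed.

Lemma measurable_barycentric z i :
  measurable_fun [set: point] (fun x => barycentric z x 0 i).
Proof.
under eq_fun do rewrite barycentric_coordE.
apply: measurable_funD; last exact: measurable_cst.
apply: measurable_sum => j; apply: measurable_funM; last exact: measurable_cst.
exact: measurable_coord.
Qed.

Variable z : seq point.
Hypothesis nz : nondegenerate z.

Lemma open_open_simplex : open (open_simplex z).
Proof.
rewrite open_simplexE// openE => x x0.
apply: (@filter_forall _ _ (fun i y => 0 < barycentric z y 0 i) (nbhs x)) => i.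
have : nbhs (barycentric z x 0 i) [set t | 0 < t].
  by apply: open_nbhs_nbhs; split; [exact: open_gt|exact: x0].
exact: barycentric_continuous.
Qed.

Lemma measurable_open_simplex : measurable (open_simplex z).
Proof.
rewrite open_simplexE//.
rewrite (_ : [set x | _] = \bigcap_(i in [set: 'I_(1 + d)])
    (fun x => barycentric z x 0 i) @^-1` `]0, +oo[).
  apply: fin_bigcap_measurable; first exact: finite_finset.
  move=> i _; rewrite -[X in measurable X]setTI.
  by apply: measurable_barycentric => //; exact: measurable_itv.
apply/seteqP; split => x /= x0 i.
  by move=> _; rewrite /= in_itv/= andbT x0.
by have := x0 i I; rewrite /= in_itv/= andbT.
Qed.

Lemma open_simplex_bounded : exists2 r : R, 0 < r & open_simplex z `<=` box 0 r.
Proof.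
exists (1 + \sum_(i < 1 + d) \sum_j `|z`_i 0 j|).
  by rewrite ltr_pwDl// sumr_ge0// => i _; rewrite sumr_ge0.
move=> x xz j; rewrite /ball/= mxE sub0r normrN.
rewrite -{1}(barycentricK nz x) summxE ltr_pwDl//.
apply: le_trans (ler_norm_sum _ _ _) _; apply: ler_sum => i _.
have /andP[b0 b1] := barycentric_lt1 nz xz i.
rewrite mxE normrM (ger0_norm (ltW b0)) (bigD1 j)//=.
apply: ler_wpDr; first by rewrite sumr_ge0.
by rewrite ler_piMl.
Qed.

Lemma open_simplex_fin : (mu (open_simplex z) < +oo)%E.
Proof.
have [r r0 zr] := open_simplex_bounded.
apply: (@le_lt_trans _ _ (mu (box 0 r))).
  by apply: le_measure; rewrite ?inE//; [exact: measurable_open_simplex|exact: measurable_box].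
by rewrite lebesgue_rV_box// ltry.
Qed.

Lemma vertex_closure y : y \in z -> closure (open_simplex z) y.
Proof.
have sz := size_nondegenerate nz.
move=> /(nthP 0)[i]; rewrite sz => id_ <- B.
(* The barycentre: moving from a vertex a positive fraction [t] of the way towards it makes all
   coordinates positive. *)
pose c : point := \sum_(k < 1 + d) (1 + d)%:R^-1 *: z`_k.
pose p (t : R) := z`_i + t *: (c - z`_i).
have pc : p t @[t --> (0 : R)] --> z`_i.
  rewrite [X in _ --> X](_ : _ = p 0); last by rewrite /p scale0r addr0.
  by apply: cvgD; [exact: cvg_cst|exact: scalel_continuous].
move=> /pc /nbhs_ballP[e /= e0 eB].
pose t : R := Num.min 1 (e / 2).
have t0 : 0 < t by rewrite lt_min ltr01 divr_gt0.
have t1 : t <= 1 by rewrite ge_min lexx.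
exists (p t); split; last first.
  apply: eB; rewrite /ball/= sub0r normrN gtr0_norm//.
  by rewrite gt_min; apply/orP; right; rewrite ltr_pdivrMr// ltr_pMr// ltr1n.
rewrite open_simplexE// => k.
have -> : p t = \sum_(k < 1 + d) (t * (1 + d)%:R^-1 + (1 - t) * (k == i :> nat)%:R) *: z`_k.
  have sumi : \sum_(k < 1 + d) (k == i :> nat)%:R *: z`_k = z`_i.
    rewrite (bigD1 (Ordinal id_))//= eqxx scale1r big1 ?addr0// => j.
    by rewrite -val_eqE /= => /negbTE ->; rewrite scale0r.
  under eq_bigr do rewrite scalerDl -!scalerA.
  rewrite big_split /= -scaler_sumr -/c -scaler_sumr sumi.
  by rewrite /p scalerBr scalerBl scale1r addrCA.
rewrite (barycentric_uniq nz (l := fun k => t * (1 + d)%:R^-1 + (1 - t) * (k == i :> nat)%:R)).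
  by rewrite mxE ltr_pwDl ?mulr_ge0 ?subr_ge0 ?ler0n// mulr_gt0// invr_gt0.
rewrite big_split /= -mulr_sumr -mulr_sumr sumr_const card_ord -[_ *+ (1 + d)]mulr_natr.
rewrite mulVf// (bigD1 (Ordinal id_))//= eqxx big1; last first.
  by move=> j; rewrite -val_eqE /= => /negbTE ->.
by rewrite addr0 !mulr1 subrKC.
Qed.

Lemma open_simplex_gt0 : (0 < mu (open_simplex z))%E.
Proof.
have sz := size_nondegenerate nz.
have /vertex_closure/(_ setT filterT)[x [xz _]] : z`_0 \in z by rewrite mem_nth ?sz.
have [e e0 eA] := nbhs_box (open_nbhs_nbhs (conj open_open_simplex xz)).
apply: lt_le_trans (_ : mu (box x e) <= _)%E.
  by rewrite lebesgue_rV_box// lte_fin exprn_gt0// mulrn_wgt0.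
by apply: le_measure; rewrite ?inE//; [exact: measurable_box|exact: measurable_open_simplex].
Qed.

Lemma fine_open_simplex_gt0 : 0 < fine (mu (open_simplex z)).
Proof. by rewrite fine_gt0// open_simplex_gt0 open_simplex_fin. Qed.
End SimplexTopology.

(** * Moments of the local nodal basis *)

Section RintegralSum.
Context d (T : measurableType d) (R : realType) (mu : {measure set T -> \bar R}).

Lemma integrable_Rsum (I : Type) (s : seq I) (f : I -> T -> R) :
  (forall i, mu.-integrable setT (EFin \o f i)) ->
  mu.-integrable setT (EFin \o (fun x => \sum_(i <- s) f i x)) /\
  \int[mu]_x (\sum_(i <- s) f i x) = \sum_(i <- s) \int[mu]_x f i x.
Proof.
move=> fi; elim: s => [|i s [IH1 IH2]].
  rewrite big_nil (_ : (fun x => _) = cst 0); last by apply/funext => x; rewrite big_nil.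
  split; last by rewrite Rintegral_cst// mul0r.
  exact: integrable0.
rewrite big_cons (_ : (fun x => _) = (fun x => f i x + \sum_(i <- s) f i x)); last first.
  by apply/funext => x; rewrite big_cons.
split; last by rewrite RintegralD// IH2.
exact: (integrableD measurableT (fi i) IH1).
Qed.
End RintegralSum.

Section Hats.
Context {R : realType} {d : nat}.
Local Notation point := 'rV[R]_d.
Local Notation mu := (@lebesgue_rV R d).
Implicit Types (z : seq point) (x y : point).

(** The function of [disc_basis] on an arbitrary simplex, which may also be an interior node of the
    forest. *)
Definition hat z (i : 'I_(1 + d)) x : R :=
  if x \in open_simplex z then barycentric z x 0 i else 0.

Lemma hat_in z i x : open_simplex z x -> hat z i x = barycentric z x 0 i.
Proof. by rewrite /hat => /mem_set ->. Qed.

Lemma hat_out z i x : ~ open_simplex z x -> hat z i x = 0.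
Proof. by move=> xz; rewrite /hat memNset. Qed.

Lemma hat_bound z i x : nondegenerate z -> 0 <= hat z i x <= 1.
Proof.
move=> nz; have [xz|xz] := pselect (open_simplex z x); last by rewrite hat_out// lexx ler01.
by rewrite hat_in//; have /andP[/ltW -> ->] := barycentric_lt1 nz xz i.
Qed.

Lemma measurable_hat z i : nondegenerate z ->
  measurable_fun [set: 'rV[measurableTypeR R]_d] (hat z i).
Proof.
move=> nz; rewrite (_ : hat z i = (fun x => barycentric z x 0 i) \* \1_(open_simplex z)).
  apply: measurable_funM; first exact: measurable_barycentric.
  by apply: measurable_indic; exact: measurable_open_simplex.
by apply/funext => x; rewrite /hat /= indicE; case: ifP => _; rewrite ?mulr1 ?mulr0.
Qed.

Lemma measurable_hatM z i z' j : nondegenerate z -> nondegenerate z' ->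
  measurable_fun [set: 'rV[measurableTypeR R]_d] (fun x => hat z i x * hat z' j x).
Proof. by move=> nz nz'; apply: measurable_funM; exact: measurable_hat. Qed.

Lemma integrable_hatM z i z' j : nondegenerate z -> nondegenerate z' ->
  mu.-integrable setT (EFin \o (fun x => hat z i x * hat z' j x)).
Proof.
move=> nz nz'; have mz := measurable_open_simplex nz.
have iz : mu.-integrable setT (fun x => (\1_(open_simplex z) x)%:E).
  apply/integrableP; split.
    by apply/measurable_EFinP; apply: measurable_indic; exact: measurable_open_simplex.
  rewrite (eq_integral (fun x : 'rV[measurableTypeR R]_d =>
    (\1_(open_simplex z) x)%:E)); last first.
    by move=> t _; rewrite gee0_abs// lee_fin.
  by rewrite integral_indic// setIT; exact: open_simplex_fin.
apply: (le_integrable measurableT _ _ iz).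
  by apply/measurable_EFinP; exact: measurable_hatM.
move=> x _ /=; rewrite lee_fin normrM.
have [xz|xz] := pselect (open_simplex z x); last by rewrite hat_out// normr0 mul0r.
rewrite indicE (mem_set xz) normr1.
have /andP[h0 h1] := hat_bound i x nz; have /andP[h0' h1'] := hat_bound j x nz'.
by rewrite !ger0_norm// mulr_ile1.
Qed.

Definition moment z i z' j : R := \int[mu]_x (hat z i x * hat z' j x).

Definition gram i j : R := moment ref_simplex i ref_simplex j.

Definition simplex_volume z : R := fine (mu (open_simplex z)).

Lemma simplex_volume_gt0 z : nondegenerate z -> 0 < simplex_volume z.
Proof. exact: fine_open_simplex_gt0. Qed.

Lemma moment_disjoint z i z' j : open_simplex z `&` open_simplex z' = set0 ->
  moment z i z' j = 0.
Proof.
move=> zz'; rewrite /moment (_ : (fun x => _) = cst 0); first by rewrite Rintegral_cst// mul0r.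
apply/funext => x /=; have [xz|xz] := pselect (open_simplex z x); last first.
  by rewrite hat_out ?mul0r.
rewrite [hat z' _ _]hat_out ?mulr0// => xz'.
by have : set0 x by rewrite -zz'.
Qed.

(** Change of variables from the reference simplex; the unspecified factor [C] is eliminated through
    the ratio of volumes. *)
Lemma moment_self z i j : nondegenerate z ->
  moment z i z j = simplex_volume z / simplex_volume ref_simplex * gram i j.
Proof.
move=> nz; have nr := @nondegenerate_ref R d.
have [A uA zE] := affine_ref nz.
set f := affine_map A z`_0 in zE.
have [C C0 fC] := lebesgue_rV_affine z`_0 uA.
have prez : f @^-1` open_simplex z = open_simplex ref_simplex.
  by rewrite {1}zE; exact: open_simplex_affine.
have volE : simplex_volume ref_simplex = C * simplex_volume z.
  rewrite /simplex_volume -prez fC; last exact: measurable_open_simplex.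
  by rewrite fineM// ge0_fin_numE// open_simplex_fin.
have mf : measurable_fun [set: 'rV[measurableTypeR R]_d]
    (f : _ -> 'rV[measurableTypeR R]_d) by exact: measurable_rV_affine.
have hatf k x : hat z k (f x) = hat ref_simplex k x.
  rewrite /hat.
  have -> : (f x \in open_simplex z) = (x \in open_simplex ref_simplex).
    by rewrite -prez; apply/idP/idP; rewrite !inE.
  by case: ifP => // _; rewrite {1}zE barycentric_affine.
have mg : measurable_fun [set: 'rV[measurableTypeR R]_d]
    (fun x => (hat z i x * hat z j x)%:E).
  by apply/measurable_EFinP; exact: measurable_hatM.
have g0 x : (0 <= (hat z i x * hat z j x)%:E)%E.
  have /andP[h0 _] := hat_bound i x nz; have /andP[h0' _] := hat_bound j x nz.
  by rewrite lee_fin mulr_ge0.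
have : (\int[mu]_x (hat ref_simplex i x * hat ref_simplex j x)%:E =
    C%:E * \int[mu]_x (hat z i x * hat z j x)%:E)%E.
  transitivity (\int[mu]_(x in f @^-1` setT) (hat z i (f x) * hat z j (f x))%:E)%E.
    by rewrite preimage_setT; apply: eq_integral => x _; rewrite !hatf.
  rewrite -(ge0_integral_pushforward mf mu measurableT mg (fun y _ => g0 y)).
  (* The image of [mu] under [f] is [C] times [mu]. *)
  rewrite (eq_measure_integral (mscale (NngNum (ltW C0)) mu)).
    by rewrite ge0_integral_mscale.
  move=> B mB _; exact: fC.
move=> /(congr1 fine).
rewrite fineM//; last exact: (integrable_fin_num measurableT (integrable_hatM i j nz nz)).
rewrite -[LHS]/(gram i j) -[X in _ = _ * X]/(moment z i z j) => ->.
have v0 := simplex_volume_gt0 nz.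
by rewrite volE /=; field; rewrite !gt_eqF.
Qed.

Definition gram_mx : 'M[R]_(1 + d) := \matrix_(i, j) gram i j.

(** A row in the kernel gives a combination [h] of the hats with zero square integral, so [h]
    vanishes almost everywhere, and its coefficients are values at the vertices. *)
Lemma gram_unit : gram_mx \in unitmx.
Proof.
have nr := @nondegenerate_ref R d.
rewrite -row_free_unit; apply: inj_row_free => w wG.
pose h x := \sum_i w 0 i * hat ref_simplex i x.
have hE x : h x ^+ 2 =
    \sum_i \sum_j (w 0 i * w 0 j) * (hat ref_simplex i x * hat ref_simplex j x).
  rewrite expr2 /h mulr_suml; apply: eq_bigr => i _; rewrite mulr_sumr.
  by apply: eq_bigr => j _; rewrite mulrACA.
have int_ij i j : mu.-integrable setT
    (EFin \o (fun x => (w 0 i * w 0 j) * (hat ref_simplex i x * hat ref_simplex j x))).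
  exact: (integrableZl measurableT (w 0 i * w 0 j) (integrable_hatM i j nr nr)).
have int_i i := integrable_Rsum (index_enum (ordinal (1 + d))) (int_ij i).
have [int_h int_hE] := integrable_Rsum (index_enum (ordinal (1 + d))) (fun i => (int_i i).1).
have h0 : \int[mu]_x (h x ^+ 2) = 0.
  under eq_Rintegral do rewrite hE.
  rewrite int_hE; transitivity ((w *m gram_mx *m w^T) 0 0); last by rewrite wG mul0mx mxE.
  rewrite -mulmxA mxE; apply: eq_bigr => i _; rewrite (int_i i).2 mxE mulr_sumr.
  apply: eq_bigr => j _; rewrite RintegralZl//; last exact: integrable_hatM.
  by rewrite -[X in _ * X = _]/(gram i j) !mxE; ring.
have mh2 : measurable_fun [set: 'rV[measurableTypeR R]_d] (fun x => (h x ^+ 2)%:E).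
  have := measurable_int mu int_h; congr (measurable_fun _ _).
  by apply/funext => x /=; rewrite hE.
have : ae_eq mu setT (fun x => (h x ^+ 2)%:E) (cst 0%E).
  apply/ae_eq_integral_abs => //.
  rewrite (eq_integral (fun x : 'rV[measurableTypeR R]_d => (h x ^+ 2)%:E)); last first.
    by move=> x _; rewrite /= ger0_norm// sqr_ge0.
  have int_h2 : mu.-integrable setT (EFin \o (fun x => h x ^+ 2)).
    by under [fun x => h x ^+ 2]eq_fun do rewrite hE.
  rewrite -(fineK (integrable_fin_num measurableT int_h2)).
  by rewrite -[fine _]/(\int[mu]_x (h x ^+ 2)) h0.
(* [h] is cut off outside the open simplex; its continuous version [b] can be evaluated at the
   vertices. *)
move=> h2ae; pose b x := \sum_i w 0 i * barycentric ref_simplex x 0 i.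
have bc : continuous b.
  apply: continuous_sumr => i x.
  by apply: (@continuousM _ _ (cst _)); [exact: cst_continuous|exact: barycentric_continuous].
have b0 : forall x, closure (open_simplex ref_simplex) x -> b x = 0.
  apply: ae_eq0_closure; first exact: open_open_simplex.
    exact: continuous_subspaceT.
  apply: filterS h2ae => x /(_ I) /= [] /eqP; rewrite sqrf_eq0 => /eqP hx xr.
  by rewrite -hx; apply: eq_bigr => i _; rewrite hat_in.
apply/rowP => i; rewrite mxE -[RHS](b0 ref_simplex`_i).
  rewrite /b barycentric_vertex// (bigD1 i)//= mxE !eqxx mulr1 big1 ?addr0// => j ji.
  by rewrite mxE eqxx (negbTE ji) mulr0.
by apply: vertex_closure => //; rewrite mem_nth// size_ref; exact: ltn_ord.
Qed.

(** Bisection halves the volume; as scaling factors are not identified with determinants, the ratio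
    is kept as a constant measured on the reference simplex. *)
Definition volume_ratio g b : R :=
  simplex_volume (bisect (ref_simplex, g) b).1 / simplex_volume ref_simplex.

Lemma simplex_volume_bisect z g b : (0 < d)%N -> (g < d)%N -> nondegenerate z ->
  simplex_volume (bisect (z, g) b).1 = simplex_volume z * volume_ratio g b.
Proof.
move=> d0 gd nz; have nr := @nondegenerate_ref R d.
have [A uA zE] := affine_ref nz.
have [C C0 fC] := lebesgue_rV_affine z`_0 uA.
have vol z' : nondegenerate z' ->
    simplex_volume z' = C * simplex_volume [seq affine_map A z`_0 x | x <- z'].
  move=> nz'; rewrite /simplex_volume -(open_simplex_affine z`_0 uA nz').
  have nfz := nondegenerate_affine z`_0 uA nz'.
  rewrite fC; last exact: measurable_open_simplex.
  by rewrite fineM// ge0_fin_numE// open_simplex_fin.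
rewrite /volume_ratio (vol _ nr) (vol _ (bisect_nondegenerate b d0 gd nr)).
rewrite -bisect_affine ?size_ref// -zE.
have v0 := simplex_volume_gt0 nz.
by field; rewrite !gt_eqF.
Qed.

Lemma moment_bisect z1 i z g b j : (0 < d)%N -> (g < d)%N ->
  nondegenerate z1 -> nondegenerate z ->
  open_simplex z1 `<=` open_simplex (bisect (z, g) b).1 ->
  moment z1 i z j = \sum_k moment z1 i (bisect (z, g) b).1 k * transition g b k j.
Proof.
move=> d0 gd nz1 nz z1b; have nb := bisect_nondegenerate b d0 gd nz.
have int_k k : mu.-integrable setT (EFin \o (fun x =>
    (hat z1 i x * hat (bisect (z, g) b).1 k x) * transition g b k j)).
  exact: (integrableZr measurableT (transition g b k j) (integrable_hatM i k nz1 nb)).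
have [_] := integrable_Rsum (index_enum (ordinal (1 + d))) int_k.
under [in X in _ = X -> _]eq_bigr => k _.
  rewrite RintegralZr//; last exact: integrable_hatM.
  over.
move=> <-; apply: eq_Rintegral => x _.
have [xz|xz] := pselect (open_simplex z1 x); last first.
  rewrite hat_out// mul0r big1// => k _; by rewrite !mul0r.
have xb := z1b _ xz.
rewrite [hat z j x]hat_in; last exact: (bisect_sub d0 gd nz xb).
rewrite (barycentric_child d0 gd nz b) mulr_sumr; apply: eq_bigr => k _.
by rewrite (hat_in k xb) transitionE// mulrA.
Qed.
End Hats.

(** * The cells of the forest *)

Section Cells.
Context {R : realType} {d : nat}.
Local Notation point := 'rV[R]_d.
Variables (Omega : set point) (T0 : {fset tsimplex R d}).
Hypotheses (d0 : (0 < d)%N) (T0P : initial_partition Omega T0).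
Implicit Types c : cell R d.

Definition cell_type c : nat := (cell_simplex c).2.

Lemma vertices_childE c b :
  vertices (child c b) = (bisect (vertices c, cell_type c) b).1.
Proof.
rewrite /vertices /cell_type (_ : cell_simplex (child c b) = bisect (cell_simplex c) b)//.
by case: (cell_simplex c).
Qed.

Lemma cell_wf c : c.1 \in T0 -> nondegenerate (vertices c) /\ (cell_type c < d)%N.
Proof.
have [[nd _ _ _] gd _] := T0P.
case: c => T s /= TT0; elim: s => [|b s [nz gs]].
  split; last exact: gd.
  by have [|nz _] := nd (T, [::]); first by rewrite mem_roots TT0.
have -> : (T, b :: s) = child (T, s) b by [].
rewrite vertices_childE; split; first exact: bisect_nondegenerate.
rewrite /cell_type (_ : cell_simplex _ = bisect (cell_simplex (T, s)) b)//.
by case: (cell_simplex _) => ? ?; rewrite /= ltn_mod.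
Qed.

Lemma cell_nondegenerate c : c.1 \in T0 -> nondegenerate (vertices c).
Proof. by move=> /cell_wf[]. Qed.

Lemma cell_type_lt c : c.1 \in T0 -> (cell_type c < d)%N.
Proof. by move=> /cell_wf[]. Qed.

Lemma child_sub c b : c.1 \in T0 -> cell_set (child c b) `<=` cell_set c.
Proof.
move=> /cell_wf[nz gc]; rewrite /cell_set vertices_childE.
exact: bisect_sub.
Qed.

Lemma children_disjoint c b b' : c.1 \in T0 -> b != b' ->
  cell_set (child c b) `&` cell_set (child c b') = set0.
Proof.
move=> /cell_wf[nz gc] bb'; rewrite -subset0 => x [].
rewrite /cell_set !vertices_childE.
by case: b b' bb' => -[]// _; [move=> /[swap]|]; exact: bisect_disjoint.
Qed.

Lemma descendant_sub T s t : T \in T0 -> cell_set (T, t ++ s) `<=` cell_set (T, s).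
Proof.
move=> TT0; elim: t => [//|b t IH] /=.
by apply: subset_trans IH; exact: (@child_sub (T, t ++ s)).
Qed.

Lemma cell_sub_domain c : c.1 \in T0 -> cell_set c `<=` Omega.
Proof.
have [[nd _ _ _] _ _] := T0P; case: c => T s /= TT0.
rewrite -[s]cats0; apply: subset_trans (descendant_sub TT0) _.
by have [|_ sub] := nd (T, [::]); first by rewrite mem_roots TT0.
Qed.

(** Distinct roots are disjoint and so are siblings, hence intersecting cells lie on one branch. A
    path starts with its last bisection, so an ancestor is a suffix. *)
Lemma cells_meet c c' x : c.1 \in T0 -> c'.1 \in T0 -> cell_set c x -> cell_set c' x ->
  c.1 = c'.1 /\ ((exists t, c'.2 = t ++ c.2) \/ (exists t, c.2 = t ++ c'.2)).
Proof.
have [[_ _ dj _] _ _] := T0P.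
case: c c' => T s [T' s'] /= TT0 TT0' xs xs'.
have TT' : T = T'.
  apply: contrapT => TT'; suff : set0 x by [].
  rewrite -(dj (T, [::]) (T', [::])) ?mem_roots ?TT0 ?TT0'//; last by case.
  by split; [move: xs; rewrite -[s]cats0|move: xs'; rewrite -[s']cats0]; exact: descendant_sub.
split=> //; subst T'; elim: s xs => [|b s IH] xs; first by left; exists s'; rewrite cats0.
have [|[t s'E]|[t ->]] := IH; first exact: (@child_sub (T, s) b).
(* The last entry of [t] is the branch taken by [c'] just below [(T, s)]; it is compared with the
   branch [b] taken by [c]. *)
- case/lastP: t s'E => [-> |t e s'E]; first by right; exists [:: b].
  have [eb|eb] := eqVneq b e; first by left; exists t; rewrite s'E cat_rcons eb.
  suff : set0 x by [].
  rewrite -(@children_disjoint (T, s) b e)//; split => //.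
  by move: xs'; rewrite s'E cat_rcons; exact: descendant_sub.
- by right; exists (b :: t).
Qed.

Section ForestCells.
Variables (P F : {fset cell R d}).
Hypothesis PF : forest T0 P F.

Lemma forest_root c : c \in F -> c.1 \in T0.
Proof. by have [_ FT0 _ _] := PF; exact: FT0. Qed.

Lemma forest_suffix T s t : (T, t ++ s) \in F -> (T, s) \in F.
Proof.
have [_ _ Fc _] := PF; elim: t => [//|b t IH] /= H; apply: IH.
by have := Fc (T, t ++ s) b; rewrite /child /= H => /esym/andP[].
Qed.

Lemma forest_strict T s t : (T, t ++ s) \in F -> (T, s) \in P -> t = [::].
Proof.
have [_ _ Fc _] := PF; case/lastP: t => [//|t b]; rewrite cat_rcons.
move=> /forest_suffix H sP; have := Fc (T, s) b.
by rewrite /child /= H sP andbF.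
Qed.

(** If two cells meet, one descends from the other; the ancestor is a leaf or has the maximal
    generation [j], so they coincide. *)
Lemma level_disjoint j c c' : (j <= max_gen P)%N -> c \in level P j -> c' \in level P j ->
  c <> c' -> cell_set c `&` cell_set c' = set0.
Proof.
move=> jL; rewrite !(mem_level PF)// => /andP[cF cj] /andP[cF' cj'] cc'.
have key (c1 c2 : cell R d) t : c1 \in F -> c2 \in F ->
    (gen c1 == j) || (c1 \in P) && (gen c1 < j)%N ->
    (gen c2 == j) || (c2 \in P) && (gen c2 < j)%N ->
    c1.1 = c2.1 -> c2.2 = t ++ c1.2 -> c1 = c2.
  case: c1 c2 => T s [T' s'] /= _ F2 c1j c2j TT' s'E; subst T' s'.
  move: c1j => /orP[/eqP g1|/andP[c1P _]]; last by rewrite (forest_strict F2 c1P).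
  have {}g1 : size s = j by [].
  have g2 : (size (t ++ s) <= j)%N.
    by move: c2j => /orP[/eqP <-//|/andP[_ /ltnW]].
  by move: g2; rewrite size_cat g1 -{2}[j]add0n leq_add2r leqn0 size_eq0 => /eqP ->.
rewrite -subset0 => x [xc xc']; apply: cc'.
have [TT' [[t tE]|[t tE]]] := cells_meet (forest_root cF) (forest_root cF') xc xc'.
  exact: key tE.
by apply/esym; apply: key tE.
Qed.

(** Makes every basis function of the finest space see at most one child of an interior cell. *)
Lemma leaf_child c c' : c \in F -> c \notin P -> c' \in P ->
  cell_set c' `&` cell_set c = set0 \/ exists b, cell_set c' `<=` cell_set (child c b).
Proof.
have [subP _ _ _] := PF.
move=> cF cP cP'; have [->|/set0P[x [xc' xc]]] := eqVneq (cell_set c' `&` cell_set c) set0.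
  by left.
right; have cF' := subP _ cP'.
have [TT' [[t tE]|[t tE]]] := cells_meet (forest_root cF) (forest_root cF') xc xc'.
  case: c c' TT' tE {xc xc'} cF cP cP' cF' => T s [T' s'] /= -> ->.
  case/lastP: t => [|t b] cF cP cP' cF'; first by rewrite cP' in cP.
  by exists b; rewrite cat_rcons; apply: descendant_sub; exact: (forest_root cF').
case: c c' TT' tE {xc xc'} cF cP cP' cF' => T s [T' s'] /= -> -> cF cP cP' _.
by move: cP; rewrite (forest_strict cF cP') cP'.
Qed.
End ForestCells.
End Cells.

(** * Matrix rows *)

Section Dofs.
Context {R : realType} {d : nat}.
Local Notation point := 'rV[R]_d.
Implicit Types (P : {fset cell R d}) (c : cell R d) (i : 'I_d.+1).

Definition dof P (k : 'I_(size (dofs P))) : cell R d * 'I_d.+1 :=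
  tnth (in_tuple (dofs P)) k.
Arguments dof {P} k.

Lemma mem_dofs P c i : ((c, i) \in dofs P) = (c \in P).
Proof.
apply/allpairsP/idP => [[[c' i'] /= [cP _ [-> _]]]//|cP].
by exists (c, i); rewrite mem_enum.
Qed.

Lemma dof_in P k : (@dof P k).1 \in P.
Proof.
have := mem_tnth k (in_tuple (dofs P)); rewrite -/(dof k).
by case: (dof k) => c i; rewrite mem_dofs.
Qed.

Lemma dof_inj P : injective (@dof P).
Proof.
apply/tuple_uniqP => /=; apply: allpairs_uniq; rewrite ?fset_uniq ?enum_uniq//.
by move=> [? ?] [? ?].
Qed.

Lemma ex_dof P c : c \in P -> exists kk, forall i, @dof P (kk i) = (c, i).
Proof.
move=> cP; have H i : exists k : 'I_(size (dofs P)), dof k = (c, i).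
  have /tnthP[k ->] : (c, i) \in in_tuple (dofs P) by rewrite [_ \in _]mem_dofs.
  by exists k.
by have [kk kkE] := choice H; exists kk.
Qed.

Lemma sum_dofs (V : nmodType) P c kk (f : 'I_(size (dofs P)) -> V) :
  (forall i, dof (kk i) = (c, i)) -> (forall k, (dof k).1 <> c -> f k = 0) ->
  \sum_k f k = \sum_i f (kk i).
Proof.
move=> kkE f0; rewrite (bigID (fun k => (dof k).1 == c))/= [X in _ + X]big1; last first.
  by move=> k /eqP; exact: f0.
rewrite addr0 (reindex_onto kk (fun k => (dof k).2)); last first.
  by move=> k /eqP kc; apply: dof_inj; rewrite kkE -kc; case: dof.
by apply: eq_bigl => i; rewrite kkE /= !eqxx.
Qed.

Lemma disc_basisE P k : @disc_basis R d P k = hat (vertices (dof k).1) (dof k).2.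
Proof. by rewrite /disc_basis -/(dof k); case: (dof k). Qed.
End Dofs.
Arguments dof {R d P} k.

Section Identities.
Context {R : realType} {d : nat}.
Local Notation point := 'rV[R]_d.
Local Notation mu := (@lebesgue_rV R d).
Variables (Omega gamma : set point) (T0 : {fset tsimplex R d}).
Hypotheses (d0 : (0 < d)%N) (oOmega : open Omega) (T0P : initial_partition Omega T0).
Implicit Types (P : {fset cell R d}) (c : cell R d) (z : point) (i j : 'I_(1 + d)).

Definition disjoint_cells P :=
  {in P, forall c, c.1 \in T0} /\
  {in P &, forall c c', c <> c' -> cell_set c `&` cell_set c' = set0}.

Let wf c : c.1 \in T0 -> nondegenerate (vertices c) := cell_nondegenerate d0 T0P (c := c).

Lemma lincomb_disc P c kk (a : 'cV[R]_(size (dofs P))) x : disjoint_cells P ->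
  c \in P -> (forall i, dof (kk i) = (c, i)) -> cell_set c x ->
  lincomb (@disc_basis R d P) a x = \sum_i a (kk i) 0 * barycentric (vertices c) x 0 i.
Proof.
move=> [_ dj] cP kkE xc; rewrite /lincomb (sum_dofs kkE).
  by apply: eq_bigr => i _; rewrite disc_basisE kkE hat_in.
move=> k kc; rewrite disc_basisE hat_out ?mulr0// => xk.
by have : set0 x by rewrite -(dj _ _ (dof_in k) cP kc).
Qed.

Lemma Rintegral_domain (D : set point) (f : point -> R) : (forall x, ~ D x -> f x = 0) ->
  \int[mu]_(x in D) f x = \int[mu]_x f x.
Proof.
move=> f0; rewrite Rintegral_mkcond; apply: eq_Rintegral => x _.
by rewrite patchE; case: ifPn => // /negP xD; rewrite f0// => /mem_set.
Qed.

Lemma hat_S_disc P c j : disjoint_cells P -> c \in P ->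
  S_disc Omega P (hat (vertices c) j).
Proof.
move=> [PT dj] cP; have nz := wf (PT _ cP).
split.
  split; first exact: measurable_funTS (measurable_hat j nz).
  have /integrableP[m2 i2] := integrable_hatM j j nz nz.
  apply/integrableP; split; first exact: measurable_funTS m2.
  rewrite integral_mkcond; apply: le_lt_trans i2; rewrite le_eqVlt; apply/orP; left.
  apply/eqP; apply: eq_integral => x _; rewrite patchE; case: ifPn => [_|/negP xO].
    by rewrite /= expr2.
  rewrite /= hat_out ?mul0r ?normr0// => /(cell_sub_domain d0 T0P (PT _ cP)) xO'.
  by apply: xO; exact/mem_set.
move=> c' c'P; have [->|/eqP cc'] := eqVneq c' c.
  exists (\row_k invmx (vertex_mx (vertices c)) (rshift 1 k) j),
    (invmx (vertex_mx (vertices c)) (lshift d 0) j).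
  move=> x xc; rewrite hat_in// barycentric_coordE; congr (_ + _).
  by apply: eq_bigr => k _; rewrite mxE mulrC.
exists 0, 0 => x xc'; rewrite hat_out; first by rewrite addr0 big1// => k _; rewrite mxE mul0r.
by move=> xc; have : set0 x by rewrite -(dj _ _ c'P cP cc').
Qed.

Lemma lincomb_moment P c j (a : 'cV[R]_(size (dofs P))) : disjoint_cells P -> c.1 \in T0 ->
  \int[mu]_(x in Omega) (lincomb (@disc_basis R d P) a x * hat (vertices c) j x) =
  \sum_k a k 0 * moment (vertices (dof k).1) (dof k).2 (vertices c) j.
Proof.
move=> [PT _] cT; rewrite Rintegral_domain; last first.
  move=> x xO; rewrite [hat _ _ _]hat_out ?mulr0// => xc.
  exact: xO (cell_sub_domain d0 T0P cT xc).
have nzk k := wf (PT _ (@dof_in _ _ P k)).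
have int_k k : mu.-integrable setT (EFin \o (fun x =>
    a k 0 * (hat (vertices (dof k).1) (dof k).2 x * hat (vertices c) j x))).
  exact: (integrableZl measurableT (a k 0) (integrable_hatM _ j (nzk k) (wf cT))).
have [_] := integrable_Rsum (index_enum (ordinal (size (dofs P)))) int_k.
under [in X in _ = X -> _]eq_bigr => k _.
  rewrite RintegralZl//; last exact: integrable_hatM (nzk k) (wf cT).
  over.
move=> <-; apply: eq_Rintegral => x _; rewrite /lincomb mulr_suml.
by apply: eq_bigr => k _; rewrite disc_basisE mulrA.
Qed.

(* For the coefficient vector [a] of a function [u], [(q_row P c i *m a) 0 0] is
   the volume of [c] times the value at the [i]-th vertex of the orthogonal
   projection of [u] onto the affine functions on [c]; it does not depend on a
   level of the hierarchy. *)
Definition q_row P c i : 'rV[R]_(size (dofs P)) :=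
  \row_k (simplex_volume (@ref_simplex R d) *
    ((\row_j moment (vertices (dof k).1) (dof k).2 (vertices c) j) *m invmx gram_mx) 0 i).

(** Testing the projection with the hats of [c] gives a local system with the Gram matrix times a
    ratio of volumes; the factor [volume c] cancels the dependence on the cell. *)
Lemma q_row_projection P P' c kk (Q : 'M[R]_(size (dofs P'), size (dofs P))) i :
  disjoint_cells P -> disjoint_cells P' ->
  represents (@disc_basis R d P) (@disc_basis R d P') (L2_projection Omega P') Q ->
  c \in P' -> (forall i, dof (kk i) = (c, i)) ->
  volume c *: row (kk i) Q = q_row P c i.
Proof.
move=> PD P'D Qrep cP kkE; have [PT' dj'] := P'D; have nz := wf (PT' _ cP).
have v0 := simplex_volume_gt0 nz; have r0 := simplex_volume_gt0 (@nondegenerate_ref R d).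
apply/rowP => k; rewrite [LHS]mxE [row _ _ _ _]mxE [RHS]mxE.
pose m : 'rV_(1 + d) := \row_j moment (vertices (dof k).1) (dof k).2 (vertices c) j.
pose u : 'rV_(1 + d) := \row_i Q (kk i) k.
have uG : (volume c / simplex_volume (@ref_simplex R d)) *: (u *m gram_mx) = m.
  apply/rowP => j; rewrite !mxE.
  have [_ /(_ _ (hat_S_disc j P'D cP))] := Qrep (delta_mx k 0).
  rewrite !lincomb_moment ?PT'//.
  rewrite (bigD1 k)//= mxE !eqxx mul1r big1 ?addr0; last first.
    by move=> l lk; rewrite mxE (negbTE lk) mul0r.
  move=> ->; rewrite (sum_dofs kkE); last first.
    move=> l lc; rewrite moment_disjoint ?mulr0//; exact: dj' (dof_in l) cP lc.
  rewrite mulr_sumr; apply: eq_bigr => i' _; rewrite kkE moment_self// -colE !mxE.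
  by rewrite /simplex_volume /volume /cell_set /=; ring.
rewrite -/m -uG -scalemxAl mulmxK ?gram_unit// !mxE mulrA; congr (_ * _).
by rewrite /volume mulrC divfK// gt_eqF.
Qed.

(** On a leaf a function of the finest space is already affine, so projecting changes nothing. *)
Lemma q_row_leaf P c k i : disjoint_cells P -> dof k = (c, i) ->
  q_row P c i = volume c *: delta_mx 0 k.
Proof.
move=> [PT dj] kE; have cP : c \in P by have := dof_in k; rewrite kE.
have nz := wf (PT _ cP); have r0 := simplex_volume_gt0 (@nondegenerate_ref R d).
apply/rowP => l; rewrite [LHS]mxE [RHS]mxE [delta_mx _ _ _ _]mxE eqxx /=.
have [lc|/eqP lc] := eqVneq (dof l).1 c; last first.
  rewrite (_ : \row_j _ = 0) ?mul0mx ?mxE ?mulr0.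
    by case: eqP => [lk|]; rewrite ?mulr0//; case: lc; rewrite lk kE.
  by apply/rowP => j; rewrite !mxE moment_disjoint//; exact: dj (dof_in l) cP lc.
have -> : \row_j moment (vertices (dof l).1) (dof l).2 (vertices c) j =
    (volume c / simplex_volume (@ref_simplex R d)) *: (delta_mx 0 (dof l).2 *m gram_mx).
  by apply/rowP => j; rewrite mxE lc moment_self// [RHS]mxE -rowE !mxE.
rewrite -scalemxAl mulmxK ?gram_unit// !mxE eqxx mulrA; congr (_ * (nat_of_bool _)%:R).
  by rewrite /volume mulrC divfK// gt_eqF.
apply/eqP/eqP => [il|->]; last by rewrite kE.
by apply: dof_inj; rewrite kE il -lc; case: (dof l).
Qed.

(** Moments on a child pass to the parent by the transition matrix. The conjugation by [gram_mx]
    accounts for the factor [invmx gram_mx] in [q_row]; no volume remains. *)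
Definition coarsening g b : 'M[R]_(1 + d) :=
  gram_mx *m (\matrix_(i, j) transition g b i j) *m invmx gram_mx.

Lemma q_row_child P F c i : forest T0 P F -> disjoint_cells P -> c \in F -> c \notin P ->
  q_row P c i = \sum_(b : bool) \sum_k coarsening (cell_type c) b k i *: q_row P (child c b) k.
Proof.
move=> PF [PT dj] cF cP; have cT := forest_root PF cF; have nz := wf cT.
have gc := cell_type_lt d0 T0P cT.
pose m c' l : 'rV_(1 + d) :=
  \row_j moment (vertices (@dof _ _ P l).1) (dof l).2 (vertices c') j.
pose L b : 'M[R]_(1 + d) := \matrix_(i, j) transition (cell_type c) b i j.
have childT b : (child c b).1 \in T0 by [].
have mE l : m c l = \sum_(b : bool) m (child c b) l *m L b.
  apply/rowP => j; rewrite mxE summxE.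
  have lP := @dof_in _ _ P l; have nzl := wf (PT _ lP).
  (* The leaf carrying the basis function misses [c], or lies in a single child [b0] whose moments
     alone contribute. *)
  have [dc|[b0 sb]] := leaf_child d0 T0P PF cF cP lP.
    rewrite moment_disjoint// big1// => b _; rewrite mxE big1// => k _.
    rewrite mxE moment_disjoint ?mul0r//; apply/seteqP; split=> // x [xl xb].
    by rewrite -dc; split=> //; exact: (child_sub d0 T0P cT xb).
  rewrite (bigD1 b0)//= big1 ?addr0; last first.
    move=> b bb0; rewrite mxE big1// => k _.
    rewrite mxE moment_disjoint ?mul0r//; apply/seteqP; split=> // x [xl xb].
    by rewrite -(children_disjoint d0 T0P cT bb0); split=> //; exact: sb.
  rewrite (@moment_bisect _ _ _ _ (vertices c) (cell_type c) b0)//; last first.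
    by rewrite -vertices_childE.
  by rewrite mxE; apply: eq_bigr => k _; rewrite !mxE vertices_childE.
apply/rowP => l; rewrite mxE -/(m c l) mE summxE mulmx_suml summxE mulr_sumr.
apply: eq_bigr => b _; rewrite summxE.
have -> : m (child c b) l *m L b *m invmx gram_mx =
    (m (child c b) l *m invmx gram_mx) *m coarsening (cell_type c) b.
  by rewrite /coarsening !mulmxA mulmxKV// gram_unit.
rewrite mxE mulr_sumr; apply: eq_bigr => k _; rewrite !mxE -/(m _ l).
by rewrite mulrA mulrC.
Qed.
End Identities.

(** * Embeddings and averages at the nodes *)

Section NodalIdentities.
Context {R : realType} {d : nat}.
Local Notation point := 'rV[R]_d.
Local Notation mu := (@lebesgue_rV R d).
Variables (Omega gamma : set point) (T0 : {fset tsimplex R d}).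
Hypotheses (d0 : (0 < d)%N) (oOmega : open Omega) (T0P : initial_partition Omega T0).
Implicit Types (P : {fset cell R d}) (c : cell R d) (z : point) (i j : 'I_(1 + d)).
Let wf c : c.1 \in T0 -> nondegenerate (vertices c) := cell_nondegenerate d0 T0P (c := c).

(** Evaluation at a node in nodal coordinates; at nodes on [gamma] it is 0, as the Dirichlet
    condition requires. *)
Definition node_row P z : 'rV[R]_#|` free_nodes gamma P|%fset :=
  \row_k (z == free_node k)%:R.

Lemma mem_free_nodes P z : (z \in free_nodes gamma P) = (z \in nodes P) && (z \notin gamma).
Proof. by rewrite !inE. Qed.

Lemma free_node_in P k : @free_node R d gamma P k \in free_nodes gamma P.
Proof. by rewrite /free_node mem_nth. Qed.

Lemma free_node_inj P : injective (@free_node R d gamma P).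
Proof.
move=> k l /eqP; rewrite nth_uniq ?fset_uniq ?ltn_ord// => /eqP.
exact: val_inj.
Qed.

Lemma ex_free_node P z : z \in free_nodes gamma P ->
  exists k : 'I_#|` free_nodes gamma P|%fset, z = free_node k.
Proof.
move=> zP.
have zi : (index z (enum_fset (free_nodes gamma P)) < #|` free_nodes gamma P|%fset)%N.
  by rewrite index_mem.
by exists (Ordinal zi); rewrite /free_node /= nth_index.
Qed.

Lemma node_row_free P (k : 'I_#|` free_nodes gamma P|%fset) :
  node_row P (free_node k) = delta_mx 0 k.
Proof. by apply/rowP => l; rewrite !mxE eqxx /= (inj_eq (@free_node_inj P)) eq_sym. Qed.

Lemma node_row_gamma P z : z \in gamma -> node_row P z = 0.
Proof.
move=> zg; apply/rowP => k; rewrite !mxE; case: eqP => // zk.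
by have := free_node_in k; rewrite mem_free_nodes -zk zg andbF.
Qed.

Lemma lincomb_node P phi a z :
  nodal_basis Omega (gamma := gamma) (P := P) phi -> z \in nodes P ->
  lincomb phi a z = (node_row P z *m a) 0 0.
Proof.
move=> [_ phiE] zP; rewrite /lincomb mxE; apply: eq_bigr => k _.
by rewrite !mxE mulrC; have [_ ->] := phiE k.
Qed.

Lemma closure_cell c : c.1 \in T0 -> closure (cell_set c) `<=` closure Omega.
Proof. by move=> cT; apply: closure_subset; exact: (cell_sub_domain d0 T0P). Qed.

Lemma vertex_closure_cell c z : c.1 \in T0 -> z \in vertices c -> closure (cell_set c) z.
Proof. by move=> cT zc; exact: (vertex_closure (wf cT)). Qed.

Lemma node_closure P z : {in P, forall c, c.1 \in T0} -> z \in nodes P -> closure Omega z.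
Proof.
move=> PT /mem_nodes[c cP zc].
exact: closure_cell (PT _ cP) _ (vertex_closure_cell (PT _ cP) zc).
Qed.

Lemma lincomb_continuous P phi a : nodal_basis Omega (gamma := gamma) (P := P) phi ->
  {within closure Omega, continuous (lincomb phi a)}.
Proof.
move=> [_ phiE]; apply: (@continuous_sumr R (subspace (closure Omega))) => k x.
apply: (@continuousM _ (subspace (closure Omega)) (cst (a k 0)) (phi k)).
  exact: cst_continuous.
by have [phic _] := phiE k; exact: phic.
Qed.

(** The embedding is an equality almost everywhere; both sides have versions continuous up to the
    closure of the cell, hence equal values at its vertices. *)
Lemma embedding_row P phi c kk (E : 'M[R]_(size (dofs P), #|` free_nodes gamma P|%fset)) i :
  disjoint_cells T0 P -> nodal_basis Omega (gamma := gamma) (P := P) phi ->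
  represents phi (@disc_basis R d P) (embedding Omega) E ->
  c \in P -> (forall i, dof (kk i) = (c, i)) ->
  row (kk i) E = node_row P (vertices c)`_i.
Proof.
move=> PD phiN Erep cP kkE; have [PT _] := PD; have cT := PT _ cP; have nz := wf cT.
apply/rowP => l; rewrite [LHS]mxE.
have sc : (vertices c)`_i \in vertices c.
  by rewrite mem_nth// size_nondegenerate//; exact: ltn_ord.
have zP : (vertices c)`_i \in nodes P by apply/mem_nodes; exists c.
pose a : 'cV[R]_#|` free_nodes gamma P|%fset := delta_mx l 0.
pose g x := \sum_i (E *m a) (kk i) 0 * barycentric (vertices c) x 0 i.
have gc : continuous g.
  apply: continuous_sumr => j x.
  by apply: (@continuousM _ _ (cst _)); [exact: cst_continuous|exact: barycentric_continuous].
have f0 : lincomb phi a (vertices c)`_i - g (vertices c)`_i = 0.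
  apply: (@ae_eq0_closure _ _ (cell_set c) (fun x => lincomb phi a x - g x)).
  - exact: open_open_simplex.
  - apply: (@continuous_subspaceW _ _ _ (closure Omega)); first exact: closure_cell.
    move=> x; apply: (@continuousB _ _ (subspace (closure Omega)) (lincomb phi a) g).
      exact: lincomb_continuous.
    exact: continuous_subspaceT.
  - apply: negligibleS (Erep a) => x; apply: contra_not => Ex xc.
    rewrite Ex; last exact: (cell_sub_domain d0 T0P cT).
    by rewrite (lincomb_disc _ PD cP kkE)// subrr.
  - exact: vertex_closure_cell.
move: f0 => /eqP; rewrite subr_eq0 (lincomb_node a phiN zP) => /eqP.
rewrite -colE mxE => ->; rewrite /g (bigD1 i)//= barycentric_vertex//.
rewrite [delta_mx 0 _ 0 _]mxE !eqxx mulr1 -colE mxE big1 ?addr0// => j ji.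
by rewrite [delta_mx 0 _ 0 _]mxE [j == i](negbTE ji) andbF mulr0.
Qed.

Lemma value_at_vertex P c kk a i : disjoint_cells T0 P -> c \in P ->
  (forall i, dof (kk i) = (c, i)) ->
  value_at c (lincomb (@disc_basis R d P) a) (vertices c)`_i = a (kk i) 0.
Proof.
move=> PD cP kkE; have [PT _] := PD; have nz := wf (PT _ cP).
have sc : (vertices c)`_i \in vertices c.
  by rewrite mem_nth// size_nondegenerate//; exact: ltn_ord.
pose g x := \sum_i a (kk i) 0 * barycentric (vertices c) x 0 i.
have gc : continuous g.
  apply: continuous_sumr => j x.
  by apply: (@continuousM _ _ (cst _)); [exact: cst_continuous|exact: barycentric_continuous].
have gE : g (vertices c)`_i = a (kk i) 0.
  rewrite /g (bigD1 i)//= barycentric_vertex// mxE !eqxx mulr1 big1 ?addr0// => j ji.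
  by rewrite mxE (negbTE ji) mulr0.
have PF : ProperFilter (within (cell_set c) (nbhs (vertices c)`_i)).
  exact: within_nbhs_proper (vertex_closure_cell (PT _ cP) sc).
rewrite /value_at; apply: cvg_lim => //; rewrite -gE.
have gw : g x @[x --> within (cell_set c) (nbhs (vertices c)`_i)] --> g (vertices c)`_i.
  exact: cvg_within_filter (gc (vertices c)`_i).
apply: cvg_trans gw; apply: near_eq_cvg; apply: filterS (withinT _ _) => x xc.
by rewrite (lincomb_disc a PD cP kkE).
Qed.

(** If [z] is not a vertex of [c], [inord] returns a default, which no sum over the cells around [z]
    meets. *)
Definition vertex_index c z : 'I_d.+1 := inord (index z (vertices c)).

Lemma nth_vertex_index c z : c.1 \in T0 -> z \in vertices c ->
  (vertices c)`_(vertex_index c z) = z.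
Proof.
move=> cT zc; rewrite /vertex_index inordK ?nth_index//.
by rewrite -(size_nondegenerate (wf cT)) index_mem.
Qed.

(** The volumes in the numerator of the average are absorbed by [q_row], which leaves an unweighted
    sum of rows that refer to cells and not to levels. *)
Lemma averaging_row P P' phi (Q : 'M[R]_(size (dofs P'), size (dofs P)))
    (H : 'M[R]_(#|` free_nodes gamma P'|%fset, size (dofs P'))) k :
  disjoint_cells T0 P -> disjoint_cells T0 P' ->
  nodal_basis Omega (gamma := gamma) (P := P') phi ->
  represents (@disc_basis R d P) (@disc_basis R d P') (L2_projection Omega P') Q ->
  represents (@disc_basis R d P') phi (averaging Omega gamma P') H ->
  row k (H *m Q) = (\sum_(c <- P' | free_node k \in vertices c) volume c)^-1 *:
    \sum_(c <- P' | free_node k \in vertices c) q_row P c (vertex_index c (free_node k)).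
Proof.
move=> PD P'D phiN Qrep Hrep; have [PT' _] := P'D.
apply/rowP => l; rewrite [LHS]mxE.
pose a : 'cV[R]_(size (dofs P)) := delta_mx l 0.
have zP := free_node_in k; have [_ _ /(_ _ zP)] := Hrep (Q *m a).
have zn : free_node k \in nodes P' by move: zP; rewrite mem_free_nodes => /andP[].
rewrite (lincomb_node _ phiN zn) node_row_free -rowE mxE mulmxA -colE mxE => ->.
rewrite mulrC mxE summxE; congr (_ * _).
rewrite big_seq_cond [RHS]big_seq_cond; apply: eq_bigr => c /andP[cP zc].
have [kk kkE] := ex_dof cP.
rewrite -{1}(nth_vertex_index (PT' _ cP) zc) (value_at_vertex _ _ P'D cP kkE).
rewrite -(q_row_projection d0 T0P _ PD P'D Qrep cP kkE) [RHS]mxE [row _ _ _ _]mxE.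
by rewrite /a -colE [col _ _ _ _]mxE.
Qed.

Lemma embedding_value P P' phi phi' a k
    (I : 'M[R]_(#|` free_nodes gamma P'|%fset, #|` free_nodes gamma P|%fset)) :
  {in P', forall c, c.1 \in T0} ->
  nodal_basis Omega (gamma := gamma) (P := P) phi ->
  nodal_basis Omega (gamma := gamma) (P := P') phi' ->
  represents phi phi' (embedding Omega) I ->
  (row k I *m a) 0 0 = lincomb phi a (free_node k).
Proof.
move=> PT' phiN phiN' Irep.
have zn : free_node k \in nodes P'.
  by have := free_node_in k; rewrite mem_free_nodes => /andP[].
have f0 : lincomb phi a (free_node k) - lincomb phi' (I *m a) (free_node k) = 0.
  apply: (@ae_eq0_closure _ _ Omega
    (fun x => lincomb phi a x - lincomb phi' (I *m a) x)) => //.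
  - move=> x.
    apply: (@continuousB _ _ (subspace (closure Omega))
      (lincomb phi a) (lincomb phi' (I *m a)));
      exact: lincomb_continuous.
  - by apply: negligibleS (Irep a) => x; apply: contra_not => Ix xO; rewrite Ix// subrr.
  - exact: node_closure zn.
move: f0 => /eqP; rewrite subr_eq0 => /eqP ->.
by rewrite (lincomb_node _ phiN' zn) node_row_free -rowE -row_mul !mxE.
Qed.

(** Basis functions are affine on the open cell and, by continuity, on its closure, which contains
    the refinement edge. *)
Lemma lincomb_midpoint P phi a c : {in P, forall c, c.1 \in T0} ->
  nodal_basis Omega (gamma := gamma) (P := P) phi -> c \in P ->
  lincomb phi a (midpoint (vertices c)) =
  2^-1 * (lincomb phi a (vertices c)`_0 + lincomb phi a (vertices c)`_d).
Proof.
move=> PT phiN cP; have cT := PT _ cP; have nz := wf cT; have sc := size_nondegenerate nz.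
have [[phiS _] phiE] := phiN.
have phim k : phi k (midpoint (vertices c)) =
    2^-1 * (phi k (vertices c)`_0 + phi k (vertices c)`_d).
  have [_ /(_ _ cP)[al [be phia]]] := phiS k.
  pose g (x : point) := \sum_i al 0 i * x 0 i + be.
  have gc : continuous g.
    have sc1 : continuous (fun x : point => \sum_i al 0 i * x 0 i).
      apply: continuous_sumr => i x.
      apply: (@continuousM _ _ (cst _)); first exact: cst_continuous.
      exact: (@coord_continuous R 1 d 0 i x).
    by move=> x; apply: (@continuousD _ _ _ (fun x : point => \sum_i al 0 i * x 0 i) (cst be));
      [exact: sc1|exact: cst_continuous].
  have phig x : closure (cell_set c) x -> phi k x = g x.
    move=> xc; apply/eqP; rewrite -subr_eq0; apply/eqP.
    apply: (@ae_eq0_closure _ _ (cell_set c) (fun x => phi k x - g x)) => //.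
    - exact: open_open_simplex.
    - apply: (@continuous_subspaceW _ _ _ (closure Omega)); first exact: closure_cell.
      move=> y; apply: (@continuousB _ _ (subspace (closure Omega)) (phi k) g).
        by have [phic _] := phiE k; exact: phic.
      exact: continuous_subspaceT.
    - by apply: aeW => y yc; rewrite phia// subrr.
  rewrite !phig; first last.
  (* The midpoint lies in the closure of the cell because it is a vertex of a child. *)
  - have mc : midpoint (vertices c) \in vertices (child c false).
      rewrite vertices_childE; apply: midpoint_bisect => //.
      exact: (cell_type_lt d0 T0P cT).
    have := @vertex_closure_cell (child c false) (midpoint (vertices c)) cT mc.
    by apply: closure_subset; exact: (child_sub d0 T0P).
  - by apply: vertex_closure_cell => //; rewrite mem_nth ?sc.
  - by apply: vertex_closure_cell => //; rewrite mem_nth ?sc.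
  rewrite /g addrACA mulrDr -big_split /=; congr (_ + _); last by lra.
  by rewrite mulr_sumr; apply: eq_bigr => i _; rewrite !mxE; ring.
rewrite /lincomb -big_split mulr_sumr; apply: eq_bigr => k _ /=.
by rewrite phim; ring.
Qed.
End NodalIdentities.

(** * The algorithm *)

Lemma lin_stepD (R : realType) n (A : seq R) (S : seq 'rV[R]_n) u v :
  1 \in A -> u \in S -> v \in S -> lin_step A S (u + v).
Proof. by move=> A1 uS vS; exists 1, 1, u, v; rewrite !scale1r. Qed.

Lemma lin_stepB (R : realType) n (A : seq R) (S : seq 'rV[R]_n) u v :
  1 \in A -> -1 \in A -> u \in S -> v \in S -> lin_step A S (u - v).
Proof. by move=> A1 AN1 uS vS; exists 1, (-1), u, v; rewrite scale1r scaleN1r. Qed.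

Lemma lin_stepZ (R : realType) n (A : seq R) (S : seq 'rV[R]_n) a u :
  0 \in A -> a \in A -> u \in S -> lin_step A S (a *: u).
Proof. by move=> A0 aA uS; exists a, 0, u, u; rewrite scale0r addr0. Qed.

Lemma reach_lincomb (R : realType) n (A : seq R) (S : seq 'rV[R]_n)
    (I : eqType) (s : seq I) (a : I -> R) (u : I -> 'rV[R]_n) :
  1 \in A -> 0 \in S -> (forall i, i \in s -> a i \in A) ->
  (forall i, i \in s -> u i \in S) ->
  reach (lin_step A) S (size s) [:: \sum_(i <- s) a i *: u i].
Proof.
move=> A1 S0; elim/last_ind: s => [|s i IH] aA uS.
  by rewrite big_nil; apply: reach_refl => v; rewrite inE => /eqP ->.
rewrite size_rcons -cats1 big_cat big_seq1 /=.
apply: reach_then_step; first exact: lin_step_sub.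
  by apply: IH => j js; [apply: aA|apply: uS]; rewrite mem_rcons inE js orbT.
exists 1, (a i), (\sum_(i <- s) a i *: u i), (u i); split => //.
- by apply: aA; rewrite mem_rcons inE eqxx.
- by rewrite inE eqxx.
- by rewrite inE uS ?orbT// mem_rcons inE eqxx.
- by rewrite scale1r.
Qed.

Section Algorithm.
Context {R : realType} {d : nat}.
Local Notation point := 'rV[R]_d.
Variables (s : R) (Omega : set point) (T0 : {fset tsimplex R d}).
Hypotheses (d0 : (0 < d)%N) (T0P : initial_partition Omega T0).

(** Real powers are not an operation of a program; with this constant the level weights become
    integer powers, computed by products. *)
Definition level_ratio : R := 2 `^ (2 * s / d%:R - 1).

(** Determined by [s], [d] and the initial partition alone: the volumes of the roots, and the ratios
    and coarsening entries for each of the [d] types. *)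
Definition constants : seq R :=
  [:: 0; 1; -1; 2^-1; level_ratio] ++ [seq simplex_volume T.1 | T <- enum_fset T0] ++
  [seq volume_ratio (d := d) (val p.1) p.2 | p <- enum {: 'I_d * bool}] ++
  [seq coarsening (val p.1.1) p.1.2 p.2.1 p.2.2 |
     p <- enum {: ('I_d * bool) * ('I_(1 + d) * 'I_(1 + d))}].

Lemma level_weightE j : 2 `^ (j%:R * (2 * s / d%:R - 1)) = level_ratio ^+ j.
Proof. by rewrite mulrC powRrM powR_mulrn ?powR_ge0. Qed.

Lemma volume_ratio_constants g b : (g < d)%N ->
  volume_ratio (R := R) (d := d) g b \in constants.
Proof.
move=> gd; rewrite !mem_cat; apply/or4P; apply: Or43.
by apply/mapP; exists (Ordinal gd, b); rewrite ?mem_enum.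
Qed.

Lemma coarsening_constants g b (i k : 'I_(1 + d)) : (g < d)%N ->
  coarsening (R := R) g b i k \in constants.
Proof.
move=> gd; rewrite !mem_cat; apply/or4P; apply: Or44.
by apply/mapP; exists ((Ordinal gd, b), (i, k)); rewrite ?mem_enum.
Qed.

Variables (P F : {fset cell R d}).
Hypothesis PF : forest T0 P F.

Let wf c : c.1 \in T0 -> nondegenerate (vertices c) := cell_nondegenerate d0 T0P (c := c).
Let rootF c : c \in F -> c.1 \in T0 := forest_root PF (c := c).
Let L := max_gen P.
Let f := #|` F|%fset.

Lemma level_disjoint_cells j : (j <= L)%N -> disjoint_cells T0 (level P j).
Proof.
move=> jL; split; first by move=> c /(level_sub PF jL)/rootF.
by move=> c c' cj cj'; exact: (level_disjoint d0 T0P PF jL).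
Qed.

Lemma leaf_disjoint_cells : disjoint_cells T0 P.
Proof. by have := level_disjoint_cells (leqnn L); rewrite level_max. Qed.

Lemma size_forest_vertices : {in F, forall c, size (vertices c) = d.+1}.
Proof. by move=> c /rootF/wf; exact: size_nondegenerate. Qed.

Lemma forest_vertices_child c z : c \in F -> z \in vertices c ->
  exists b, z \in vertices (child c b).
Proof.
move=> cF zc; have sc := size_forest_vertices cF.
have [b zb] := bisect_parent d0 sc (cell_type_lt d0 T0P (rootF cF)) zc.
by exists b; rewrite vertices_childE.
Qed.

Definition weight := vertex_sum P (fun c (_ : point) => volume c : R).

Lemma volume_gt0 c : c \in F -> 0 < volume c.
Proof. by move=> /rootF/wf/simplex_volume_gt0. Qed.

(** A program fails upon a division by zero; a cell witnessing activity belongs to its level and has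
    positive volume. *)
Lemma weight_gt0 z j : (z, j) \in active F -> 0 < weight j z.
Proof.
move=> zj; have jL := active_le PF zj; move: zj => /activeP[c [cF gc zc]].
rewrite /weight /vertex_sum (big_rem c) /=; last by rewrite (mem_level PF)// cF gc eqxx.
rewrite zc ltr_pwDl ?volume_gt0// big_seq_cond sumr_ge0// => c' /andP[/mem_rem].
by move=> /(level_sub PF jL)/volume_gt0/ltW.
Qed.

(** Level weights are listed by cell: every active level is the generation of a cell, and the power
    for its parent comes first. *)
Definition scalars : seq R :=
  [seq volume c | c <- enum_fset F] ++
  [seq weight a.2 a.1 | a <- active F] ++
  [seq (weight a.2 a.1)^-1 | a <- active F] ++
  [seq level_ratio ^+ gen c | c <- enum_fset F] ++ constants.

Let e := (f * d.+1)%N.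

(** Volumes and level weights cost [f] each, the sums of volumes [3 * e] and their inverses [e]. *)
Lemma reach_scalars : reach arith_step constants (2 * f + 4 * e) scalars.
Proof.
have sub := @arith_step_sub R.
have K1 : 1 \in constants by rewrite !inE eqxx !orbT.
have K0 : 0 \in constants by rewrite !inE eqxx.
have KR : level_ratio \in constants by rewrite !inE eqxx !orbT.
have parentF c : c \in F -> (0 < gen c)%N -> exists p b,
    [/\ c = child p b, p \in F & (gen p < gen c)%N].
  move=> cF gc; have [b [cE pF _]] := forest_parent PF cF gc.
  by exists (parent c), b; split => //; rewrite [in X in (_ < X)%N]cE /gen /= ltnSn.
have r1 : reach arith_step constants f [seq volume c | c <- enum_fset F].
  rewrite /f -[X in reach _ _ X](muln1) -sum_nat_const_seq.
  apply: (reach_ranked sub (r := @gen R d)) => c cF.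
  have [gc|gc] := posnP (gen c).
    apply: reach_refl => v; rewrite inE => /eqP ->; rewrite mem_cat; apply/orP; right.
    case: c cF gc => T t cF /eqP/nilP /= tE; subst t.
    rewrite !mem_cat; apply/or4P; apply: Or42; apply/mapP.
    by exists T => //; exact: (rootF cF).
  have [p [b [cE pF gp]]] := parentF _ cF gc; have pT := rootF pF.
  apply: reach_step; exists Mul, (volume p), (volume_ratio (d := d) (cell_type p) b); split.
  - rewrite mem_cat; apply/orP; left; apply/mapP; exists p => //.
    by rewrite mem_filter gp.
  - by rewrite mem_cat volume_ratio_constants ?orbT//; exact: (cell_type_lt d0 T0P pT).
  - rewrite /= -(simplex_volume_bisect b d0 (cell_type_lt d0 T0P pT) (wf pT)).
    by rewrite -vertices_childE cE.
set S1 := [seq volume c | c <- enum_fset F] ++ constants.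
have S1v c : c \in F -> volume c \in S1 by move=> cF; rewrite mem_cat map_f.
have r2 : reach arith_step S1 (3 * e) [seq weight a.2 a.1 | a <- active F].
  apply: (reach_vertex_sum PF size_forest_vertices forest_vertices_child sub).
  - by move=> S u v uS vS; exists Add, u, v; split.
  - by move=> S u v uS vS; exists Defs.Sub, u, v; split.
  - by rewrite mem_cat K0 orbT.
  - by move=> c cF z _; exact: S1v.
set S2 := [seq weight a.2 a.1 | a <- active F] ++ S1.
have KS2 : {subset constants <= S2} by move=> v vK; rewrite /S2 /S1 2!mem_cat vK !orbT.
have act : (size (active F) <= e)%N := size_active size_forest_vertices.
have r3 : reach arith_step S2 e [seq (weight a.2 a.1)^-1 | a <- active F].
  apply: (reach_leq sub (N := \sum_(a <- active F) 1)%N); last first.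
    by rewrite sum_nat_const_seq muln1.
  apply: (reach_tasks sub) => s1 [z j] s2 aE.
  have zj : (z, j) \in active F by rewrite aE mem_cat inE eqxx orbT.
  apply: reach_step; exists Div, 1, (weight j z); split.
  - by rewrite mem_cat KS2 ?orbT.
  - rewrite mem_cat; apply/orP; right; rewrite mem_cat; apply/orP; left.
    by apply/mapP; exists (z, j).
  - by rewrite /= gt_eqF ?weight_gt0// div1r.
set S3 := [seq (weight a.2 a.1)^-1 | a <- active F] ++ S2.
have KS3 : {subset constants <= S3} by move=> v /KS2 vK; rewrite mem_cat vK orbT.
have r4 : reach arith_step S3 f [seq level_ratio ^+ gen c | c <- enum_fset F].
  rewrite /f -[X in reach _ _ X](muln1) -sum_nat_const_seq.
  apply: (reach_ranked sub (r := @gen R d)) => c cF.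
  have [->|gc] := posnP (gen c).
    apply: reach_refl => v; rewrite inE expr0 => /eqP ->.
    by rewrite mem_cat KS3 ?orbT.
  have [p [b [cE pF gp]]] := parentF _ cF gc.
  apply: reach_step; exists Mul, (level_ratio ^+ gen p), level_ratio; split.
  - rewrite mem_cat; apply/orP; left; apply/mapP; exists p => //.
    by rewrite mem_filter gp.
  - by rewrite mem_cat KS3 ?orbT.
  - by rewrite /= cE /gen /= exprSr.
have r5 : reach arith_step ([seq level_ratio ^+ gen c | c <- enum_fset F] ++ S3) 0 constants.
  by apply: reach_refl => v vK; rewrite mem_cat KS3 ?orbT.
apply: (reach_leq sub (reach_cut sub r1 (reach_cut sub r2 (reach_cut sub r3
  (reach_cut sub r4 r5))))).
by lia.
Qed.
End Algorithm.

Lemma col_mulmx (R : pzSemiRingType) m n p (A : 'M[R]_(m, n)) (B : 'M[R]_(n, p)) l :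
  col l (A *m B) = A *m col l B.
Proof. by apply/colP => i; rewrite !mxE; apply: eq_bigr => k _; rewrite mxE. Qed.

(** * Rows of the level differences and their cost *)

Section LevelDifferences.
Context {R : realType} {d : nat}.
Local Notation point := 'rV[R]_d.
Variables (s : R) (Omega gamma : set point) (T0 : {fset tsimplex R d}).
Hypotheses (d0 : (0 < d)%N) (oOmega : open Omega) (T0P : initial_partition Omega T0).
Variables (P F : {fset cell R d}).
Hypothesis PF : forest T0 P F.
Local Notation Lv := (level P).
Local Notation L := (max_gen P).
Local Notation n_ j := #|` free_nodes gamma (Lv j)|%fset.
Local Notation m_ j := (size (dofs (Lv j))).
Local Notation n := #|` free_nodes gamma P|%fset.
Variables (phi : forall P' : {fset cell R d}, 'I_#|` free_nodes gamma P'|%fset -> point -> R)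
  (E : 'M[R]_(size (dofs P), n)) (H : forall j, 'M[R]_(n_ j, m_ j))
  (Q : forall j, 'M[R]_(m_ j, size (dofs P))) (I : forall j, 'M[R]_(n_ j, n_ j.-1)).
Arguments phi : clear implicits.
Hypothesis phiN : forall j, (j <= L)%N -> nodal_basis Omega (phi (Lv j)).
Hypothesis Erep : represents (phi P) (@disc_basis R d P) (embedding Omega) E.
Hypothesis Qrep : forall j, (j <= L)%N ->
  represents (@disc_basis R d P) (@disc_basis R d (Lv j)) (L2_projection Omega (Lv j)) (Q j).
Hypothesis Hrep : forall j, (j <= L)%N ->
  represents (@disc_basis R d (Lv j)) (phi (Lv j)) (averaging Omega gamma (Lv j)) (H j).
Hypothesis I0 : I 0%N = 0.
Hypothesis Irep : forall j, (1 <= j <= L)%N ->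
  represents (phi (Lv j.-1)) (phi (Lv j)) (embedding Omega) (I j).

Let wf c : c.1 \in T0 -> nondegenerate (vertices c) := cell_nondegenerate d0 T0P (c := c).
Let rootF c : c \in F -> c.1 \in T0 := forest_root PF (c := c).
Let LvD j : (j <= L)%N -> disjoint_cells T0 (Lv j) := level_disjoint_cells d0 T0P PF (j := j).
Let size_verticesF := size_forest_vertices d0 T0P PF.
Let vertices_childF := forest_vertices_child d0 T0P PF.
Let PD : disjoint_cells T0 P := leaf_disjoint_cells d0 T0P PF.

Let phiP : nodal_basis Omega (phi P).
Proof. by have := phiN (leqnn L); rewrite level_max. Qed.

Definition vertex_row c (z : point) : 'rV[R]_n := q_row P c (vertex_index c z) *m E.

(** Indexed by points rather than by the ordinals of a level, so that rows of different levels can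
    be compared and looked up. *)
Definition average_row j z : 'rV[R]_n :=
  if z \in gamma then 0 else (weight P j z)^-1 *: vertex_sum P vertex_row j z.

(** At most one [k] qualifies; the sum yields 0 when [z] is not a free node of level [j]. *)
Definition diff_row j z : 'rV[R]_n :=
  \sum_(k | free_node k == z :> point) row k (level_diff H Q I j *m E).

Lemma row_average j (k : 'I_(n_ j)) : (j <= L)%N ->
  row k (H j *m Q j *m E) = average_row j (free_node k).
Proof.
move=> jL; rewrite row_mul (averaging_row d0 T0P k PD (LvD jL) (phiN jL) (Qrep jL) (Hrep jL)).
have := free_node_in k; rewrite mem_free_nodes /average_row => /andP[_ /negbTE ->].
by rewrite -scalemxAl mulmx_suml.
Qed.

Lemma node_row_average j z : (j <= L)%N -> z \in nodes (Lv j) ->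
  node_row gamma (Lv j) z *m (H j *m Q j *m E) = average_row j z.
Proof.
move=> jL zj; have [zg|zg] := boolP (z \in gamma).
  by rewrite node_row_gamma// mul0mx /average_row zg.
have [|k ->] := @ex_free_node _ _ gamma (Lv j) z; first by rewrite mem_free_nodes zj.
by rewrite node_row_free -rowE row_average.
Qed.

Lemma prolongation_entry j (k : 'I_(n_ j.+1)) (u : 'cV[R]_(n_ j)) : (j < L)%N ->
  (row k (I j.+1) *m u) 0 0 = lincomb (phi (Lv j)) u (free_node k).
Proof.
move=> jL; have [PT' _] := LvD jL.
exact: (embedding_value d0 oOmega T0P u k PT' (phiN (ltnW jL)) (phiN jL)
  (Irep (j := j.+1) jL)).
Qed.

Lemma row_prolongation_old j (k : 'I_(n_ j.+1)) : (j < L)%N -> free_node k \in nodes (Lv j) ->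
  row k (I j.+1 *m (H j *m Q j *m E)) = average_row j (free_node k).
Proof.
move=> jL zj; rewrite -node_row_average ?(ltnW jL)//; apply/rowP => l.
set U := H j *m Q j *m E; rewrite row_mul.
(* The embedding is known by its action on functions; entry [l] comes from the function whose
   coefficients form column [l]. *)
transitivity ((row k (I j.+1) *m col l U) 0 0); first by rewrite -col_mulmx [RHS]mxE.
rewrite prolongation_entry// (lincomb_node _ (phiN (ltnW jL)) zj).
by rewrite -col_mulmx [LHS]mxE.
Qed.

Lemma row_prolongation_new j (k : 'I_(n_ j.+1)) c : (j < L)%N -> c \in Lv j ->
  free_node k = midpoint (vertices c) ->
  row k (I j.+1 *m (H j *m Q j *m E)) =
  2^-1 *: average_row j (vertices c)`_0 + 2^-1 *: average_row j (vertices c)`_d.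
Proof.
move=> jL cj kc; have jL' := ltnW jL; have [PT _] := LvD jL'.
have sc := size_nondegenerate (wf (PT _ cj)).
have z0 : (vertices c)`_0 \in nodes (Lv j).
  by apply/mem_nodes; exists c => //; rewrite mem_nth ?sc.
have zd : (vertices c)`_d \in nodes (Lv j).
  by apply/mem_nodes; exists c => //; rewrite mem_nth ?sc.
rewrite -!node_row_average//; apply/rowP => l.
set U := H j *m Q j *m E; rewrite row_mul.
transitivity ((row k (I j.+1) *m col l U) 0 0); first by rewrite -col_mulmx [RHS]mxE.
rewrite prolongation_entry// kc (lincomb_midpoint d0 T0P _ PT (phiN jL') cj).
rewrite !(lincomb_node _ (phiN jL'))// mulrDr -!col_mulmx.
by rewrite [in RHS]mxE; congr (_ + _); rewrite [RHS]mxE [col _ _ _ _]mxE.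
Qed.

Lemma diff_row_free j (k : 'I_(n_ j)) :
  diff_row j (free_node k) = row k (level_diff H Q I j *m E).
Proof.
rewrite /diff_row (big_pred1 k)// => l; rewrite pred1E /=.
by rewrite (inj_eq (@free_node_inj _ _ gamma (Lv j))).
Qed.

Lemma diff_row_gamma j z : z \in gamma -> diff_row j z = 0.
Proof.
move=> zg; rewrite /diff_row big_pred0// => k; apply/eqP => kz.
by have := free_node_in k; rewrite mem_free_nodes kz zg andbF.
Qed.

Lemma row_level_diff0 (k : 'I_(n_ 0)) :
  row k (level_diff H Q I 0 *m E) = average_row 0 (free_node k).
Proof. by rewrite /level_diff I0 !mul0mx subr0 row_average. Qed.

Lemma row_level_diffS j (k : 'I_(n_ j.+1)) : (j < L)%N ->
  row k (level_diff H Q I j.+1 *m E) =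
  average_row j.+1 (free_node k) - row k (I j.+1 *m (H j *m Q j *m E)).
Proof.
move=> jL; rewrite -row_average// -linearB /level_diff /= mulmxBl; congr (row k (_ - _)).
by rewrite !mulmxA.
Qed.

(** A new node belongs to a cell of generation [j.+1], whose vertices are vertices of the parent
    except for one midpoint. *)
Lemma nodes_levelS_midpoint j z : (j < L)%N -> z \in nodes (Lv j.+1) ->
  z \notin nodes (Lv j) -> exists2 c, c \in Lv j & z = midpoint (vertices c).
Proof.
move=> jL /mem_nodes[c cj zc] zj; have cF := level_sub PF jL cj.
have [gc|gc] := eqVneq (gen c) j.+1; last first.
  case/negP: zj; apply/mem_nodes; exists c => //.
  move: cj; rewrite !(mem_level PF) ?(ltnW jL)// (negbTE gc) cF /= => /andP[-> ].
  by rewrite ltnS leq_eqVlt.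
have [|b [cE pF pP]] := forest_parent PF cF; first by rewrite gc.
have pj : parent c \in Lv j.
  rewrite (mem_level PF) ?(ltnW jL)// pF /=; apply/orP; left.
  by move: gc; rewrite cE /gen /= => -[->].
exists (parent c) => //; move: zc; rewrite cE vertices_childE.
move=> /(bisect_child d0 (size_verticesF pF) (cell_type_lt d0 T0P (rootF pF))).
move=> [zp|//]; case/negP: zj; apply/mem_nodes.
by exists (parent c).
Qed.

Lemma average_row_last j z : (j <= L)%N -> z \in nodes (Lv j) ->
  exists i, [/\ (i <= j)%N, (z, i) \in active F & average_row i z = average_row j z].
Proof.
move=> jL zj; have [i [ij zi iE]] := last_active PF vertices_childF jL zj.
by exists i; split => //; rewrite /average_row /weight !iE.
Qed.

(** Such a node is old, prolongation keeps the value there, and the average has not changed. At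
    level 0 every node is active. *)
Lemma row_level_diff_inactive j (k : 'I_(n_ j)) : (j <= L)%N ->
  (free_node k, j) \notin active F -> row k (level_diff H Q I j *m E) = 0.
Proof.
have zk : free_node k \in nodes (Lv j).
  by have := free_node_in k; rewrite mem_free_nodes => /andP[].
case: j k zk => [|j] k zk jL zj; first by rewrite (active0 PF zk) in zj.
have [zA|zj'] := nodes_level_active PF jL zk; first by rewrite zA in zj.
rewrite row_level_diffS// row_prolongation_old// /average_row /weight.
by rewrite !(vertex_sum_inactive PF vertices_childF _ jL zj) subrr.
Qed.

Lemma gram_rows p q (A : 'M[R]_(p, q)) : A^T *m A = \sum_k (row k A)^T *m row k A.
Proof.
apply/matrixP => i l; rewrite mxE summxE; apply: eq_bigr => k _.
by rewrite !mxE big_ord1 !mxE.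
Qed.

(** Each level contributes the weighted Gram matrix of its rows. Rows at inactive pairs vanish, and
    active pairs off the free nodes have row 0. *)
Lemma preconditioner_sum : preconditioner s E H Q I =
  \sum_(a <- active F) level_ratio (d := d) s ^+ a.2 *:
    ((diff_row a.2 a.1)^T *m diff_row a.2 a.1).
Proof.
rewrite /preconditioner mulmx_sumr mulmx_suml.
pose G (u : 'rV[R]_n) := u^T *m u.
rewrite (eq_bigr (fun j : 'I_L.+1 => \sum_(a <- active F | a.2 == j)
    level_ratio (d := d) s ^+ a.2 *: G (diff_row a.2 a.1))); last first.
  move=> [j /= jL] _; rewrite ltnS in jL.
  transitivity (level_ratio (d := d) s ^+ j *: \sum_k G (row k (level_diff H Q I j *m E))).
    rewrite -gram_rows trmx_mul -!mulmxA level_weightE -scalemxAl -!scalemxAr.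
    by [].
  rewrite (eq_bigr (fun a : point * nat =>
    level_ratio (d := d) s ^+ j *: G (diff_row j a.1))); last first.
    by move=> [z i] /eqP /= ->.
  rewrite -scaler_sumr; congr (_ *: _).
  have GE z : G (diff_row j z) =
      \sum_(k | free_node k == z :> point) G (row k (level_diff H Q I j *m E)).
    have [k kz|none] := pickP (fun k : 'I_(n_ j) => free_node k == z).
      rewrite -(eqP kz) diff_row_free (big_pred1 k)// => l.
      by rewrite /= (inj_eq (@free_node_inj _ _ gamma (Lv j))).
    by rewrite /diff_row !big_pred0// /G mulmx0.
  rewrite (eq_bigr _ (fun a _ => GE a.1)) (exchange_big_dep xpredT)//=.
  apply: eq_bigr => k _.
  have [kA|kA] := boolP ((free_node k, j) \in active F); last first.
    by rewrite (row_level_diff_inactive jL kA) /G mulmx0 big1// => a _; rewrite mulmx0.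
  rewrite (eq_bigl (pred1 (free_node k, j))); last first.
    by move=> [z i]; rewrite /= xpair_eqE andbC eq_sym.
  rewrite big_mkcond (bigD1_seq _ kA) ?undup_uniq//= eqxx big1 ?addr0// => a.
  by rewrite /= => /negbTE ->.
rewrite (exchange_big_dep xpredT)//= [LHS]big_seq [RHS]big_seq; apply: eq_bigr => -[z j] zj.
rewrite (bigD1 (Ordinal (active_le PF zj : (_ < L.+1)%N)))//= big1 ?addr0//.
move=> i /andP[/eqP /= ji]; rewrite -val_eqE /= ji.
by rewrite eqxx.
Qed.

Let f := #|` F|%fset.
Let e := (f * d.+1)%N.
Let A := scalars s T0 P F.

Lemma constants_scalars : {subset constants s T0 <= A}.
Proof. by move=> v vK; rewrite 4!mem_cat vK !orbT. Qed.

Lemma volume_scalars c : c \in F -> volume c \in A.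
Proof. by move=> cF; rewrite mem_cat map_f. Qed.

Lemma weight_scalars z j : (z, j) \in active F -> (weight P j z)^-1 \in A.
Proof.
move=> zj; rewrite /A /scalars 3!mem_cat; apply/or4P; apply: Or43.
by apply/mapP; exists (z, j).
Qed.

Lemma level_ratio_scalars z j : (z, j) \in active F -> level_ratio (d := d) s ^+ j \in A.
Proof.
move=> /activeP[c [cF <- _]]; rewrite /A /scalars 3!mem_cat; apply/or4P; apply: Or44.
by rewrite mem_cat; apply/orP; left; apply: (map_f (fun c => _ ^+ gen c)).
Qed.

Let A1 : 1 \in A.
Proof. by apply: constants_scalars; rewrite !inE eqxx !orbT. Qed.

Let A0 : 0 \in A.
Proof. by apply: constants_scalars; rewrite !inE eqxx. Qed.

Let AN1 : -1 \in A.
Proof. by apply: constants_scalars; rewrite !inE eqxx !orbT. Qed.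

Let Ahalf : 2^-1 \in A.
Proof. by apply: constants_scalars; rewrite !inE eqxx !orbT. Qed.

Definition basis_rows : seq 'rV[R]_n := 0 :: [seq delta_mx 0 i | i <- enum 'I_n].

Definition cell_rows : seq 'rV[R]_n :=
  [seq q_row P p.1 p.2 *m E | p <- [seq (c, i) | c <- enum_fset F, i <- enum 'I_d.+1]].

Let row0 S : 0 \in S ++ basis_rows.
Proof. by rewrite mem_cat inE eqxx orbT. Qed.

Lemma node_row_basis z : z \in nodes P -> node_row gamma P z \in basis_rows.
Proof.
move=> zP; have [zg|zg] := boolP (z \in gamma).
  by rewrite node_row_gamma// inE eqxx.
have [|k ->] := @ex_free_node _ _ gamma P z; first by rewrite mem_free_nodes zP.
by rewrite node_row_free in_cons map_f ?orbT// mem_enum.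
Qed.

Lemma reach_cell_rows : reach (lin_step A) basis_rows (e * (2 * d.+1)) cell_rows.
Proof.
have sub := @lin_step_sub R n A.
have -> : e = size [seq (c, i) | c <- enum_fset F, i <- enum 'I_d.+1].
  by rewrite size_allpairs size_enum_ord.
rewrite -sum_nat_const_seq.
(* Ranking by [L - gen] processes the children before their parent. *)
apply: (reach_ranked sub (r := fun p => (L - gen p.1)%N)) => p /allpairsP[[c i] /= [cF _ ->]].
have cT := rootF cF.
have [cP|cP] := boolP (c \in P).
  have [kk kkE] := ex_dof cP; have [PT _] := PD.
  apply: (reach_leq sub (N := 1%N)); last by rewrite mulnS.
  apply: reach_step => /=.
  rewrite (q_row_leaf d0 T0P PD (kkE i)) -scalemxAl -rowE.
  rewrite (embedding_row d0 T0P i PD phiP Erep cP kkE).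
  apply: lin_stepZ => //; first exact: volume_scalars.
  rewrite mem_cat node_row_basis ?orbT//; apply/mem_nodes; exists c => //.
  by rewrite mem_nth ?size_verticesF//; exact: ltn_ord.
rewrite /= (q_row_child d0 T0P i PF PD cF cP) mulmx_suml.
have -> : \sum_(b : bool)
      (\sum_k coarsening (cell_type c) b k i *: q_row P (child c b) k) *m E =
    \sum_(p <- enum {: bool * 'I_(1 + d)}) coarsening (cell_type c) p.1 p.2 i *:
      (q_row P (child c p.1) p.2 *m E).
  rewrite big_enum /= -(pair_big xpredT xpredT (fun b k =>
    coarsening (cell_type c) b k i *: (q_row P (child c b) k *m E)))/=.
  apply: eq_bigr => b _; rewrite mulmx_suml; apply: eq_bigr => k _.
  by rewrite scalemxAl.
have [_ _ Fc _] := PF.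
(* One step for each vertex of each of the two children. *)
have -> : (2 * d.+1)%N = size (enum {: bool * 'I_(1 + d)}).
  by rewrite -cardE card_prod card_bool card_ord.
apply: reach_lincomb => //.
  move=> bk _; apply/constants_scalars/coarsening_constants.
  exact: (cell_type_lt d0 T0P cT).
move=> [b k] _; rewrite mem_cat; apply/orP; left; apply/mapP; exists (child c b, k) => //=.
have chF : child c b \in F by rewrite Fc cF cP.
rewrite mem_filter /=; apply/andP; split; last first.
  by apply/allpairsP; exists (child c b, k); rewrite mem_enum.
have := forest_gen PF chF; rewrite /gen /=; lia.
Qed.

(** After the cell rows: [3 * e] for the vertex sums, [e] for the averages, and at most two steps
    per difference. *)
Lemma reach_diff_rows : reach (lin_step A) basis_rows (e * (2 * d.+1) + 6 * e)
  [seq diff_row a.2 a.1 | a <- active F].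
Proof.
have sub := @lin_step_sub R n A.
set S1 := cell_rows ++ basis_rows.
have r2 : reach (lin_step A) S1 (3 * e) [seq vertex_sum P vertex_row a.2 a.1 | a <- active F].
  apply: (reach_vertex_sum PF size_verticesF vertices_childF sub).
  - by move=> S u v; exact: lin_stepD.
  - by move=> S u v; exact: lin_stepB.
  - exact: row0.
  - move=> c cF z zc; rewrite mem_cat; apply/orP; left; apply/mapP.
    exists (c, vertex_index c z) => //; apply/allpairsP.
    by exists (c, vertex_index c z); rewrite mem_enum.
set S2 := [seq vertex_sum P vertex_row a.2 a.1 | a <- active F] ++ S1.
have row02 S : 0 \in S ++ S2 by rewrite mem_cat /S2 mem_cat row0 !orbT.
have act : (size (active F) <= e)%N := size_active size_verticesF.
have r3 : reach (lin_step A) S2 e [seq average_row a.2 a.1 | a <- active F].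
  apply: (reach_leq sub (N := \sum_(a <- active F) 1)%N); last first.
    by rewrite sum_nat_const_seq muln1.
  apply: (reach_tasks sub) => s1 [z j] s2 aE.
  have zj : (z, j) \in active F by rewrite aE mem_cat inE eqxx orbT.
  rewrite /= /average_row; case: ifP => _.
    by apply: reach_refl => v; rewrite inE => /eqP ->.
  apply: reach_step; apply: lin_stepZ => //; first exact: weight_scalars.
  rewrite mem_cat; apply/orP; right; rewrite mem_cat; apply/orP; left.
  by apply/mapP; exists (z, j).
set S3 := [seq average_row a.2 a.1 | a <- active F] ++ S2.
(* Averages were computed at active pairs only; any other one equals the average at the last active
   level. *)
have avgS3 j z : (j <= L)%N -> z \in nodes (Lv j) -> average_row j z \in S3.
  move=> jL /(average_row_last jL)[i [_ zi <-]]; rewrite mem_cat; apply/orP; left.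
  by apply/mapP; exists (z, i).
have r4 : reach (lin_step A) S3 (2 * e) [seq diff_row a.2 a.1 | a <- active F].
  apply: (reach_leq sub (N := \sum_(a <- active F) 2)%N); last first.
    by rewrite sum_nat_const_seq mulnC leq_mul2l.
  apply: (reach_tasks sub) => s1 [z j] s2 aE.
  have zj : (z, j) \in active F by rewrite aE mem_cat inE eqxx orbT.
  apply: (reach_sub sub (S0 := S3)); last by move=> v vS; rewrite mem_cat vS orbT.
  have jL := active_le PF zj; rewrite /= in jL *.
  have [zg|zg] := boolP (z \in gamma).
    by rewrite diff_row_gamma//; apply: reach_refl => v; rewrite inE => /eqP ->; exact: row02.
  have zn : z \in nodes (Lv j).
    move: zj => /activeP[c [cF gc zc]]; apply/mem_nodes; exists c => //.
    by rewrite (mem_level PF)// cF gc eqxx.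
  have [|k zk] := @ex_free_node _ _ gamma (Lv j) z; first by rewrite mem_free_nodes zn.
  rewrite zk diff_row_free; case: j jL zn k zk {zj aE} => [|j] jL zn k zk.
    rewrite row_level_diff0 -zk; apply: reach_refl => v; rewrite inE => /eqP ->.
    exact: avgS3.
  have jL' := ltnW jL; rewrite row_level_diffS//.
  have [zo|zo] := boolP (z \in nodes (Lv j)).
    rewrite row_prolongation_old -?zk//.
    apply: (reach_leq sub (N := 1%N)) => //; apply: reach_step.
    by apply: lin_stepB => //; exact: avgS3.
  have [c cj zE] := nodes_levelS_midpoint jL zn zo.
  rewrite (row_prolongation_new jL cj) -?zk//.
  have cF := level_sub PF jL' cj; have sc := size_verticesF cF.
  (* At a new node the prolongation is the mean of the averages at the two ends of the refinement
     edge: one step for it, one for the difference. *)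
  apply: (reach_then_step sub (T := [:: 2^-1 *: average_row j (vertices c)`_0 +
      2^-1 *: average_row j (vertices c)`_d])).
    apply: reach_step; exists 2^-1, 2^-1, (average_row j (vertices c)`_0),
      (average_row j (vertices c)`_d).
    split=> //; apply: avgS3 => //; apply/mem_nodes; exists c => //;
      by rewrite mem_nth ?sc.
  apply: lin_stepB => //; last by rewrite inE eqxx.
  by rewrite in_cons avgS3 ?orbT.
apply: (reach_leq sub (reach_cutr sub reach_cell_rows (reach_cutr sub r2
  (reach_cutr sub r3 r4)))).
by lia.
Qed.

(** With [D = d.+1] and [e = f * D], the bound of [computes_gram] is [(2 * f + 4 * e) + 7 * (2 * D *
    e + 6 * e) + 2 * e], that is [2 * f + 48 * e + 14 * D * e]. *)
Lemma computes_preconditioner : exists (prog : seq instruction) out,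
  (size prog <= #|` F|%fset * (2 + d.+1 * (48 + 14 * d.+1)))%N /\
  computes (constants s T0) prog out (preconditioner s E H Q I).
Proof.
pose Y := [seq (level_ratio (d := d) s ^+ a.2, diff_row a.2 a.1) | a <- active F].
have [|||||prog [out [szp cp]]] := @computes_gram R (constants s T0) A n
    (preconditioner s E H Q I) Y (2 * f + 4 * e) (e * (2 * d.+1) + 6 * e).
- by rewrite !inE eqxx.
- exact: (reach_scalars s d0 T0P PF).
- have -> : [seq y.2 | y <- Y] = [seq diff_row a.2 a.1 | a <- active F].
    by rewrite /Y -map_comp.
  exact: reach_diff_rows.
- rewrite -map_comp => _ /mapP[[z j] zj ->]; exact: level_ratio_scalars zj.
- by rewrite preconditioner_sum big_map.
exists prog, out; split => //; apply: leq_trans szp _.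
have : (size Y <= e)%N by rewrite size_map (size_active size_verticesF).
rewrite /e -/f; move: (d.+1) => D.
have -> : (f * (2 + D * (48 + 14 * D)) = 2 * f + 48 * (f * D) + 14 * (f * D * D))%N by ring.
have -> : (f * D * (2 * D) = 2 * (f * D * D))%N by ring.
move: (f * D * D)%N => x; move: (f * D)%N => y.
by move: (size Y) (f) => w v; lia.
Qed.
End LevelDifferences.

Theorem proposition3p4 (R : realType) (d : nat) (s : R)
    (Omega gamma : set 'rV[R]_d) (T0 : {fset tsimplex R d}) :
  (1 <= d)%N -> 0 <= s <= 1 ->
  domain Omega -> initial_partition Omega T0 ->
  dirichlet_boundary Omega gamma T0 ->
  exists (C : nat) (K : seq R),
  forall P : {fset cell R d}, admissible Omega T0 P ->
  forall (phi : forall P' : {fset cell R d},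
            'I_#|` free_nodes gamma P'|%fset -> 'rV[R]_d -> R)
         (E : 'M[R]_(size (dofs P), #|` free_nodes gamma P|%fset))
         (H : forall j, 'M[R]_(#|` free_nodes gamma (level P j)|%fset,
                               size (dofs (level P j))))
         (Q : forall j, 'M[R]_(size (dofs (level P j)), size (dofs P)))
         (I : forall j, 'M[R]_(#|` free_nodes gamma (level P j)|%fset,
                               #|` free_nodes gamma (level P j.-1)|%fset)),
  (forall j, (j <= max_gen P)%N -> nodal_basis Omega (phi (level P j))) ->
  represents (phi P) (@disc_basis R d P) (embedding Omega) E ->
  (forall j, (j <= max_gen P)%N ->
    represents (@disc_basis R d P) (@disc_basis R d (level P j))
      (L2_projection Omega (level P j)) (Q j)) ->
  (forall j, (j <= max_gen P)%N ->
    represents (@disc_basis R d (level P j)) (phi (level P j))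
      (averaging Omega gamma (level P j)) (H j)) ->
  I 0%N = 0 ->
  (forall j, (1 <= j <= max_gen P)%N ->
    represents (phi (level P j.-1)) (phi (level P j)) (embedding Omega) (I j)) ->
  exists (prog : seq instruction) out,
    (size prog <= C * #|` P|%fset)%N /\
    computes K prog out (preconditioner s E H Q I).
Proof.
move=> d0 _ [oOmega _ _] T0P _.
(* The leading 2 bounds the nodes of the forest by the leaves. *)
exists (2 * (2 + d.+1 * (48 + 14 * d.+1)))%N, (constants s T0).
move=> P [/ex_forest[F PF] _] phi E H Q I phiN Erep Qrep Hrep I0 Irep.
have [prog [out [szp cp]]] :=
  computes_preconditioner s d0 oOmega T0P PF phiN Erep Qrep Hrep I0 Irep.
exists prog, out; split => //; apply: leq_trans szp _.
have [_ _ _ F2] := PF.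
by rewrite mulnAC leq_mul2r F2 orbT.
Qed.
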